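(* Let $M$ be a 1-cusped hyperbolic 3-manifold with an epimorphism $\alpha:\pi_1(M)\twoheadrightarrow\mathbb{Z}$ and an ideal triangulation $\mathcal{T}$ admitting a geometric solution, and let $\sigma$ be an obstruction cocycle. Then $$\tau^{\mathrm{CS}}_\lambda(\mathcal{T})=\pm\frac{1}{c_1\cdots c_N}\left.\frac{d}{dt}\right|_{t=1}\det\left(\frac{\partial p^\sigma_i}{\partial c_j}\right),\qquad 1\le i,j\le N+L,$$ where $\lambda$ is the peripheral curve satisfying $\alpha(\lambda)=0$ and the right-hand side is evaluated at a point $(c_1,\dots,c_{N+L})\in(\mathbb{C}^* )^{N+L}$ corresponding to the geometric solution of $\mathcal{T}$.
   Context: **1-loop invariant.** $M$ is oriented; $\mathcal{T}$ has edges $e_1,\dots,e_N$ and tetrahedra $\Delta_1,\dots,\Delta_N$. Choose for each $\Delta_j$ a pair of opposite edges (quad type); assign $z_j$ to that pair and $z_j'=\frac1{1-z_j}$, $z_j''=1-\frac1{z_j}$ to the other two pairs of opposite edges, in the cyclic order around each ideal vertex determined by the orientation (the usual cross-ratio convention), $z_j\in\mathbb{C}\setminus\{0,1\}$. For $\square\in\{\ ,{}',{}''\}$, $\mathbf{G}^\square$ is the $N\times N$ matrix whose $(i,j)$-entry is the number of edges of $\Delta_j$ with parameter $z_j^\square$ incident to $e_i$. The gluing equation of $e_i$ is $\prod_jz_j^{\mathbf{G}_{ij}}z_j'^{\mathbf{G}'_{ij}}z_j''^{\mathbf{G}''_{ij}}=1$. Each peripheral curve $\gamma$ (oriented, homotopically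 non-trivial simple closed curve in the peripheral torus) has row vectors $\mathbf{C}_\gamma^\square\in\mathbb{Z}^N$ such that its completeness equation is $\prod_jz_j^{\mathbf{C}_{\gamma j}}z_j'^{\mathbf{C}'_{\gamma j}}z_j''^{\mathbf{C}''_{\gamma j}}=1$. A solution of $\mathcal{T}$ satisfies all gluing and completeness equations; it is geometric if its holonomy is the geometric representation $\pi_1(M)\to\mathrm{PSL}_2(\mathbb{C})$. A combinatorial flattening is a triple $f,f',f''\in\mathbb{Z}^N$ with $f+f'+f''=(1,\dots,1)^T$, $\mathbf{G}f+\mathbf{G}'f'+\mathbf{G}''f''=(2,\dots,2)^T$ and $\mathbf{C}_\gamma f+\mathbf{C}_\gamma'f'+\mathbf{C}_\gamma''f''=0$ for all $\gamma$; one always exists. Let $\zeta_j=\frac1{z_j}$, $\zeta_j'=\frac1{1-z_j}$, $\zeta_j''=\frac1{z_j(z_j-1)}$, and let $\widehat{\mathbf{G}}^\square$ be obtained from $\mathbf{G}^\square$ by replacing one row (the same one for each $\square$) by $\mathbf{C}_\gamma^\square$. The 1-loop invariant is $$\tau^{\mathrm{CS}}_\gamma(\mathcal{T})=\frac12\,\frac{\det\big(\widehat{\mathbf{G}}\,\mathrm{diag}(\zeta)+\widehat{\mathbf{G}}'\mathrm{diag}(\zeta')+\widehat{\mathbf{G}}''\mathrm{diag}(\zeta'')\big)}{\prod_{j}\zeta_j^{f_j}\zeta_j'^{f_j'}\zeta_j''^{f_j''}}$$ evaluated at the geometric solution; it is well-defined up to sign. **$\sigma$-Ptolemy assignments.**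 Let $\overline M$ be the compact manifold with torus boundary whose interior is $M$; truncating the tetrahedra of $\mathcal{T}$ decomposes $\overline M$ into truncated tetrahedra whose triangular faces triangulate $\partial\overline M$. Edges of $\partial\overline M$ are called short-edges; $\mathcal{E}(X)$ is the set of oriented edges of $X$. A cocycle $\sigma:\mathcal{E}(\partial\overline M)\to\{\pm1\}$ satisfies $\sigma(-e)=\sigma(e)^{-1}$ and has product $1$ around each triangle; it induces a homomorphism $\sigma:\pi_1(\partial\overline M)\to\{\pm1\}$. It is an obstruction cocycle if for some lift $\rho:\pi_1(M)\to\mathrm{SL}_2(\mathbb{C})$ of the geometric representation, up to conjugation $\rho(\gamma)=\begin{pmatrix}\sigma(\gamma)&*\\0&\sigma(\gamma)^{-1}\end{pmatrix}$ for all $\gamma\in\pi_1(\partial\overline M)$. For a tetrahedron $\Delta=[v_0,v_1,v_2,v_3]$ (labelled compatibly with orientation), $l_{ij}$ is the oriented edge from $v_i$ to $v_j$ and $s_{ijk}$ is the oriented short-edge at $v_j$ from $l_{ij}$ to $l_{jk}$. Given $c:\mathcal{E}(\Delta)\to\mathbb{C}^*$ with $c(-e)=-c(e)$, the $\sigma$-Ptolemy equation of $\Delta$ is $$c(l_{02})c(l_{13})-\frac{\sigma(s_{031})\sigma(s_{302})}{\sigma(s_{312})\sigma(s_{021})}c(l_{03})c(l_{12})-\frac{\sigma(s_{013})\sigma(s_{102})}{\sigma(s_{132})\sigma(s_{023})}c(l_{01})c(l_{23})=0 .$$ A $\sigma$-Ptolemy assignment of $\mathcal{T}$ is $c:\mathcal{E}(\mathcal{T})\to\mathbb{C}^*$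 with $c(-e)=-c(e)$ satisfying this equation for all tetrahedra. It determines shape parameters: the shape parameter of $\Delta$ at $l_{13}$ (and $l_{02}$) is $z=-\frac{\sigma(s_{103})\sigma(s_{321})}{\sigma(s_{032})\sigma(s_{210})}\frac{c(l_{01})c(l_{23})}{c(l_{03})c(l_{12})}$; with this quad type, $z'$ is at $l_{01},l_{23}$ and $z''$ at $l_{03},l_{12}$ (''compatibly with orientation'' means that this matches the convention above). These form a solution of $\mathcal{T}$; $c$ corresponds to the geometric solution if that solution is geometric. For an obstruction cocycle such a $c$ exists. **The functions $p_i^\sigma$.** Let $\widetilde M$ be the infinite cyclic cover of $M$ corresponding to $\ker\alpha$, with lifted triangulation $\widetilde{\mathcal{T}}$ and generator $g$ of the deck group $\mathbb{Z}$. Choose a fundamental domain of $M$ in $\widetilde M$, giving lifts $\widetilde e_i,\widetilde\Delta_j$ ($1\le i,j\le N$). Let $\widetilde e_{N+1},\dots,\widetilde e_{N+L}$ be the edges of $\widetilde\Delta_1,\dots,\widetilde\Delta_N$ other than $\widetilde e_1,\dots,\widetilde e_N$. For $N+1\le i\le N+L$ there are unique $1\le j(i)\le N$ and $k(i)\in\mathbb{Z}$ with $\widetilde e_i=g^{k(i)}\cdot\widetilde e_{j(i)}$. Orient the edges of $\mathcal{T}$, orient those of $\widetilde{\mathcal{T}}$ accordingly, and assign a variable $c_i$ to each $\widetilde e_i$, $1\le i\le N+L$. For $1\le i\le N$, $p_i^\sigma$ is the left-hand side of the $\sigma$-Ptolemy equation of $\widetilde\Delta_i$ in these variables; for $N+1\le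 i\le N+L$, $p_i^\sigma=c_i-t^{-k(i)}c_{j(i)}$. A $\sigma$-Ptolemy assignment $c$ of $\mathcal{T}$ gives the point $(c_1,\dots,c_{N+L})$ with $c_i=c(e_i)$ for $i\le N$ and $c_i=c_{j(i)}$ for $i>N$; a point corresponds to the geometric solution if it arises in this way from such a $c$.
   Formalization: Added hypothesis: α maps the peripheral subgroup π_1 of the boundary torus onto Z. If its image there is dZ with d ≠ 1, the right-hand side equals ±d·τ_λ, so the claim as stated fails (a 4-tetrahedron example has d = 2). *)

(* Defs.v *)
From HB Require Import structures.
From mathcomp Require Import all_boot all_order all_algebra perm.
From mathcomp Require Import all_classical all_reals all_analysis.
From mathcomp Require Import complex.

Set Implicit Arguments.
Unset Strict Implicit.
Unset Printing Implicit Defensive.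

Import Order.TTheory GRing.Theory Num.Theory.
Import numFieldNormedType.Exports.

Local Open Scope classical_set_scope.
Local Open Scope ring_scope.

(* The complex numbers R[i], packed as a [numClosedFieldType] so that the      *)
(* topology that MathComp-Analysis puts on any such field is inferred.         *)
Definition Cx (R : realType) : numClosedFieldType := complex.complex R.

Definition v0 : 'I_4 := @Ordinal 4 0 isT.
Definition v1 : 'I_4 := @Ordinal 4 1 isT.
Definition v2 : 'I_4 := @Ordinal 4 2 isT.
Definition v3 : 'I_4 := @Ordinal 4 3 isT.

(** * Oriented ideal triangulations *)

(* Face [f] of a tetrahedron is the one opposite to its vertex [f].  It is     *)
(* glued to a face of [nb j f]; [gl j f] sends a vertex [a != f] of the face   *)
(* to the vertex it is identified with, and [f] to the vertex of [nb j f]      *)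
(* opposite to the glued face.  All tetrahedra are labelled compatibly with    *)
(* the orientation, hence [gl j f] is odd.                                     *)
Record triangulation (N : nat) := Triangulation {
  nb : 'I_N -> 'I_4 -> 'I_N;
  gl : 'I_N -> 'I_4 -> {perm 'I_4};
  nbK : forall j f, nb (nb j f) (gl j f f) = j;
  glK : forall j f, gl (nb j f) (gl j f f) = (gl j f)^-1%g;
  gl_fixfree : forall j f, (nb j f, gl j f f) != (j, f);
  gl_odd : forall j f, odd_perm (gl j f)
}.

(* A path of the dual graph, starting in tetrahedron [j], is the sequence of   *)
(* the faces it crosses. [tgt] is its last tetrahedron, [tr] the composite of  *)
(* the gluing permutations.                                                    *)
Fixpoint tgt N (T : triangulation N) (j : 'I_N) (r : seq 'I_4) : 'I_N :=
  if r is f :: r' then tgt T (nb T j f) r' else j.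

Fixpoint tr N (T : triangulation N) (j : 'I_N) (r : seq 'I_4) (a : 'I_4) : 'I_4 :=
  if r is f :: r' then tr T (nb T j f) r' (gl T j f a) else a.

(* [pivots T j r S]: along [r] only faces containing the vertices of [S]       *)
(* (transported) are crossed, i.e. [r] stays in the star of the simplex [S].   *)
Fixpoint pivots N (T : triangulation N) (j : 'I_N) (r : seq 'I_4)
    (S : {set 'I_4}) : bool :=
  if r is f :: r' then (f \notin S) && pivots T (nb T j f) r' (gl T j f @: S)
  else true.

Fixpoint rev_path N (T : triangulation N) (j : 'I_N) (r : seq 'I_4) : seq 'I_4 :=
  if r is f :: r' then rcons (rev_path T (nb T j f) r') (gl T j f f) else [::].

(* [(j, a, b)] is the oriented edge l_ab of the j-th tetrahedron. *)
Definition oedge (N : nat) : Type := ('I_N * 'I_4 * 'I_4)%type.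

Definition flip A (x : A * 'I_4 * 'I_4) : A * 'I_4 * 'I_4 := (x.1.1, x.2, x.1.2).

Definition same_edge N (T : triangulation N) (x y : oedge N) : Prop :=
  exists r, [/\ pivots T x.1.1 r [set x.1.2; x.2]%SET, tgt T x.1.1 r = y.1.1,
                tr T x.1.1 r x.1.2 = y.1.2 & tr T x.1.1 r x.2 = y.2].

(* [x] is glued to the i-th edge, with either orientation. *)
Definition on_edge N (T : triangulation N) (e : 'I_N -> oedge N) (x : oedge N)
    (i : 'I_N) : Prop :=
  same_edge T x (e i) \/ same_edge T x (flip (e i)).

(* [T] triangulates a connected oriented 3-manifold with a single cusp, and    *)
(* [e] enumerates its edges, each with a chosen orientation.                   *)
(* The link of the unique ideal vertex is a connected closed oriented surface  *)
(* with 4N triangles, 6N sides and two vertices per edge of [T]; as [T] has as *)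
(* many edges as tetrahedra, its Euler characteristic is 0: it is a torus.     *)
Definition one_cusped N (T : triangulation N) (e : 'I_N -> oedge N) : Prop :=
  [/\ forall j v j' v', exists r,
        [/\ pivots T j r [set v]%SET, tgt T j r = j' & tr T j r v = v'],
      forall j a b, a != b -> ~ same_edge T (j, a, b) (j, b, a),
      forall i, (e i).1.2 != (e i).2 &
      forall x : oedge N, x.1.2 != x.2 -> exists! i, on_edge T e x i].

(** * Fundamental groups *)

(* The closed paths in the star of an edge, which bound in that star.          *)
(* Backtracking is the special case of a path crossing one face back and forth.*)
Definition star_loop N (T : triangulation N) (j : 'I_N) (c : seq 'I_4) : Prop :=
  exists a b, [/\ a != b, pivots T j c [set a; b]%SET, tgt T j c = j,
                  tr T j c a = a & tr T j c b = b].

(* Homotopy of paths starting in tetrahedron [j], within the star of [S].      *)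
(* With [S] empty this is homotopy in M (i.e. in the dual 2-complex).  With    *)
(* [S = {v}] the paths are those of the dual graph of the triangulation of the *)
(* peripheral torus starting in the triangle at vertex [v], and this is        *)
(* homotopy in that torus.                                                     *)
Inductive homotopic N (T : triangulation N) (j : 'I_N) (S : {set 'I_4}) :
    seq 'I_4 -> seq 'I_4 -> Prop :=
| homotopic_refl r : pivots T j r S -> homotopic T j S r r
| homotopic_sym r s : homotopic T j S r s -> homotopic T j S s r
| homotopic_trans r s u :
    homotopic T j S r s -> homotopic T j S s u -> homotopic T j S r u
| homotopic_star r c s : star_loop T (tgt T j r) c ->
    pivots T j (r ++ c ++ s) S -> homotopic T j S (r ++ c ++ s) (r ++ s).

(* Loops based at the tetrahedron [b] represent the elements of pi_1(M). *)
Definition loop N (T : triangulation N) (b : 'I_N) (w : seq 'I_4) : Prop :=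
  tgt T b w = b.

(* [alpha] is (the function on loops inducing) an epimorphism pi_1(M) -> Z. *)
Definition is_epimorphism N (T : triangulation N) (b : 'I_N)
    (alpha : seq 'I_4 -> int) : Prop :=
  [/\ forall u w, loop T b u -> loop T b w -> alpha (u ++ w) = alpha u + alpha w,
      forall u w, loop T b u -> homotopic T b finset.set0 u w -> alpha u = alpha w &
      forall n, exists2 w, loop T b w & alpha w = n].

(* The restriction of [alpha] to the peripheral subgroup is onto.  (When its   *)
(* image is d Z, the derivative at t = 1 is d times the 1-loop invariant.)     *)
Definition peripherally_onto N (T : triangulation N) (b : 'I_N)
    (alpha : seq 'I_4 -> int) : Prop :=
  forall n, exists w, [/\ loop T b w, pivots T b w [set v0]%SET,
                          tr T b w v0 = v0 & alpha w = n].

(** * Hyperbolic geometry *)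

(* (x, y, t) with t > 0 stands for the point (x + iy, t) of hyperbolic space. *)
Definition hspace (R : realType) : Type := (R * R * R)%type.

Definition moebius (R : realType) (A : 'M[Cx R]_2) (p : hspace R) : hspace R :=
  let w : Cx R := complex.Complex p.1.1 p.1.2 in
  let t : Cx R := complex.Complex p.2 0 in
  let q : Cx R := A 1 0 * w + A 1 1 in
  let d : R := complex.Re (`|q| ^+ 2 + `|A 1 0| ^+ 2 * t ^+ 2 : Cx R) in
  let u : Cx R := (A 0 0 * w + A 0 1) * q^* + A 0 0 * (A 1 0)^* * t ^+ 2 in
  (complex.Re u / d, complex.Im u / d, p.2 / d).

Definition hyperbolic_volume (R : realType)
    (D : set (measurableTypeR R * measurableTypeR R * measurableTypeR R)) : \bar R :=
  (\int[((@lebesgue_measure R) \x (@lebesgue_measure R)) \x (@lebesgue_measure R)]_(p in D)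
     ((p.2 : R) ^- 3)%:E)%E.

Definition finite_covolume (R : realType) N (T : triangulation N) (b : 'I_N)
    (rho : seq 'I_4 -> 'M[Cx R]_2) : Prop :=
  exists D : set (measurableTypeR R * measurableTypeR R * measurableTypeR R),
    [/\ measurable D, forall p, D p -> 0 < (p.2 : R), (hyperbolic_volume D < +oo)%E &
        forall p : hspace R, 0 < p.2 -> exists w q,
          [/\ loop T b w, D q & p = moebius (rho w) q]].

(* A simplex without its vertices, in barycentric coordinates. *)
Definition ideal_simplex (R : realType) : set 'rV[R]_4 :=
  [set x | [/\ forall a, 0 <= x 0 a, forall a, x 0 a < 1 & \sum_a x 0 a = 1]].

(* A point of the universal cover of M is a pair (p, x) of a path [p] from the *)
(* base tetrahedron and a point [x] of the last tetrahedron of [p].            *)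
Definition same_point (R : realType) N (T : triangulation N) (b : 'I_N)
    (p : seq 'I_4) (x : 'rV[R]_4) (q : seq 'I_4) (y : 'rV[R]_4) : Prop :=
  exists r, [/\ pivots T (tgt T b p) r [set a | x 0 a != 0]%SET,
                homotopic T b finset.set0 (p ++ r) q &
                forall a, y 0 (tr T (tgt T b p) r a) = x 0 a].

Definition barycentric (R : realType) (y : 'rV[R]_3) : 'rV[R]_4 :=
  row_mx (1 - \sum_i y 0 i)%:M y : 'rV[R]_(1 + 3).

Definition coords (R : realType) (p : hspace R) : 'rV[R]_3 :=
  \row_(i < 3) nth 0 [:: p.1.1; p.1.2; p.2] i.

(* [rho] is the geometric representation of the oriented manifold M: the       *)
(* holonomy of a complete hyperbolic structure of finite volume, given by an   *)
(* equivariant orientation-preserving homeomorphism [dev] from the universal   *)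
(* cover onto hyperbolic space.  ([dev] is a continuous bijection between      *)
(* 3-manifolds, hence a homeomorphism, and its orientation character can be    *)
(* read off at any one point where it has a nonzero Jacobian.)                 *)
(* Only the classes of the matrices in PSL_2 matter here.                      *)
Definition geometric_representation (R : realType) N (T : triangulation N)
    (b : 'I_N) (rho : seq 'I_4 -> 'M[Cx R]_2) : Prop :=
  (forall w, loop T b w -> \det (rho w) = 1) /\ finite_covolume T b rho /\
  exists dev : seq 'I_4 -> 'rV[R]_4 -> hspace R,
  (forall p x, ideal_simplex x -> 0 < (dev p x).2) /\
  (forall p, {within ideal_simplex (R := R), continuous (dev p)}) /\
  (forall p x q y, ideal_simplex x -> ideal_simplex y ->
     (dev p x = dev q y <-> same_point T b p x q y)) /\
  (forall h : hspace R, 0 < h.2 -> exists p x, ideal_simplex x /\ dev p x = h) /\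
  (forall w p x, loop T b w -> ideal_simplex x ->
     dev (w ++ p) x = moebius (rho w) (dev p x)) /\
  (exists p y, let F := fun y => coords (dev p (barycentric y)) in
     [/\ forall a, 0 < barycentric y 0 a, differentiable F y &
         0 < \det (jacobian F y)]).

(** * Shape parameters and gluing equations *)

(* The three pairs of opposite edges: {l02, l13}, {l01, l23}, {l03, l12}. *)
Definition edge_kind (a b : 'I_4) : 'I_3 :=
  if ~~ odd (a + b) then 0 else if (a + b == 3)%N then 2%:R else 1.

(* z, z' and z'' *)
Definition shape_param (F : fieldType) (k : 'I_3) (z : F) : F :=
  nth 0 [:: z; (1 - z)^-1; 1 - z^-1] k.

(* zeta, zeta' and zeta'' *)
Definition zeta (F : fieldType) (k : 'I_3) (z : F) : F :=
  nth 0 [:: z^-1; (1 - z)^-1; (z * (z - 1))^-1] k.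

(* The quad types are arbitrary: z_j is assigned to the pair of opposite edges *)
(* [qd j], and z_j', z_j'' to the next ones in cyclic order, so that the edge  *)
(* [ab] of the j-th tetrahedron carries                                        *)
(*   [shape_param (edge_kind a b - qd j) (z j)].                               *)
Definition edge_shape (F : fieldType) N (qd : 'I_N -> 'I_3) (z : 'I_N -> F)
    (j : 'I_N) (a b : 'I_4) : F :=
  shape_param (edge_kind a b - qd j) (z j).

(* G, G' and G'' *)
Definition gluing_mx N (T : triangulation N) (e : 'I_N -> oedge N)
    (qd : 'I_N -> 'I_3) (k : 'I_3) : 'M[int]_N :=
  \matrix_(i, j) #|[set ab : 'I_4 * 'I_4 |
     [&& (ab.1 < ab.2)%N, edge_kind ab.1 ab.2 - qd j == k &
         `[< on_edge T e (j, ab.1, ab.2) i >]]]%SET|%:Z.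

(* Sign of the permutation (0,1,2,3) |-> (a,b,c,d), for distinct a, b, c, d. *)
Definition sign4 (a b c d : 'I_4) : int :=
  sgz ((b%:Z - a%:Z) * (c%:Z - a%:Z) * (d%:Z - a%:Z) *
       (c%:Z - b%:Z) * (d%:Z - b%:Z) * (d%:Z - c%:Z)).

(* An arc in the triangle cutting off the vertex [avtx] of the tetrahedron     *)
(* [atet]: it enters through face [ain], leaves through face [aout], and       *)
(* hence cuts off the corner of the triangle at the edge [avtx acor].          *)
Record arc (N : nat) := Arc {
  atet : 'I_N; avtx : 'I_4; acor : 'I_4; ain : 'I_4; aout : 'I_4 }.

Record curve (N : nat) := Curve { clen : nat; carc : 'I_clen.+1 -> arc N }.
Arguments carc {N} c _.

Definition closed_curve N (T : triangulation N) (g : curve N) : Prop :=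
  forall i, let x := carc g i in let y := carc g (ordS i) in
  [/\ uniq [:: avtx x; acor x; ain x; aout x],
      atet y = nb T (atet x) (aout x),
      avtx y = gl T (atet x) (aout x) (avtx x) &
      ain y = gl T (atet x) (aout x) (aout x)].

(* The arcs can be realised by pairwise disjoint straight segments: in         *)
(* barycentric coordinates of the triangles, the i-th arc goes from [P i] to   *)
(* the starting point of the next arc (pulled back by the gluing).             *)
Definition simple_curve (R : realType) N (T : triangulation N) (g : curve N) : Prop :=
  exists P : 'I_(clen g).+1 -> 'I_4 -> R,
  let Q i a := P (ordS i) (gl T (atet (carc g i)) (aout (carc g i)) a) in
  (forall i, let x := carc g i in
     [/\ P i (avtx x) = 0, P i (ain x) = 0, 0 < P i (acor x), 0 < P i (aout x) &
         P i (acor x) + P i (aout x) = 1]) /\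
  (forall i i' s s', i != i' ->
     atet (carc g i) = atet (carc g i') -> avtx (carc g i) = avtx (carc g i') ->
     0 <= s <= 1 -> 0 <= s' <= 1 ->
     exists a, (1 - s) * P i a + s * Q i a != (1 - s') * P i' a + s' * Q i' a).

Definition curve_word N (g : curve N) : seq 'I_4 :=
  [seq aout (carc g i) | i <- enum 'I_(clen g).+1].

Definition peripheral_curve (R : realType) N (T : triangulation N) (g : curve N) : Prop :=
  [/\ closed_curve T g, simple_curve R T g &
      ~ homotopic T (atet (carc g ord0)) [set avtx (carc g ord0)]%SET
          (curve_word g) [::]].

(* alpha(g) = 0, for the curve joined to the base tetrahedron by any path. *)
Definition alpha_vanishes N (T : triangulation N) (b : 'I_N)
    (alpha : seq 'I_4 -> int) (g : curve N) : Prop :=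
  forall r, tgt T b r = atet (carc g ord0) ->
    alpha (r ++ curve_word g ++ rev_path T b r) = 0.

(* C, C' and C'': corners to the left of the curve count +1, corners to its    *)
(* right count -1.                                                             *)
Definition curve_row N (qd : 'I_N -> 'I_3) (g : curve N) (k : 'I_3) (j : 'I_N) : int :=
  \sum_(i | (atet (carc g i) == j) &&
            (edge_kind (avtx (carc g i)) (acor (carc g i)) - qd j == k))
    sign4 (avtx (carc g i)) (acor (carc g i)) (ain (carc g i)) (aout (carc g i)).

Definition solution (R : realType) N (T : triangulation N) (e : 'I_N -> oedge N)
    (qd : 'I_N -> 'I_3) (z : 'I_N -> Cx R) : Prop :=
  [/\ forall j, z j != 0 /\ z j != 1,
      forall i, \prod_j \prod_(k < 3) shape_param k (z j) ^ gluing_mx T e qd k i j = 1 &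
      forall g, peripheral_curve R T g ->
        \prod_j \prod_(k < 3) shape_param k (z j) ^ curve_row qd g k j = 1].

Definition wedge (F : fieldType) (u v : 'cV[F]_2) : F :=
  u 0 0 * v 1 0 - u 1 0 * v 0 0.

(* [rho] is a holonomy of the shape parameters [z]: [V p a], a point of the    *)
(* projective line in homogeneous coordinates, is the image under the          *)
(* developing map of the a-th vertex of the last tetrahedron of [p] in the     *)
(* universal cover.  For vertices (v0, v2, v1, v3) at (oo, 0, 1, x) the        *)
(* parameter at l13 and l02 is x.                                              *)
Definition holonomy (R : realType) N (T : triangulation N) (b : 'I_N)
    (qd : 'I_N -> 'I_3) (z : 'I_N -> Cx R) (rho : seq 'I_4 -> 'M[Cx R]_2) : Prop :=
  exists V : seq 'I_4 -> 'I_4 -> 'cV[Cx R]_2,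
  (forall p a a', a != a' -> wedge (V p a) (V p a') != 0) /\
  (forall p q a, homotopic T b finset.set0 p q -> wedge (V p a) (V q a) = 0) /\
  (forall p f a, a != f ->
     wedge (V p a) (V (rcons p f) (gl T (tgt T b p) f a)) = 0) /\
  (forall p, edge_shape qd z (tgt T b p) v1 v3 =
     (wedge (V p v3) (V p v2) * wedge (V p v1) (V p v0)) /
     (wedge (V p v1) (V p v2) * wedge (V p v3) (V p v0))) /\
  (forall w p a, loop T b w -> wedge (rho w *m V p a) (V (w ++ p) a) = 0).

Definition geometric_solution (R : realType) N (T : triangulation N) (b : 'I_N)
    (e : 'I_N -> oedge N) (qd : 'I_N -> 'I_3) (z : 'I_N -> Cx R) : Prop :=
  solution T e qd z /\
  exists2 rho, geometric_representation T b rho & holonomy T b qd z rho.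

(** * The 1-loop invariant *)

Definition flattening (R : realType) N (T : triangulation N) (e : 'I_N -> oedge N)
    (qd : 'I_N -> 'I_3) (f : 'I_3 -> 'I_N -> int) : Prop :=
  [/\ forall j, \sum_k f k j = 1,
      forall i, \sum_k \sum_j gluing_mx T e qd k i j * f k j = 2 &
      forall g, peripheral_curve R T g -> \sum_k \sum_j curve_row qd g k j * f k j = 0].

(* The i0-th row of the gluing matrix is replaced by the row of the curve. *)
Definition gluing_hat N (T : triangulation N) (e : 'I_N -> oedge N)
    (qd : 'I_N -> 'I_3) (i0 : 'I_N) (g : curve N) (k : 'I_3) : 'M[int]_N :=
  \matrix_(i, j) if i == i0 then curve_row qd g k j else gluing_mx T e qd k i j.

Definition one_loop (R : realType) N (T : triangulation N) (e : 'I_N -> oedge N)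
    (qd : 'I_N -> 'I_3) (i0 : 'I_N) (g : curve N) (f : 'I_3 -> 'I_N -> int)
    (z : 'I_N -> Cx R) : Cx R :=
  2^-1 *
  (\det (\sum_(k < 3) map_mx intr (gluing_hat T e qd i0 g k) *m
                      diag_mx (\row_j zeta k (z j))) /
   \prod_j \prod_(k < 3) zeta k (z j) ^ f k j).

(** * sigma-Ptolemy assignments *)

(* [sigma j i v k] is the value at the short-edge s_ivk of the j-th tetrahedron. *)
Definition cocycle (R : realType) N (T : triangulation N)
    (sigma : 'I_N -> 'I_4 -> 'I_4 -> 'I_4 -> Cx R) : Prop :=
  forall j i v k l, uniq [:: i; v; k; l] ->
  [/\ sigma j i v k = 1 \/ sigma j i v k = -1,
      sigma j k v i = (sigma j i v k)^-1,
      sigma j i v k * sigma j k v l * sigma j l v i = 1 &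
      sigma (nb T j l) (gl T j l i) (gl T j l v) (gl T j l k) = sigma j i v k].

(* Paths along short-edges.  A state (j, v, u) is the endpoint on the edge     *)
(* [vu] of the triangle at vertex [v] of the j-th tetrahedron; the same point  *)
(* is seen from all tetrahedra around that edge.  [bpath x y w s] is a path    *)
(* from [x] to [y] with product of sigma-values [s], crossing the faces [w].   *)
Inductive bpath (R : realType) N (T : triangulation N)
    (sigma : 'I_N -> 'I_4 -> 'I_4 -> 'I_4 -> Cx R) :
    oedge N -> oedge N -> seq 'I_4 -> Cx R -> Prop :=
| bpath_nil x : bpath T sigma x x [::] 1
| bpath_short j v u k y w s : uniq [:: u; v; k] -> bpath T sigma (j, v, k) y w s ->
    bpath T sigma (j, v, u) y w (sigma j u v k * s)
| bpath_cross j v u f y w s : uniq [:: u; v; f] ->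
    bpath T sigma (nb T j f, gl T j f v, gl T j f u) y w s ->
    bpath T sigma (j, v, u) y (f :: w) s.

Definition obstruction_cocycle (R : realType) N (T : triangulation N) (b : 'I_N)
    (sigma : 'I_N -> 'I_4 -> 'I_4 -> 'I_4 -> Cx R) : Prop :=
  cocycle T sigma /\
  exists rho : seq 'I_4 -> 'M[Cx R]_2,
  [/\ geometric_representation T b rho,
      forall u w, loop T b u -> loop T b w -> rho (u ++ w) = rho u *m rho w,
      forall u w, loop T b u -> homotopic T b finset.set0 u w -> rho u = rho w &
      exists2 A, A \in unitmx & forall w s,
        bpath T sigma (b, v0, v1) (b, v0, v1) w s ->
        let B := invmx A *m rho w *m A in
        [/\ B 0 0 = s, B 1 0 = 0 & B 1 1 = s^-1]].

Definition ptolemy (R : realType) (s : 'I_4 -> 'I_4 -> 'I_4 -> Cx R)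
    (c : 'I_4 -> 'I_4 -> Cx R) : Cx R :=
  c v0 v2 * c v1 v3
  - (s v0 v3 v1 * s v3 v0 v2) / (s v3 v1 v2 * s v0 v2 v1) * (c v0 v3 * c v1 v2)
  - (s v0 v1 v3 * s v1 v0 v2) / (s v1 v3 v2 * s v0 v2 v3) * (c v0 v1 * c v2 v3).

(* [c j a b] is the value at the edge l_ab of the j-th tetrahedron. *)
Definition ptolemy_assignment (R : realType) N (T : triangulation N)
    (sigma : 'I_N -> 'I_4 -> 'I_4 -> 'I_4 -> Cx R)
    (c : 'I_N -> 'I_4 -> 'I_4 -> Cx R) : Prop :=
  [/\ forall j a b, a != b -> c j a b != 0 /\ c j b a = - c j a b,
      forall j a b f, uniq [:: a; b; f] ->
        c (nb T j f) (gl T j f a) (gl T j f b) = c j a b &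
      forall j, ptolemy (sigma j) (c j) = 0].

(* The shape parameter at l13 and l02. *)
Definition ptolemy_shape (R : realType) (s : 'I_4 -> 'I_4 -> 'I_4 -> Cx R)
    (c : 'I_4 -> 'I_4 -> Cx R) : Cx R :=
  - ((s v1 v0 v3 * s v3 v2 v1) / (s v0 v3 v2 * s v2 v1 v0)
     * ((c v0 v1 * c v2 v3) / (c v0 v3 * c v1 v2))).

(** * The infinite cyclic cover *)

(* A tetrahedron of the cover is a path [p] from the base tetrahedron, up to   *)
(* paths with the same end differing by an element of ker alpha; (p, a, b) is  *)
(* its oriented edge l_ab, glued to those of the neighbouring tetrahedra.      *)
Definition ledge : Type := (seq 'I_4 * 'I_4 * 'I_4)%type.

Definition same_ledge N (T : triangulation N) (b : 'I_N) (alpha : seq 'I_4 -> int)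
    (x y : ledge) : Prop :=
  exists r, [/\
     pivots T (tgt T b x.1.1) r [set x.1.2; x.2]%SET,
     tgt T (tgt T b x.1.1) r = tgt T b y.1.1,
     (tr T (tgt T b x.1.1) r x.1.2, tr T (tgt T b x.1.1) r x.2) = (y.1.2, y.2) &
     alpha (x.1.1 ++ r ++ rev_path T b y.1.1) = 0].

(* y = g^k x *)
Definition deck_related N (T : triangulation N) (b : 'I_N) (alpha : seq 'I_4 -> int)
    (k : int) (x y : ledge) : Prop :=
  exists w, [/\ loop T b w, alpha w = k &
                same_ledge T b alpha (w ++ x.1.1, x.1.2, x.2) y].

(* The choices made in the infinite cyclic cover: a lift of each tetrahedron   *)
(* and of each edge (a set of representatives for the deck group), the list of *)
(* the remaining edges of the lifted tetrahedra, and the resulting data:       *)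
(* [orb l], [expo l] are j(i), k(i) for i = N + l, and [var j a b] gives the   *)
(* index of the edge l_ab of the lift of the j-th tetrahedron, with a boolean  *)
(* telling whether its orientation is the chosen one.                          *)
Record lifts N (T : triangulation N) (b : 'I_N) (alpha : seq 'I_4 -> int)
    (e : 'I_N -> oedge N) (L : nat) := Lifts {
  ltet : 'I_N -> seq 'I_4;
  elift : 'I_(N + L) -> ledge;
  orb : 'I_L -> 'I_N;
  expo : 'I_L -> int;
  var : 'I_N -> 'I_4 -> 'I_4 -> 'I_(N + L) * bool;
  ltetP : forall j, tgt T b (ltet j) = j;
  eliftP : forall i, let x := elift (lshift L i) in
    same_edge T (tgt T b x.1.1, x.1.2, x.2) (e i);
  elift_inj : forall m m', m != m' ->
    ~ same_ledge T b alpha (elift m) (elift m') /\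
    ~ same_ledge T b alpha (elift m) (flip (elift m'));
  elift_extra : forall l, exists j c d, c != d /\ (var j c d).1 = rshift N l;
  orbP : forall l,
    deck_related T b alpha (expo l) (elift (lshift L (orb l))) (elift (rshift N l));
  varP : forall j c d, c != d -> let m := elift (var j c d).1 in
    same_ledge T b alpha (ltet j, c, d) (if (var j c d).2 then m else flip m)
}.

(* p_i^sigma, as a function of the variables [x], for a value of t *)
Definition ptolemy_poly (R : realType) N (T : triangulation N) (b : 'I_N)
    (alpha : seq 'I_4 -> int) (e : 'I_N -> oedge N) (L : nat)
    (D : lifts T b alpha e L) (sigma : 'I_N -> 'I_4 -> 'I_4 -> 'I_4 -> Cx R)
    (t : Cx R) (i : 'I_(N + L)) (x : 'rV[Cx R]_(N + L)) : Cx R :=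
  match fintype.split i with
  | inl j => ptolemy (sigma j) (fun c d =>
      if (var D j c d).2 then x 0 (var D j c d).1 else - x 0 (var D j c d).1)
  | inr l => x 0 i - t ^ (- expo D l) * x 0 (lshift L (orb D l))
  end.

Definition edge_value (R : realType) N (e : 'I_N -> oedge N)
    (c : 'I_N -> 'I_4 -> 'I_4 -> Cx R) (i : 'I_N) : Cx R :=
  c (e i).1.1 (e i).1.2 (e i).2.

Definition ptolemy_point (R : realType) N (T : triangulation N) (b : 'I_N)
    (alpha : seq 'I_4 -> int) (e : 'I_N -> oedge N) (L : nat)
    (D : lifts T b alpha e L) (c : 'I_N -> 'I_4 -> 'I_4 -> Cx R) : 'rV[Cx R]_(N + L) :=
  \row_i match fintype.split i with
         | inl j => edge_value e c j
         | inr l => edge_value e c (orb D l)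
         end.

Definition ptolemy_jacobian (R : realType) N (T : triangulation N) (b : 'I_N)
    (alpha : seq 'I_4 -> int) (e : 'I_N -> oedge N) (L : nat)
    (D : lifts T b alpha e L) (sigma : 'I_N -> 'I_4 -> 'I_4 -> 'I_4 -> Cx R)
    (x : 'rV[Cx R]_(N + L)) (t : Cx R) : 'M[Cx R]_(N + L) :=
  \matrix_(i, j) 'D_(delta_mx 0 j) (ptolemy_poly D sigma t i) x.

(* Main.v *)
(* Multiplying the columns of the Jacobian by the values of the variables and  *)
(* eliminating c_{N+1}, ..., c_{N+L} turns its determinant into that of an     *)
(* N x N matrix whose j-th row is proportional, by the Ptolemy relation, to    *)
(* the sum over the edges ab of the j-th tetrahedron of t^{-k(ab)} zeta_ab.    *)
(* At t = 1 this is the transpose of the gluing matrix, whose rows sum to 0;   *)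
(* so the derivative is a determinant where one gluing row is replaced by      *)
(* r_j = - sum_ab k(ab) zeta_ab, and it remains to compare r with the row of   *)
(* lambda.  Pair both with the cofactors of the gluing matrix along that row.  *)
(* The numbers zeta_ab cofactor_j at the corners of the cusp triangles sum to  *)
(* 0 in every triangle and around every vertex, so they are the increments of  *)
(* a closed 1-cochain on the cusp torus.  Up to a factor -2 pairing with r is  *)
(* its cup product with the class of alpha, and pairing with lambda is its     *)
(* evaluation on lambda; both kill alpha, and H^1 of the torus has rank 2, so  *)
(* they are proportional.  The factor is a unit since lambda, being simple,    *)
(* and alpha, being onto, are primitive.  The flattening accounts for the      *)
(* factors c_i and for the proportionality of the rows.                        *)
Require Import Defs.
From HB Require Import structures.
From mathcomp Require Import all_boot all_order all_algebra perm.
From mathcomp Require Import all_classical all_reals all_analysis.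
From mathcomp Require Import complex ring lra zify.

Set Implicit Arguments.
Unset Strict Implicit.
Unset Printing Implicit Defensive.

Import Order.TTheory GRing.Theory Num.Theory.
Import numFieldNormedType.Exports.

(** * Flat connections on combinatorial tori *)

(** Algebra first. A Ptolemy relation is a sum of three monomials, so a variable times the
    derivative in it is the sum of the monomials containing it ([jacobian_tet]), and the shape
    relation makes these monomials proportional to the zeta parameters ([ptolemy_weights]). A Schur
    complement removes the extra variables ([jacobian_det]), leaving a constant times the
    determinant of a gluing matrix [cover_mx] twisted by powers of t. Its rows sum to 0 at t = 1, so
    the derivative pairs the deck exponents with one row of cofactors ([cover_mx_derive]). The
    1-loop determinant expands along the same cofactors ([det_gluing_hat]). What remains is an
    equality up to sign between two pairings with the weights zeta times cofactor
    ([weights_duality]), and the constants are compared up to sign by [flattening_product].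

    The equality of pairings is Poincare duality on the cusp torus, treated as a combinatorial map.
    A flat connection on it is a function on darts modulo the relation [conn], and [torus_gauge]
    shows that, up to gauge, the holonomies of a flat connection on a torus lie in the subgroup
    generated by two commuting elements. It is used twice: with values in the fundamental group of
    the cusp, which is therefore abelian ([cusp_group_comm]), and with values in a space of
    dimension 3, where it yields a linear relation between the periods of three classes, one of them
    [alpha] ([pair_walks]).

    The constant of proportionality is a unit because both classes are primitive ([walk_duality]).
    For [alpha] this comes from a peripheral loop of value 1 ([na_primitive]). For the curve,
    suppose that its crossing numbers with closed chains generate a proper ideal: then the indicator
    of one residue class, on the complement of the curve, shows that the curve bounds
    ([curve_exact]), so it is null-homotopic because the group is abelian, contrary to being
    peripheral ([curve_primitive]). *)

Section CombinatorialMaps.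
Local Open Scope nat_scope.
Local Open Scope group_scope.

Section EdgeDeletion.
Variable D : finType.
Implicit Types (p q t : {perm D}) (x y s : D).

Definition skip p x := tperm (p^-1 x) x * p.

Lemma skipE p x y :
  skip p x y = if y == x then x else if p y == x then p x else p y.
Proof.
rewrite /skip permM; have [->|nyx] := eqVneq y x; first by rewrite tpermR permKV.
have [pyx|npyx] := eqVneq (p y) x; first by rewrite -pyx permK tpermL.
by rewrite tpermD // eq_sym //; apply: contra_neq npyx => ->; rewrite permKV.
Qed.

Lemma card_porbits_skip p x : #|porbits (skip p x)| = #|porbits p| + (p x != x).
Proof.
have := porbits_mul_tperm p (p^-1 x) x; rewrite /= -/(skip p x).
have -> : p^-1 x \in porbit p x.
  by rewrite -porbitV -[p^-1 x]/((p^-1 ^+ 1) x) mem_porbit.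
rewrite addn0 => ->; rewrite -(inj_eq (@perm_inj _ p)) permKV.
by rewrite eq_sym.
Qed.

(** Together these erase the edge with darts [s] and [t s] from a map, turning both darts into
    dummies. The third permutation of the new map is [unpair t s * delete p t s]. With [p] the face
    permutation this contracts the edge; with [p] the vertex permutation it deletes the edge. *)
Definition delete p t s := skip (skip p s) (t s).
Definition unpair t s := t * tperm s (t s).

Lemma deleteE p t s y : t s != s -> p s != s ->
  delete p t s y =
    if (y == s) || (y == t s) then y else
    if p y == s then if p s == t s then p (t s) else p s else
    if p y == t s then if p (t s) == s then p s else p (t s) else p y.
Proof.
move=> nts nps; rewrite /delete !skipE.
have [->|ns] := eqVneq y s; first by rewrite (eq_sym s) (negPf nts).
have [->|nt] := eqVneq y (t s); first by [].
rewrite /= (negPf nts); have [pys|npys] := eqVneq (p y) s.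
  case: ifP => // _; have [e|//] := eqVneq (p (t s)) s.
  by move: nt; rewrite -(inj_eq (@perm_inj _ p)) pys e eqxx.
by have [pyt|] := eqVneq (p y) (t s).
Qed.

Lemma unpairE t s y : involutive t -> unpair t s y = if (y == s) || (y == t s) then y else t y.
Proof.
move=> tK; rewrite /unpair permM; have [->|ns] := eqVneq y s; first by rewrite tpermR.
have [->|nt] := eqVneq y (t s); first by rewrite tK tpermL.
by rewrite tpermD //; [apply: contra_neq nt => ->; rewrite tK | apply: contra_neq ns => /perm_inj].
Qed.

Section Step.
Variables (p t : {perm D}) (s : D).
Hypotheses (tK : involutive t) (ts : t s != s).
Let r := t * p.
Hypothesis sr : t s \notin porbit r s.

Let rE y : r y = p (t y). Proof. by rewrite permM. Qed.

Let rs : r s != t s.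
Proof. by apply: contraNneq sr => <-; rewrite -[r s]/((r ^+ 1) s) mem_porbit. Qed.

Let rt : r (t s) != s.
Proof.
apply: contraNneq sr => e; rewrite porbit_sym -{1}e.
by rewrite -[r _]/((r ^+ 1) (t s)) mem_porbit.
Qed.

Let ps : p s != s. Proof. by move: rt; rewrite rE tK. Qed.
Let pt : p (t s) != t s. Proof. by rewrite -rE. Qed.

Lemma delete_dualE y :
  (unpair t s * delete p t s) y =
    if (y == s) || (y == t s) then y else
    if r y == s then if r (t s) == t s then r s else r (t s) else
    if r y == t s then if r s == s then r (t s) else r s else r y.
Proof.
rewrite permM unpairE //.
have [->|ns] := eqVneq y s; first by rewrite /= deleteE // eqxx.
have [->|nt] := eqVneq y (t s); first by rewrite /= deleteE // eqxx orbT.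
rewrite /= deleteE // (negPf (_ : t y != s)); last by apply: contra_neq nt => <-; rewrite tK.
by rewrite (inj_eq perm_inj) (negPf ns) /= !rE !tK.
Qed.

Let nondeg := ~~ ((r s == s) && (r (t s) == t s)).

(** Each of the two darts leaves its cycle and becomes a new fixed point; [nondeg] excludes the case
    in which they form a whole cycle of [p]. *)
Lemma card_porbits_delete : nondeg -> #|porbits (delete p t s)| = #|porbits p| + 2.
Proof.
move=> nd; rewrite /delete !card_porbits_skip ps -addnA; congr (_ + _).
rewrite skipE (negPf ts); have [e|_] := eqVneq (p (t s)) s; last by rewrite pt.
by move: nd; rewrite /nondeg !rE tK e eqxx /= => ->.
Qed.

(** The two cycles of [r] through [s] and [t s] merge into one, nonempty by [nondeg], and two fixed
    points are added. *)
Lemma card_porbits_delete_dual :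
  nondeg -> #|porbits (unpair t s * delete p t s)| = #|porbits r| + 1.
Proof.
move=> nd; set r1 := tperm s (t s) * r.
have r1E y : r1 y = if y == s then r (t s) else if y == t s then r s else r y.
  rewrite /r1 permM; have [->|ns] := eqVneq y s; first by rewrite tpermL.
  have [->|nt] := eqVneq y (t s); first by rewrite tpermR.
  by rewrite tpermD // eq_sym.
have -> : unpair t s * delete p t s = skip (skip r1 s) (t s).
  apply/permP => y; rewrite delete_dualE -/(delete r1 t s) deleteE //; last first.
    by rewrite r1E eqxx.
  have [//|ns] := eqVneq y s; have [//|nt] := eqVneq y (t s).
  by rewrite /= !r1E (negPf ns) (negPf nt) eqxx (negPf ts) eqxx.
have := porbits_mul_tperm r s (t s); rewrite /= -/r1 porbit_sym sr eq_sym ts /= addn2 addn1.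
move=> [] [<-]; rewrite !card_porbits_skip r1E eqxx rt skipE (negPf ts) !r1E eqxx (negPf ts) eqxx.
have [e|_] := eqVneq (r s) s; last by rewrite rs -addnA addn1 ?addn2.
by move: nd; rewrite /nondeg e eqxx /= => ->; rewrite !addn1.
Qed.

End Step.
End EdgeDeletion.

(** Carries a property from [p s] around the cycle back to [s], the inductive step being required
    only away from [s]. *)
Lemma perm_walk (D : finType) (p : {perm D}) (s : D) (Q : D -> Prop) :
  Q (p s) -> (forall y, y \in porbit p s -> y != s -> Q y -> Q (p y)) -> Q s.
Proof.
move=> Q1 Qs; have [n Hn] : exists n, forall i, i <= n -> Q ((p ^+ i.+1) s) \/
    (exists2 j, j <= i & (p ^+ j.+1) s = s /\ Q s).
  exists #|porbit p s|; elim=> [|i IH] lei; first by left; rewrite expg1.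
  case: (IH (ltnW lei)) => [Qi|[j lj]]; last by right; exists j => //; apply: leqW.
  have [e|ne] := eqVneq ((p ^+ i.+1) s) s.
    by right; exists i => //; split=> //; rewrite -e.
  by left; rewrite expgSr permM; apply: Qs => //; rewrite mem_porbit.
have {Hn} H i : Q ((p ^+ i.+1) s) \/ Q s.
  elim: i => [|i [Qi|]]; [by left; rewrite expg1| |by right].
  have [e|ne] := eqVneq ((p ^+ i.+1) s) s; first by right; rewrite -e.
  by left; rewrite expgSr permM; apply: Qs => //; rewrite mem_porbit.
have := iter_porbit p s; have: 0 < #|porbit p s| by rewrite lt0n card_porbit_neq0.
case: #|porbit p s| => // m _ e; case: (H m) => //.
by rewrite permX e.
Qed.

Lemma porbit_invariant (D : finType) (T : Type) (p : {perm D}) (f : D -> T) :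
  (forall x, f (p x) = f x) -> forall x y, y \in porbit p x -> f y = f x.
Proof.
move=> fp x y /porbitP[i ->]; elim: i => [|i IH]; first by rewrite perm1.
by rewrite expgSr permM fp.
Qed.

Lemma porbit_step (D : finType) (p : {perm D}) (x y : D) :
  (p y \in porbit p x) = (y \in porbit p x).
Proof.
by rewrite -!eq_porbit_mem -(porbit_perm p 1 y) expg1.
Qed.

Lemma card_porbits_single (D : finType) (p : {perm D}) (I : {set D}) (x0 : D) :
  x0 \notin I -> (forall x, x \in I -> p x = x) ->
  (forall x, x \notin I -> x \in porbit p x0) -> #|porbits p| = #|I|.+1.
Proof.
move=> x0I pI orb.
have fixo x : x \in I -> porbit p x = [set x].
  move=> xI; apply/setP => y; rewrite inE; apply/idP/eqP => [|->]; last exact: porbit_id.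
  by move/porbitP=> [i ->]; elim: i => [|i IH]; rewrite ?perm1 // expgSr permM IH pI.
have -> : porbits p = porbit p x0 |: [set [set x] | x in I].
  apply/setP => B; rewrite !inE; apply/imsetP/orP.
    move=> [x _ ->]; have [xI|xI] := boolP (x \in I).
      by right; apply/imsetP; exists x; rewrite ?fixo.
    by left; rewrite eq_porbit_mem orb.
  case=> [/eqP ->|/imsetP[x xI ->]]; first by exists x0.
  by exists x; rewrite ?fixo.
rewrite cardsU1 card_imset; last exact: set1_inj.
suff -> : porbit p x0 \notin [set [set x] | x in I] by rewrite add1n.
apply/imsetP => -[x xI e]; have := porbit_id p x0; rewrite e inE => /eqP xx.
by rewrite xx xI in x0I.
Qed.

Section Connection.
Variables (D : finType) (G : groupType).
Implicit Types (phi tau : {perm D}) (h k : D -> G).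

(* [conn nu h x] is the holonomy of crossing the side [x]; that it is of the
   form [h x / h (nu x)] says that the holonomy around every vertex is trivial. *)
Definition conn phi tau h x : G := h x / h (phi (tau x)).

Definition antisym phi tau h :=
  forall x, tau x != x -> conn phi tau h (tau x) = (conn phi tau h x)^-1.

(** Membership in a generated subgroup is expressed by quantifying over such predicates, which are
    later centralizers and kernels of linear maps. *)
Definition subgroup_pred (P : G -> Prop) :=
  [/\ P 1, forall u v, P u -> P v -> P (u * v) & forall u, P u -> P u^-1].

Definition connected_map phi tau := forall q : D -> bool,
  (forall x, q (phi x) = q x) -> (forall x, q (tau x) = q x) ->
  forall x y, tau x != x -> tau y != y -> q x = q y.

Definition one_face phi tau := forall q : D -> bool,
  (forall x, q (phi x) = q x) -> forall x y, tau x != x -> tau y != y -> q x = q y.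

(* Euler characteristic 0 for the map with faces the cycles of [phi], vertices
   those of [tau * phi] and edges those of [tau]; a dart fixed by [tau] is a
   dummy, which counts as one face and one vertex. *)
Definition toroidal phi tau :=
  (2 * (#|porbits phi| + #|porbits (tau * phi)%g|) = #|D| + 3 * #|[set x | tau x == x]|)%N.

Lemma one_face_porbit phi tau x y : one_face phi tau ->
  tau x != x -> tau y != y -> x \in porbit phi y.
Proof.
move=> F1 ax ay; rewrite (F1 (fun z => z \in porbit phi y) _ x y) //.
  exact: porbit_id.
by move=> z; rewrite porbit_step.
Qed.

Lemma one_face_torus n phi tau h :
  #|[set x | tau x != x]| <= n ->
  involutive tau -> (forall x, tau x = x -> phi x = x) -> one_face phi tau ->
  toroidal phi tau -> antisym phi tau h ->
  exists X Y : G, commute X Y /\ forall P, subgroup_pred P -> P X -> P Y ->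
    forall x, tau x != x -> P (conn phi tau h x).
Proof.
elim: n => [|n IH] in phi tau h *.
  move=> An tauK fixphi F1 Eul anti.
  exists 1, 1; split=> // P _ _ _ x ax; move: An.
  rewrite leqn0 cards_eq0 => /eqP/setP/(_ x).
  by rewrite !inE ax.
move=> An tauK fixphi F1 Eul anti.
set nu := tau * phi; have nuE x : nu x = phi (tau x) by rewrite permM.
have [/existsP[s /andP[as_ sr]]|] :=
    boolP [exists s, (tau s != s) && (tau s \notin porbit nu s)].
  have sa : tau (tau s) != tau s by rewrite tauK eq_sym.
  (* Both ends of this edge have degree one; with a single face, the edge is then the whole map. *)
  have [/andP[/eqP es /eqP et]|nd] := boolP ((nu s == s) && (nu (tau s) == tau s)).
    exists (conn phi tau h s), 1; split; first exact: commute1.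
    move=> P [P1 PM PV] PX _ x ax.
    suff [->//|->] : x = s \/ x = tau s by rewrite anti //; apply: PV.
    have : x \in porbit phi s by apply: one_face_porbit ax as_.
    have es' : phi s = tau s by rewrite -[RHS]et nuE tauK.
    have et' : phi (tau s) = s by rewrite -[RHS]es nuE.
    case/porbitP=> i ->; elim: i => [|i IHi]; first by left; rewrite perm1.
    by rewrite expgSr permM; case: IHi => ->; [right|left].
  set phi' := delete phi tau s; set tau' := unpair tau s.
  have dE := delete_dualE tauK as_ sr.
  have phis : phi s != s.
    by apply: contraNneq sr => e; rewrite porbit_sym -{1}e -{1}[s]tauK -nuE porbit_step porbit_id.
  have phit : phi (tau s) != tau s.
    by apply: contraNneq sr => e; rewrite -{1}e -nuE porbit_step porbit_id.
  have tau'E := @unpairE _ tau s ^~ tauK.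
  have act' x : (tau' x != x) = [&& x != s, x != tau s & tau x != x].
    rewrite tau'E; have [->|] := eqVneq x s; first by rewrite eqxx.
    by have [->|] := eqVneq x (tau s); rewrite /= ?eqxx.
  have nuo x : (nu x \in porbit nu (tau s)) = (x \in porbit nu (tau s)) by rewrite porbit_step.
  have so : s \in porbit nu (tau s) = false by rewrite porbit_sym (negPf sr).
  have Hst : h (tau s) / h (nu (tau s)) = h (nu s) / h s.
    by have := anti s as_; rewrite /conn -!nuE invgF.
  (* Right translation of [h] by a constant on one vertex does not change [conn]. This constant
     makes the two vertices fit together when the edge between them is contracted. *)
  set c := (h (nu (tau s)))^-1 * h s.
  have cE : c = (h (tau s))^-1 * h (nu s).
    by rewrite -[h (nu s)](mulgVK (h s)) -Hst /c !mulgA mulVg mul1g.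
  pose h' x := h x * (if x \in porbit nu (tau s) then c else 1 : G).
  have conn'E x : x != s -> x != tau s -> conn phi' tau' h' x = conn phi tau h x.
    move=> ns nt; rewrite /conn -!nuE -[phi' _]permM dE (negPf ns) (negPf nt) /= -/nu.
    rewrite [in LHS]/h'; have := nuo x; have [e|nxs] := eqVneq (nu x) s.
      rewrite e so => <-; have [e'|ne] := eqVneq (nu (tau s)) (tau s).
        rewrite nuo so !mulg1; congr (_ / _).
        by move: Hst; rewrite e' mulgV => /esym/divg1_eq.
      by rewrite nuo porbit_id mulg1 /c mulVKg.
    have [e|nxt] := eqVneq (nu x) (tau s).
      rewrite e porbit_id => <-; have [e'|ne] := eqVneq (nu s) s.
        rewrite nuo porbit_id mulgKA; congr (_ / _).
        by move: Hst; rewrite e' mulgV => /divg1_eq.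
      by rewrite nuo so mulg1 cE !mulgA mulgK.
    by move=> ->; rewrite mulgKA.
  have [||||||X [Y [XY gen]]] := IH phi' tau' h'.
  - rewrite -ltnS; apply: leq_trans An; apply: proper_card; apply/properP; split.
      by apply/fintype.subsetP => x; rewrite !inE act' => /and3P[].
    by exists s; rewrite !inE ?act' ?eqxx.
  - move=> x; rewrite !tau'E; have [->|ns] := eqVneq x s; first by rewrite eqxx.
    have [->|nt] := eqVneq x (tau s); first by rewrite eqxx orbT.
    by rewrite /= (inj_eq perm_inj) (negPf ns) orbF; case: eqP => // e; rewrite -e tauK eqxx in nt.
  - move=> x; rewrite tau'E /phi' deleteE //.
    case: ifP => // xx /[dup] xx' /fixphi ->; move/norP: xx => [/negPf -> /negPf ->] //.
  - move=> q qphi; pose q1 x := q (if x == s then if phi s == tau s then phi (tau s) else phi s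
        else if x == tau s then if phi (tau s) == s then phi s else phi (tau s) else x).
    have q1phi x : q1 (phi x) = q1 x.
      rewrite /q1; have [->|ns] := eqVneq x s.
        rewrite (negPf phis); have [e|//] := eqVneq (phi s) (tau s).
        have [e'|//] := eqVneq (phi (tau s)) s.
        by move: nd; rewrite !nuE tauK e e' !eqxx.
      have [->|nt] := eqVneq x (tau s).
        rewrite (negPf phit); have [e|//] := eqVneq (phi (tau s)) s.
        have [e'|//] := eqVneq (phi s) (tau s).
        by move: nd; rewrite !nuE tauK e e' !eqxx.
      by rewrite -[RHS]qphi /phi' deleteE // (negPf ns) (negPf nt) /=; case: ifP => //; case: ifP.
    move=> x y; rewrite !act' => /and3P[xs xt ax] /and3P[ys yt ay].
    have := F1 q1 q1phi x y ax ay.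
    by rewrite /q1 (negPf xs) (negPf xt) (negPf ys) (negPf yt).
  - rewrite /toroidal card_porbits_delete // card_porbits_delete_dual //.
    have -> : [set x | tau' x == x] = s |: (tau s |: [set x | tau x == x]).
      apply/setP => x; rewrite !inE; have := act' x; case: (tau' x == x) => /=.
        by move=> /esym/negbT; rewrite !negb_and !negbK => /or3P[] ->; rewrite ?orbT.
      by move=> /esym/and3P[/negPf -> /negPf -> /negPf ->].
    move: Eul; rewrite /toroidal !cardsU1 !inE tauK (negPf as_) [s == _]eq_sym (negPf as_) /=.
    by clear; lia.
  - move=> x; rewrite act' => /and3P[ns nt ax]; rewrite !conn'E //.
    + by rewrite tau'E (negPf ns) (negPf nt) anti.
    + by rewrite tau'E (negPf ns) (negPf nt) /=; apply: contra_neq nt => <-; rewrite tauK.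
    + by rewrite tau'E (negPf ns) (negPf nt) /= (inj_eq perm_inj).
  exists X, Y; split=> // P PP PX PY.
  have PC x : x != s -> x != tau s -> tau x != x -> P (conn phi tau h x).
    by move=> ns nt ax; rewrite -conn'E //; apply: gen; rewrite ?act' ?ns ?nt.
  have [P1 PM PV] := PP.
  (* Going around the vertex of [s], the quotients [h (nu s) / h y] are products of holonomies of
     darts other than [s] and [tau s]; back at [s] the quotient is the inverse of the missing
     holonomy. *)
  have Ps : P (conn phi tau h s).
    rewrite -[conn _ _ _ _]invgK; apply: (PV).
    rewrite /conn -nuE invgF; apply: (@perm_walk _ nu s (fun y => P (h (nu s) / h y))).
      by rewrite mulgV.
    move=> y yo ns Py; have [/eqP iy|ay] := boolP (tau y == y).
      by rewrite (nuE y) iy fixphi.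
    rewrite -(divgKA (h y)); apply: (PM) => //; rewrite (nuE y); apply: PC => //.
    by apply: contraNneq sr => <-.
  move=> x ax; have [->//|ns] := eqVneq x s; have [->|nt] := eqVneq x (tau s).
    by rewrite anti //; apply: (PV).
  exact: PC.
rewrite negb_exists => /forallP linked.
have nulink x : tau x \in porbit nu x.
  have [/eqP ->|ax] := boolP (tau x == x); first exact: porbit_id.
  by have := linked x; rewrite ax negbK.
have [/existsP[s as_]|] := boolP [exists s, tau s != s]; last first.
  rewrite negb_exists => /forallP all_fixed; exists 1, 1; split; first exact: commute1.
  by move=> P _ _ _ x ax; have := all_fixed x; rewrite ax.
have oneV x y : tau x != x -> tau y != y -> x \in porbit nu y.
  move=> ax ay; rewrite (F1 (fun z => z \in porbit nu y) _ x y) ?porbit_id // => z.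
  rewrite -[z in LHS]tauK -nuE porbit_step.
  have := nulink z; rewrite -eq_porbit_mem => /eqP e.
  by rewrite ![_ \in porbit _ y]porbit_sym -!eq_porbit_mem e.
have nufix x : tau x = x -> nu x = x by move=> e; rewrite nuE e fixphi.
set I := [set x | tau x == x].
(* One face and one vertex besides the dummies: the Euler relation leaves four active darts. *)
have card_act : #|~: I| = 4.
  have := Eul; rewrite /toroidal -/nu -/I.
  rewrite (card_porbits_single (I := I) (x0 := s)) ?inE //; first last.
  - by move=> x; rewrite inE => ax; apply: (one_face_porbit F1).
  - by move=> x; rewrite inE => /eqP/fixphi.
  rewrite (card_porbits_single (I := I) (x0 := s)) ?inE //; first last.
  - by move=> x; rewrite inE => ax; apply: oneV.
  - by move=> x; rewrite inE => /eqP/nufix.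
  by have := cardsC I; lia.
have orbit4 (p : {perm D}) : (forall x, tau x = x -> p x = x) ->
    (forall x y, tau x != x -> tau y != y -> x \in porbit p y) ->
    forall x, tau x != x -> porbit p x = ~: I.
  move=> fixp onep x ax; apply/setP => y; rewrite !inE.
  apply/idP/idP => [|ay]; last exact: onep.
  move=> yo; apply: contra ax => /eqP ty; have py := fixp _ ty.
  move: yo; rewrite porbit_sym => /porbitP[i ->].
  have -> : (p ^+ i) y = y by elim: i => [|i IHi]; rewrite ?perm1 // expgSr permM IHi.
  by rewrite ty.
have phi_nofix x : tau x != x -> phi x != x.
  move=> ax; have := uniq_traject_porbit phi x.
  rewrite orbit4 ?card_act //=; last by move=> u v; apply: (one_face_porbit F1).
  by rewrite !inE !negb_or eq_sym => /andP[/andP[]].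
have nu4 := iter_porbit nu s; have nuU := uniq_traject_porbit nu s.
have actE x : (tau x != x) = (x \in porbit nu s) by rewrite (orbit4 nu) // !inE.
move: nu4 nuU; rewrite orbit4 // card_act /=.
set r := nu s; set s' := nu r; set r' := nu s' => nur' U.
have mem4 x : tau x != x -> x \in [:: s; r; s'; r'].
  by rewrite actE porbit_traject orbit4 // card_act.
have ar : tau r != r by rewrite actE /r porbit_step porbit_id.
have nu_tau z : tau z != z -> nu z != tau z.
  by move=> az; rewrite nuE phi_nofix // tauK eq_sym.
have ts : tau s = s'.
  have := mem4 (tau s); rewrite tauK eq_sym => /(_ as_).
  rewrite !inE (negPf as_) eq_sym (negPf (nu_tau _ as_)) /=.
  case/orP => /eqP // e; have := nu_tau (tau s); rewrite tauK eq_sym as_ => /(_ isT).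
  by rewrite e nur' eqxx.
have tr : tau r = r'.
  have := mem4 (tau r); rewrite tauK eq_sym => /(_ ar).
  rewrite !inE (negPf ar) [_ == s']eq_sym (negPf (nu_tau _ ar)) /=.
  case/orP => /eqP // e; have ers : r = s' by rewrite -ts -e tauK.
  by move: U; rewrite -ers !inE eqxx andbF.
exists (conn phi tau h s), (conn phi tau h r); split; last first.
  move=> P [P1 PM PV] PX PY x /mem4; rewrite !inE => /or4P[] /eqP -> //.
    by rewrite -ts anti //; apply: PV.
  by rewrite -tr anti //; apply: PV.
have := anti s as_; have := anti r ar; rewrite ts tr /conn -!nuE nur' -/r -/s' -/r' => er es.
(* The four holonomies around the vertex multiply to 1, and the last two are inverse to the first
   two, so this is a commutator relation. *)
have e : (h s / h r) * (h r / h s') * (h s' / h r') * (h r' / h s) = 1.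
  by rewrite !divgKA mulgV.
by move: e; rewrite er es -mulgA -invgM => /divg1_eq.
Qed.

(** Serves the deletion of an edge between two faces: data constant on the merged face come from
    data constant on the old faces, equal on both sides of the deleted edge. *)
Lemma merge_extension (T : Type) phi tau s (f : D -> T) :
    involutive tau -> tau s != s -> tau s \notin porbit phi s ->
    ~~ ((phi s == s) && (phi (tau s) == tau s)) ->
    (forall x, f ((unpair tau s * delete (tau * phi) tau s) x) = f x) ->
  exists f1 : D -> T, [/\ forall x, f1 (phi x) = f1 x,
    forall x, x != s -> x != tau s -> f1 x = f x & f1 s = f1 (tau s)].
Proof.
move=> tauK as_ sr nd finv.
have tt : tau * (tau * phi) = phi by apply/permP => x; rewrite !permM tauK.
have dE := @delete_dualE _ (tau * phi) tau s tauK as_.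
rewrite tt in dE; move: dE => /(_ sr) dE.
have nst : phi s != tau s.
  by apply: contraNneq sr => <-; rewrite porbit_step porbit_id.
have nts : phi (tau s) != s.
  by apply: contraNneq sr => e; rewrite porbit_sym -{1}e porbit_step porbit_id.
have sa : tau (tau s) != tau s by rewrite tauK eq_sym.
pose c := if phi s == s then f (phi (tau s)) else f (phi s).
exists (fun x => if (x == s) || (x == tau s) then c else f x); split; first last.
- by rewrite !eqxx orbT.
- by move=> x /negPf -> /negPf ->.
have finv' x : x != s -> x != tau s ->
    f (if phi x == s then if phi (tau s) == tau s then phi s else phi (tau s) else
    if phi x == tau s then if phi s == s then phi (tau s) else phi s else phi x) = f x.
  by move=> /negPf xs /negPf xt; have := finv x; rewrite dE xs xt.
have cE : phi s != s -> phi (tau s) != tau s -> f (phi (tau s)) = f (phi s).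
  move=> ps pt.
  pose Q y := if y == s then f (phi (tau s)) = f (phi s) else f y = f (phi s).
  suff: Q s by rewrite /Q eqxx.
  apply: (@perm_walk _ phi s Q); rewrite /Q; first by rewrite (negPf ps).
  move=> y yo ys; rewrite (negPf ys) => <-.
  have yt : y != tau s by apply: contraNneq sr => <-.
    have := finv' y ys yt; rewrite (negPf pt).
    have [//|ns] := eqVneq (phi y) s.
    have [e|//] := eqVneq (phi y) (tau s).
    by case/negP: sr; rewrite -e porbit_step.
move=> x; have [->|xs] := eqVneq x s.
  rewrite (negPf nst) orbF /c; have [//|ps] := eqVneq (phi s) s.
  by [].
have [->|xt] := eqVneq x (tau s).
  rewrite (negPf nts) /c /=; have [e|ps] := eqVneq (phi (tau s)) (tau s).
    by [].
  by have [e'|ps'] := eqVneq (phi s) s; rewrite // cE.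
rewrite /= -[RHS]finv' //; have [e|ns] := eqVneq (phi x) s.
  rewrite /= /c; have [e'|ps] := eqVneq (phi s) s.
    by case/eqP: xs; apply: (@perm_inj _ phi); rewrite e e'.
  by case: ifP => // /negbT nt; rewrite cE.
have [e|nt] := eqVneq (phi x) (tau s); last by [].
rewrite /= /c; have [//|ps] := eqVneq (phi s) s; last by [].
Qed.

(* After a gauge transformation [k], constant on faces, all holonomies lie in
   the subgroup generated by two commuting elements.  An edge between distinct
   faces is gauged to be trivial and deleted; when one face is left, an edge
   between distinct vertices is contracted instead. *)
Theorem torus_gauge n phi tau h :
  #|[set x | tau x != x]| <= n ->
  involutive tau -> (forall x, tau x = x -> phi x = x) -> connected_map phi tau ->
  toroidal phi tau -> antisym phi tau h ->
  exists k X Y, [/\ forall x, k (phi x) = k x, commute X Y & forall P, subgroup_pred P ->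
    P X -> P Y -> forall x, tau x != x -> P ((k x)^-1 * conn phi tau h x * k (tau x))].
Proof.
elim: n => [|n IH] in phi tau h *.
  move=> An tauK fixphi F1 Eul anti.
  exists (fun=> 1), 1, 1; split=> // P _ _ _ x ax; move: An.
  rewrite leqn0 cards_eq0 => /eqP/setP/(_ x).
  by rewrite !inE ax.
move=> An tauK fixphi conn1 Eul anti.
have [/existsP[s /andP[as_ sr]]|] :=
    boolP [exists s, (tau s != s) && (tau s \notin porbit phi s)]; last first.
  rewrite negb_exists => /forallP linked.
  have [|X [Y [XY gen]]] := one_face_torus An tauK fixphi _ Eul anti.
    move=> q qphi x y ax ay; apply/esym/(porbit_invariant qphi).
    rewrite (conn1 (fun z => z \in porbit phi x) _ _ y x) ?porbit_id //.
      by move=> z; rewrite porbit_step.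
    move=> z; have := linked z; case: eqP => [->//|_] /=; rewrite negbK.
    by rewrite -eq_porbit_mem ![_ \in porbit _ x]porbit_sym -!eq_porbit_mem => /eqP ->.
  exists (fun=> 1), X, Y; split=> // P PP PX PY x ax.
  by rewrite invg1 mul1g mulg1; apply: gen.
have sa : tau (tau s) != tau s by rewrite tauK eq_sym.
have [/andP[/eqP es /eqP et]|nd] := boolP ((phi s == s) && (phi (tau s) == tau s)).
  exists (fun=> 1), (conn phi tau h s), 1; split=> //; first exact: commute1.
  move=> P [P1 PM PV] PX _ x ax; rewrite invg1 mul1g mulg1.
  suff /orP[/eqP->//|/eqP->] : (x == s) || (x == tau s) by rewrite anti //; apply: PV.
  rewrite (conn1 (fun x => (x == s) || (x == tau s)) _ _ x s) ?eqxx // => z.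
    by rewrite -{1}es -{1}et !(inj_eq perm_inj).
  by rewrite -{1}[s]tauK !(inj_eq perm_inj) orbC.
set phi' := unpair tau s * delete (tau * phi) tau s; set tau' := unpair tau s.
have tt : tau * (tau * phi) = phi by apply/permP => x; rewrite !permM tauK.
have tau'E := @unpairE _ tau s ^~ tauK.
have act' x : (tau' x != x) = [&& x != s, x != tau s & tau x != x].
  rewrite tau'E; have [->|] := eqVneq x s; first by rewrite eqxx.
  by have [->|] := eqVneq x (tau s); rewrite /= ?eqxx.
have tau'K : involutive tau'.
  move=> x; rewrite !tau'E; have [->|ns] := eqVneq x s; first by rewrite eqxx.
  have [->|nt] := eqVneq x (tau s); first by rewrite eqxx orbT.
  by rewrite /= (inj_eq perm_inj) (negPf ns) orbF; case: eqP => // e; rewrite -e tauK eqxx in nt.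
have tt' : tau' * phi' = delete (tau * phi) tau s.
  by apply/permP => x; rewrite permM /phi' permM -/tau' tau'K.
have ext T f := @merge_extension T phi tau s f tauK as_ sr nd.
(* This gauge, supported on the face of [tau s], makes the holonomy across [s] trivial, so that
   deleting the edge does not disturb the remaining connection. *)
pose k0 x : G := if x \in porbit phi (tau s) then (conn phi tau h s)^-1 else 1.
have k0phi x : k0 (phi x) = k0 x by rewrite /k0 porbit_step.
pose h1 x := (k0 x)^-1 * h x.
have conn1E x : conn phi tau h1 x = (k0 x)^-1 * conn phi tau h x * k0 (tau x).
  by rewrite /conn /h1 k0phi invgM invgK !mulgA.
have anti1 : antisym phi tau h1.
  by move=> x ax; rewrite !conn1E anti // !invgM !invgK tauK !mulgA.
have h1s : h1 (phi (tau s)) = h1 s.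
  apply/esym/divg1_eq; rewrite -/(conn phi tau h1 s) conn1E /k0 porbit_id.
  by rewrite porbit_sym (negPf sr) invg1 mul1g mulgV.
have h1t : h1 (phi s) = h1 (tau s).
  apply/esym/divg1_eq; have := anti1 s as_; rewrite /conn tauK => ->.
  by rewrite h1s mulgV invg1.
have nps : (tau * phi) s != s.
  rewrite permM; apply: contraNneq sr => e.
  by rewrite porbit_sym -{1}e porbit_step porbit_id.
have h1del x : x != s -> x != tau s -> h1 (phi' (tau' x)) = h1 (phi (tau x)).
  move=> /negPf ns /negPf nt; rewrite -permM tt' deleteE // ns nt /= !permM tauK.
  have [e|_] := eqVneq (phi (tau x)) s.
    by rewrite e; case: ifP => [/eqP e'|]; rewrite ?h1s // h1t -e' h1s.
  have [e|//] := eqVneq (phi (tau x)) (tau s).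
  by rewrite e; case: ifP => [/eqP e'|]; rewrite ?h1t // h1s -h1t e'.
have conn'E x : x != s -> x != tau s -> conn phi' tau' h1 x = conn phi tau h1 x.
  by move=> ns nt; rewrite /conn h1del.
have [||||||k1 [X [Y [k1phi XY gen]]]] := IH phi' tau' h1.
- rewrite -ltnS; apply: leq_trans An; apply: proper_card; apply/properP; split.
    by apply/fintype.subsetP => x; rewrite !inE act' => /and3P[].
  by exists s; rewrite !inE ?act' ?eqxx.
- exact: tau'K.
- move=> x; rewrite tau'E /phi' delete_dualE ?tt //; case: ifP => // /norP[ns nt] tx.
  by rewrite fixphi // (negPf ns) (negPf nt).
- move=> q qphi qtau x y; rewrite !act' => /and3P[xs xt ax] /and3P[ys yt ay].
  have [q1 [q1phi q1E q1s]] := ext _ q qphi.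
  rewrite -!q1E //; apply: conn1 => // z.
  have [->|zs] := eqVneq z s; first by [].
  have [->|zt] := eqVneq z (tau s); first by rewrite tauK.
  rewrite !q1E //; last by rewrite (inj_eq perm_inj).
    by have := qtau z; rewrite tau'E (negPf zs) (negPf zt).
  by apply: contra_neq zt => <-; rewrite tauK.
- rewrite /toroidal tt' card_porbits_delete ?tt //.
  rewrite card_porbits_delete_dual ?tt //.
  have -> : [set x | tau' x == x] = s |: (tau s |: [set x | tau x == x]).
    apply/setP => x; rewrite !inE; have := act' x; case: (tau' x == x) => /=.
      by move=> /esym/negbT; rewrite !negb_and !negbK => /or3P[] ->; rewrite ?orbT.
    by move=> /esym/and3P[/negPf -> /negPf -> /negPf ->].
  move: Eul; rewrite /toroidal !cardsU1 !inE tauK (negPf as_) [s == _]eq_sym (negPf as_) /=.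
  by clear; lia.
- move=> x; rewrite act' => /and3P[ns nt ax]; rewrite !conn'E //.
  + by rewrite tau'E (negPf ns) (negPf nt) anti1.
  + by rewrite tau'E (negPf ns) (negPf nt) /=; apply: contra_neq nt => <-; rewrite tauK.
  + by rewrite tau'E (negPf ns) (negPf nt) /= (inj_eq perm_inj).
have [k2 [k2phi k2E k2s]] := ext _ k1 k1phi.
exists (fun x => k0 x * k2 x), X, Y; split=> // [x|]; first by rewrite k0phi k2phi.
move=> P PP PX PY x ax; have [P1 PM PV] := PP.
have -> : (k0 x * k2 x)^-1 * conn phi tau h x * (k0 (tau x) * k2 (tau x)) =
    (k2 x)^-1 * conn phi tau h1 x * k2 (tau x) by rewrite conn1E invgM !mulgA.
have c1s : conn phi tau h1 s = 1 by rewrite /conn h1s mulgV.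
have [->|ns] := eqVneq x s; first by rewrite c1s mulg1 k2s mulVg.
have [->|nt] := eqVneq x (tau s); first by rewrite anti1 // c1s invg1 mulg1 tauK k2s mulVg.
have := gen P PP PX PY x; rewrite act' ns nt ax => /(_ isT).
rewrite conn'E // tau'E (negPf ns) (negPf nt) /= !k2E //.
  by apply: contra_neq nt => <-; rewrite tauK.
by rewrite (inj_eq perm_inj).
Qed.
End Connection.
End CombinatorialMaps.

(** * The cusp torus *)

Section Paths.
Local Open Scope nat_scope.
Variables (N : nat) (T : triangulation N).
Implicit Types (j : 'I_N) (r s : seq 'I_4) (S : {set 'I_4}) (x y z : oedge N).

Lemma tgt_cat j r s : tgt T j (r ++ s) = tgt T (tgt T j r) s.
Proof. by elim: r j => //= f r IH j. Qed.

Lemma tr_cat j r s a : tr T j (r ++ s) a = tr T (tgt T j r) s (tr T j r a).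
Proof. by elim: r j a => //= f r IH j a. Qed.

Lemma pivots_cat j r s S :
  pivots T j (r ++ s) S = pivots T j r S && pivots T (tgt T j r) s (tr T j r @: S)%SET.
Proof.
elim: r j S => [|f r IH] j S /=; first by rewrite imset_id.
by rewrite IH -andbA -imset_comp.
Qed.

Lemma pivots_subset j r (S S' : {set 'I_4}) :
  S' \subset S -> pivots T j r S -> pivots T j r S'.
Proof.
elim: r j S S' => //= f r IH j S S' sub /andP[fS pr].
by rewrite (contra (fintype.subsetP sub _) fS) (IH _ _ _ _ pr) // imsetS.
Qed.

Lemma pivots0 j r : pivots T j r finset.set0.
Proof. by elim: r j => //= f r IH j; rewrite finset.in_set0 imset0; apply: IH. Qed.

Lemma nb_back j f : nb T (nb T j f) (gl T j f f) = j. Proof. exact: nbK. Qed.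

Lemma gl_back j f a : gl T (nb T j f) (gl T j f f) (gl T j f a) = a.
Proof. by rewrite glK permK. Qed.

Lemma rev_path_props j r S : pivots T j r S ->
  [/\ tgt T (tgt T j r) (Defs.rev_path T j r) = j,
      forall a, tr T (tgt T j r) (Defs.rev_path T j r) (tr T j r a) = a &
      pivots T (tgt T j r) (Defs.rev_path T j r) (tr T j r @: S)%SET].
Proof.
elim: r j S => [|f r IH] j S /=; first by split.
move=> /andP[fS /IH[e1 e2 e3]]; split.
- by rewrite -cats1 tgt_cat e1 /= nb_back.
- by move=> a; rewrite -cats1 tr_cat e1 e2 /= gl_back.
- rewrite -cats1 pivots_cat e1 -[[set _ | x in S]%SET]/((tr T (nb T j f) r \o gl T j f) @: S)%SET.
  rewrite imset_comp e3 /= andbT -imset_comp.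
  by apply: contra fS => /imsetP[a /imsetP[c cS ->] /=]; rewrite e2 => /perm_inj ->.
Qed.

Lemma tgt_rev j r : tgt T (tgt T j r) (Defs.rev_path T j r) = j.
Proof. by case: (rev_path_props (pivots0 j r)). Qed.

Lemma tr_rev j r a : tr T (tgt T j r) (Defs.rev_path T j r) (tr T j r a) = a.
Proof. by case: (rev_path_props (pivots0 j r)). Qed.

Lemma pivots_rev j r S : pivots T j r S ->
  pivots T (tgt T j r) (Defs.rev_path T j r) (tr T j r @: S)%SET.
Proof. by case/rev_path_props. Qed.

Lemma same_edge_refl x : same_edge T x x. Proof. by exists [::]. Qed.

Lemma same_edge_trans x y z : same_edge T x y -> same_edge T y z -> same_edge T x z.
Proof.
move=> [r [p1 t1 a1 b1]] [s [p2 t2 a2 b2]]; exists (r ++ s).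
by rewrite pivots_cat p1 tgt_cat !tr_cat t1 a1 b1 imsetU1 imset_set1 a1 b1 p2.
Qed.

Lemma same_edge_sym x y : same_edge T x y -> same_edge T y x.
Proof.
move=> [r [p1 t1 a1 b1]]; exists (Defs.rev_path T x.1.1 r).
have := pivots_rev p1; rewrite imsetU1 imset_set1 t1 a1 b1 => ->.
by rewrite -t1 tgt_rev -a1 -b1 !tr_rev.
Qed.

Lemma same_edge_flip x y : same_edge T x y -> same_edge T (flip x) (flip y).
Proof. by move=> [r [p1 t1 a1 b1]]; exists r; rewrite /= finset.setUC. Qed.

Lemma flipK x : flip (flip x) = x. Proof. by case: x => [[]]. Qed.

End Paths.

(** * Sides of the cusp triangles in cyclic order *)

Section Darts.
Local Open Scope nat_scope.

Lemma ord4_ind (P : 'I_4 -> Prop) : P v0 -> P v1 -> P v2 -> P v3 -> forall v, P v.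
Proof.
by move=> p0 p1 p2 p3 [[|[|[|[|v]]]] hv] //;
  [move: p0|move: p1|move: p2|move: p3]; congr P; apply: val_inj.
Qed.

(* [nxt v f] is the [f'] for which [(v, f, f', f'')] is an even permutation:
   the next side, counterclockwise, of the triangle at [v]. *)
Definition nxt (v f : 'I_4) : 'I_4 :=
  nth v0 (nth [::] [:: [:: v0; v2; v3; v1]; [:: v3; v1; v0; v2];
                       [:: v1; v3; v2; v0]; [:: v2; v0; v1; v3]] v) f.

Lemma nxtvv v : nxt v v = v. Proof. by elim/ord4_ind: v. Qed.

Lemma nxt3 v f : nxt v (nxt v (nxt v f)) = f.
Proof. by elim/ord4_ind: v; elim/ord4_ind: f. Qed.

Lemma nxt_eqv v f : (v == nxt v f) = (v == f).
Proof. by elim/ord4_ind: v; elim/ord4_ind: f. Qed.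

Lemma nxt_eqf v f : (nxt v f == f) = (v == f).
Proof. by elim/ord4_ind: v; elim/ord4_ind: f. Qed.

Lemma nxt_cases v f a : v != f -> a != v -> [|| a == f, a == nxt v f | a == nxt v (nxt v f)].
Proof. by elim/ord4_ind: v; elim/ord4_ind: f; elim/ord4_ind: a. Qed.

(** An odd relabelling reverses the orientation, exchanging the next side with the previous one. By
    decomposition into transpositions it is a finite check. *)
Lemma nxt_perm (s : {perm 'I_4}) v f : v != f ->
  nxt (s v) (s f) = s (if odd_perm s then nxt v (nxt v f) else nxt v f).
Proof.
pose pn (b : bool) v f := if b then nxt v (nxt v f) else nxt v f.
rewrite -/(pn s v f); have [ts -> _] := prod_tpermP s.
elim: ts v f => [|[a b] ts IH] v f vf.
  by rewrite big_nil odd_perm1 !perm1.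
rewrite big_cons /=; set t := tperm a b; set u := (\prod_(_ <- _) _)%g in IH *.
have Qt v' f' : v' != f' -> nxt (t v') (t f') = t (pn t v' f').
  rewrite /t odd_tperm; elim/ord4_ind: a {t}; elim/ord4_ind: b;
  elim/ord4_ind: v'; elim/ord4_ind: f' => // _; by rewrite !permE.
rewrite odd_permM !permM IH; last by rewrite (inj_eq perm_inj).
congr (u _); case: (odd_perm u); rewrite /= ?addbT ?addbF; last exact: Qt.
rewrite /pn Qt // Qt; case: (odd_perm t) => //=; rewrite ?nxt3 //; rewrite ?nxt_eqv //.
Qed.

End Darts.

Section CuspMap.
Local Open Scope nat_scope.
Variables (N : nat) (T : triangulation N).
Local Notation dart := (oedge N).
Implicit Types (j : 'I_N) (v f u a : 'I_4) (x y : dart).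

(* The dart [(j, v, f)] is the side on face [f] of the triangle cutting off
   vertex [v] of the j-th tetrahedron; for [v = f] it is an inactive dummy. *)
Definition phif x : dart := (x.1.1, x.1.2, nxt x.1.2 x.2).
Definition tauf x : dart :=
  if x.1.2 == x.2 then x
  else (nb T x.1.1 x.2, gl T x.1.1 x.2 x.1.2, gl T x.1.1 x.2 x.2).

Lemma phif_can : cancel phif (phif \o phif).
Proof. by move=> [[j v] f]; rewrite /phif /= nxt3. Qed.

Lemma taufK : involutive tauf.
Proof.
move=> [[j v] f]; rewrite /tauf /=; have [->|vf] := eqVneq v f; first by rewrite /= eqxx.
by rewrite /= (inj_eq perm_inj) (negPf vf) nb_back !gl_back.
Qed.

Definition phi : {perm dart} := perm (can_inj phif_can).
Definition tau : {perm dart} := perm (inv_inj taufK).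
Definition nu : {perm dart} := (tau * phi)%g.

(** One end of the side [x]: a vertex of the cusp triangulation is an end of an edge of T, that is
    an oriented edge. As a triple it is the same as [phi x], but read as an edge. *)
Definition corner x : oedge N := (x.1.1, x.1.2, nxt x.1.2 x.2).

Lemma phiE j v f : phi (j, v, f) = (j, v, nxt v f).
Proof. by rewrite permE. Qed.

Lemma phi3 x : phi (phi (phi x)) = x.
Proof. by case: x => [[j v] f]; rewrite !phiE nxt3. Qed.

Lemma cornerE x : corner x = phi x. Proof. by rewrite permE. Qed.

Lemma tauE j v f : v != f -> tau (j, v, f) = (nb T j f, gl T j f v, gl T j f f).
Proof. by move=> /negPf vf; rewrite permE /tauf /= vf. Qed.

Lemma tau_inact j v : tau (j, v, v) = (j, v, v).
Proof. by rewrite permE /tauf /= eqxx. Qed.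

Lemma tauK : involutive tau. Proof. by move=> x; rewrite !permE taufK. Qed.

Lemma nuE x : nu x = phi (tau x). Proof. by rewrite permM. Qed.

Lemma tau_act x : (tau x != x) = (x.1.2 != x.2).
Proof.
case: x => [[j v] f] /=; have [<-|vf] := eqVneq v f; first by rewrite tau_inact eqxx.
rewrite tauE //; apply/eqP => -[e1 e2 e3].
by have := gl_fixfree T j f; rewrite e1 e3 eqxx.
Qed.

Lemma tau_phi_fix x : tau x = x -> phi x = x.
Proof.
case: x => [[j v] f] /eqP; rewrite -[_ == _]negbK tau_act /= negbK => /eqP ->.
by rewrite phiE nxtvv.
Qed.

Lemma nu_act x : tau (nu x) != nu x = (tau x != x).
Proof.
rewrite !tau_act nuE; case: x => [[j v] f] /=.
have [<-|vf] := eqVneq v f; first by rewrite tau_inact phiE nxtvv eqxx.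
by rewrite tauE // phiE /= nxt_eqv (inj_eq perm_inj).
Qed.

Lemma phi_act x : tau (phi x) != phi x = (tau x != x).
Proof. by rewrite !tau_act; case: x => [[j v] f] /=; rewrite phiE /= nxt_eqv. Qed.

Lemma nuEj j v f : v != f ->
  nu (j, v, f) = (nb T j f, gl T j f v, gl T j f (nxt v (nxt v f))).
Proof. by move=> vf; rewrite nuE tauE // phiE nxt_perm // gl_odd. Qed.

Lemma corner_nu j v f : v != f ->
  corner (nu (j, v, f)) = (nb T j f, gl T j f v, gl T j f (nxt v f)).
Proof.
move=> vf; rewrite nuEj // /corner /= nxt_perm ?nxt_eqv // gl_odd.
by rewrite nxt3.
Qed.

Lemma corner_nuV j v f y : v != f -> nu y = (j, v, f) -> let g := nxt v (nxt v f) in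
  corner y = (nb T j g, gl T j g v, gl T j g (nxt v f)).
Proof.
move=> vf ny g; have vg : v != g by rewrite /g !nxt_eqv.
have -> : y = tau (j, v, g).
  by apply: (can_inj tauK); apply: (@perm_inj _ phi); rewrite -nuE ny tauK phiE /g nxt3.
rewrite tauE // /corner /= nxt_perm // gl_odd.
by rewrite {6}/g nxt3.
Qed.

(** Of the faces of a tetrahedron, only two contain a given edge: crossing one of them is a step by
    [nu], crossing the other a step by its inverse. *)
Lemma star_path_nu r x : tau x != x ->
    let p := corner x in pivots T p.1.1 r [set p.1.2; p.2]%SET ->
  exists2 y, y \in porbit nu x &
    corner y = (tgt T p.1.1 r, tr T p.1.1 r p.1.2, tr T p.1.1 r p.2).
Proof.
elim: r x => [|f r IH] [[j v] g] ax /=; first by exists (j, v, g); rewrite ?porbit_id.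
rewrite imsetU1 imset_set1 !inE => /andP[/norP[fv fu] pr]; move: (ax).
rewrite tau_act /= => vg.
have := nxt_cases vg fv; rewrite (negPf fu) /= => /orP[]/eqP ef; subst f.
  have := IH (nu (j, v, g)); rewrite nu_act => /(_ ax).
  rewrite corner_nu //= => /(_ pr)[y yo ey].
  by exists y => //; move: yo; rewrite porbit_sym porbit_step porbit_sym.
pose y := (nu^-1)%g (j, v, g).
have ny : nu y = (j, v, g) by rewrite permKV.
have := IH y; rewrite -nu_act ny => /(_ ax).
rewrite (corner_nuV vg ny) /= => /(_ pr)[z zo ez].
by exists z => //; rewrite porbit_sym -ny porbit_step porbit_sym.
Qed.

Lemma corner_inj : injective corner.
Proof. by move=> x y; rewrite !cornerE => /perm_inj. Qed.

Lemma same_edge_nu x : tau x != x -> same_edge T (corner x) (corner (nu x)).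
Proof.
case: x => [[j v] f] ax; move: (ax); rewrite tau_act /= => vf; rewrite corner_nu //.
by exists [:: f]; rewrite /= !inE eq_sym (negPf vf) eq_sym nxt_eqf (negPf vf).
Qed.

Lemma porbit_same_edge x y : tau x != x ->
  y \in porbit nu x <-> same_edge T (corner x) (corner y).
Proof.
move=> ax; split=> [/porbitP[i ->]|].
  elim: i => [|i IH]; first by rewrite perm1; apply: same_edge_refl.
  apply: same_edge_trans IH _; rewrite expgSr permM; apply: same_edge_nu.
  by elim: i => [|i IHi]; rewrite ?perm1 // expgSr permM nu_act.
move=> [r [pr e1 e2 e3]]; have [z zo ez] := star_path_nu ax pr.
suff -> : y = z by [].
by apply: corner_inj; rewrite ez [corner y]surjective_pairing [(corner y).1]surjective_pairing -e1 -e2 -e3.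
Qed.

End CuspMap.

Lemma card_porbits_label (D L : finType) (p : {perm D}) (lab : D -> L) :
  (forall x y, (y \in porbit p x) = (lab x == lab y)) ->
  (forall l, exists x, lab x = l) -> #|porbits p| = #|L|.
Proof.
move=> labP labS; pose rep l := sval (cid (labS l)).
have repK l : lab (rep l) = l := svalP (cid (labS l)).
have -> : porbits p = [set porbit p (rep l) | l in [set: L]]%SET.
  apply/finset.setP => B; apply/imsetP/imsetP => -[x _ ->]; last by exists (rep x).
  exists (lab x); rewrite ?finset.in_setT //.
  by apply/eqP; rewrite eq_porbit_mem labP repK.
rewrite card_imset ?cardsT // => l l' /eqP.
by rewrite eq_porbit_mem labP !repK => /eqP ->.
Qed.

(** * The Euler characteristic of the cusp triangulation *)

Section EdgeClasses.
Local Open Scope nat_scope.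
Variables (N : nat) (T : triangulation N) (e : 'I_N -> oedge N).
Hypothesis hT : one_cusped T e.
Implicit Types (x y : oedge N) (p : 'I_N * bool).

Definition edge_end p : oedge N := if p.2 then e p.1 else flip (e p.1).

Lemma edge_end_neq p : (edge_end p).1.2 != (edge_end p).2.
Proof. by case: hT => _ _ ne _; rewrite /edge_end; case: p => i [] /=; rewrite ?ne // eq_sym ne. Qed.

Lemma same_edge_no_flip x : x.1.2 != x.2 -> ~ same_edge T x (flip x).
Proof. by case: hT => _ nf _ _; case: x => [[j a] b]; apply: nf. Qed.

Lemma on_edge_ends x i : on_edge T e x i <-> exists b, same_edge T x (edge_end (i, b)).
Proof.
split=> [[]|[[]]]; [by exists true|by exists false|by left|by right].
Qed.

Lemma edge_end_ex x : x.1.2 != x.2 -> exists p, same_edge T x (edge_end p).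
Proof.
case: hT => _ _ _ h /h[i [/on_edge_ends[b xb] _]].
by exists (i, b).
Qed.

Lemma edge_end_uniq x p q : x.1.2 != x.2 ->
  same_edge T x (edge_end p) -> same_edge T x (edge_end q) -> p = q.
Proof.
move=> ax xp xq; case: (hT) => _ _ _ /(_ x ax)[i [_ iu]].
have ip : i = p.1 by apply: iu; apply/on_edge_ends; exists p.2; case: (p) xp.
have iq : i = q.1 by apply: iu; apply/on_edge_ends; exists q.2; case: (q) xq.
have pq := same_edge_trans (same_edge_sym xp) xq.
have nf b : ~ same_edge T (edge_end (i, b)) (edge_end (i, ~~ b)).
  move=> h; apply: (@same_edge_no_flip (edge_end (i, b))); first exact: edge_end_neq.
  by case: b h; rewrite /edge_end //= flipK.
case: p q ip iq pq {xp xq} => [i1 b1] [i2 b2] /= <- <- pq.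
by congr (_, _); case: b1 b2 pq => [] [] // /nf.
Qed.

Definition end_class x : 'I_N * bool :=
  odflt (x.1.1, true) [pick p | `[< same_edge T x (edge_end p) >]].

Lemma end_classP x : x.1.2 != x.2 -> same_edge T x (edge_end (end_class x)).
Proof.
move=> ax; rewrite /end_class; case: pickP => [p /asboolP //|no].
by have [p /asboolP] := edge_end_ex ax; rewrite no.
Qed.

Lemma end_class_eq x p : x.1.2 != x.2 ->
  same_edge T x (edge_end p) <-> end_class x = p.
Proof.
move=> ax; split=> [xp|<-]; last exact: end_classP.
exact: edge_end_uniq (end_classP ax) xp.
Qed.

Lemma corner_neq x : ((corner x).1.2 != (corner x).2) = (tau T x != x).
Proof. by rewrite tau_act; case: x => [[j v] f]; rewrite /corner /= nxt_eqv. Qed.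

Lemma porbit_nu_class x y : tau T x != x -> tau T y != y ->
  (y \in porbit (nu T) x) = (end_class (corner x) == end_class (corner y)).
Proof.
move=> ax ay; have cx := ax; have cy := ay; rewrite -corner_neq in cx; rewrite -corner_neq in cy.
apply/idP/eqP => [/(porbit_same_edge _ ax) xy|exy].
  by apply/end_class_eq => //; apply: same_edge_trans xy (end_classP cy).
apply/(porbit_same_edge _ ax).
move/(end_class_eq _ cx): exy => xy.
exact: same_edge_trans xy (same_edge_sym (end_classP cy)).
Qed.

Lemma corner_of_end p : exists2 x, tau T x != x & corner x = edge_end p.
Proof.
exists (phi N (phi N (edge_end p))); last by rewrite cornerE phi3.
by rewrite !phi_act tau_act edge_end_neq.
Qed.

Lemma nu_inact x : tau T x = x -> porbit (nu T) x = [set x]%SET.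
Proof.
move=> tx; have nx : nu T x = x by rewrite nuE tx (tau_phi_fix tx).
apply/finset.setP => y; rewrite finset.in_set1; apply/idP/eqP => [|->]; last exact: porbit_id.
by case/porbitP=> i ->; elim: i => [|i IH]; rewrite ?perm1 // expgSr permM IH.
Qed.

Lemma card_porbits_nu : #|porbits (nu T)| = 2 * N + 4 * N.
Proof.
pose lab x : ('I_N * bool) + ('I_N * 'I_4) :=
  if x.1.2 == x.2 then inr x.1 else inl (end_class (corner x)).
rewrite (@card_porbits_label _ _ _ lab) ?card_sum ?card_prod ?card_ord ?card_bool ?[_ * 2]mulnC ?[_ * 4]mulnC //.
  move=> x y; rewrite /lab; have := tau_act T x; have [ex /negbFE/eqP tx|_ ax] := eqVneq x.1.2 x.2.
    rewrite nu_inact // finset.in_set1; have [->|ne] := eqVneq y x; first by rewrite ex !eqxx.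
    have [ey|//] := eqVneq y.1.2 y.2; apply/esym/eqP => -[exy]; case/eqP: ne.
    by rewrite [y]surjective_pairing [x]surjective_pairing -ex -ey exy.
  have := tau_act T y; have [ey /negbFE/eqP ty|_ ay] := eqVneq y.1.2 y.2.
    rewrite porbit_sym nu_inact // finset.in_set1; have [exy|//] := eqVneq x y.
    by rewrite exy ty eqxx in ax.
  by rewrite porbit_nu_class.
case=> [p|[j v]]; last by exists (j, v, v); rewrite /lab eqxx.
have [x ax cx] := corner_of_end p; exists x; rewrite /lab.
move: (ax); rewrite tau_act => /negPf ->; congr inl; apply/end_class_eq.
  by rewrite corner_neq.
by rewrite cx; apply: same_edge_refl.
Qed.

Lemma card_porbits_phi : #|porbits (phi N)| = 4 * N + 4 * N.
Proof.
pose lab x : ('I_N * 'I_4) + ('I_N * 'I_4) := if x.1.2 == x.2 then inr x.1 else inl x.1.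
rewrite (@card_porbits_label _ _ _ lab) ?card_sum ?card_prod ?card_ord ?[_ * 4]mulnC //.
  move=> x y; apply/idP/eqP.
    case/porbitP=> i ->; elim: i => [|i ->]; first by rewrite perm1.
    rewrite expgSr permM; case: ((phi N ^+ i)%g x) => [[j v] f].
    by rewrite phiE /lab /= nxt_eqv.
  case: x y => [[j v] f] [[j' v'] f']; rewrite /lab /=.
  have [<-|vf] := eqVneq v f; have [<-|vf'] := eqVneq v' f' => // -[<- ev]; first by rewrite ev porbit_id.
  subst v'; have := nxt_cases vf; rewrite eq_sym in vf' => /(_ _ vf').
  case/or3P => /eqP ->; first exact: porbit_id.
    by rewrite -phiE porbit_step porbit_id.
  by rewrite -!phiE !porbit_step porbit_id.
case=> [[j v]|[j v]]; last by exists (j, v, v); rewrite /lab eqxx.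
exists (j, v, if v == v0 then v1 else v0); rewrite /lab /=.
by elim/ord4_ind: v.
Qed.

Lemma tau_act_card : #|[set x | tau T x == x]%SET| = 4 * N.
Proof.
rewrite -[RHS](_ : #|[set (p, p.2) | p in [set: 'I_N * 'I_4]]%SET| = _); last first.
  rewrite card_imset ?cardsT ?card_prod ?card_ord 1?mulnC //.
  by move=> p q [].
apply: eq_card => -[[j v] f]; rewrite !inE; apply/idP/imsetP.
  by rewrite -[_ == _]negbK tau_act /= negbK => /eqP <-; exists (j, v); rewrite ?inE.
by move=> [[j' v'] _ [-> -> ->]]; rewrite tau_inact eqxx.
Qed.

(** The 4N triangles have 6N sides and 2N vertices, two per edge of T; the 4N dummies count once as
    faces and once as vertices. *)
Lemma cusp_toroidal : toroidal (phi N) (tau T).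
Proof.
rewrite /toroidal -/(nu T) card_porbits_nu card_porbits_phi tau_act_card.
by rewrite !card_prod !card_ord; lia.
Qed.

Lemma cusp_connected : connected_map (phi N) (tau T).
Proof.
move=> q qphi qtau.
have qtri j v f f' : f != v -> f' != v -> q (j, v, f) = q (j, v, f').
  move=> fv fv'; rewrite eq_sym in fv; have := nxt_cases fv fv'.
  by case/or3P=> /eqP ->; rewrite -?phiE ?qphi.
have qpath r j v f f' : f != v -> f' != tr T j r v -> pivots T j r [set v]%SET ->
    q (j, v, f) = q (tgt T j r, tr T j r v, f').
  elim: r j v f => [|g r IH] j v f fv fv' /=; first by move=> _; apply: qtri.
  rewrite imset_set1 finset.in_set1 => /andP[gv pr].
  rewrite (qtri _ _ _ g) // -qtau tauE; last by rewrite eq_sym.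
  by apply: IH => //; rewrite (inj_eq perm_inj).
move=> [[j v] f] [[j' v'] f']; rewrite !tau_act /= => vf vf'.
case: hT => /(_ j v j' v')[r [pr er etr]] _ _ _.
by rewrite (qpath r _ _ _ f') 1?eq_sym ?etr ?er // eq_sym.
Qed.

End EdgeClasses.

(** * The peripheral group *)

Section CuspHomotopy.
Local Open Scope nat_scope.
Variables (N : nat) (T : triangulation N).
Implicit Types (j : 'I_N) (v f u a : 'I_4) (r s w c : seq 'I_4).

(* Homotopy in the cusp cross-section: unlike in [homotopic T j [set v]], the
   edges around which one may turn must end at the transported vertex. *)
Inductive cusp_homotopic j v : seq 'I_4 -> seq 'I_4 -> Prop :=
| cusp_refl r : cusp_homotopic j v r r
| cusp_sym r s : cusp_homotopic j v r s -> cusp_homotopic j v s r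
| cusp_trans r s w :
    cusp_homotopic j v r s -> cusp_homotopic j v s w -> cusp_homotopic j v r w
| cusp_star r c s u : tr T j r v != u ->
    pivots T (tgt T j r) c [set tr T j r v; u]%SET -> tgt T (tgt T j r) c = tgt T j r ->
    tr T (tgt T j r) c (tr T j r v) = tr T j r v -> tr T (tgt T j r) c u = u ->
    cusp_homotopic j v (r ++ c ++ s) (r ++ s).

Lemma cusp_homotopic_end j v r s : cusp_homotopic j v r s ->
  [/\ tgt T j r = tgt T j s, tr T j r v = tr T j s v &
      pivots T j r [set v]%SET = pivots T j s [set v]%SET].
Proof.
elim=> {r s} [r|r s _ [-> -> ->]|r s w _ [-> -> ->] _ [-> -> ->]|r c s u ne pc tc c1 c2] //.
rewrite !tgt_cat !tr_cat !pivots_cat tc c1 !imset_set1 c1.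
suff -> : pivots T (tgt T j r) c [set tr T j r v]%SET by [].
by apply: pivots_subset pc; rewrite finset.sub1set !inE eqxx.
Qed.

Lemma cusp_homotopic_catl j v t r s :
  cusp_homotopic (tgt T j t) (tr T j t v) r s -> cusp_homotopic j v (t ++ r) (t ++ s).
Proof.
elim=> {r s} [r|r s _|r s w _ h1 _ h2|r c s w ne pc tc c1 c2].
- exact: cusp_refl.
- exact: cusp_sym.
- exact: cusp_trans h1 h2.
- rewrite !(catA t); apply: (@cusp_star _ _ _ _ _ w); rewrite ?tgt_cat ?tr_cat //.
Qed.

Lemma cusp_homotopic_catr j v w r s :
  cusp_homotopic j v r s -> cusp_homotopic j v (r ++ w) (s ++ w).
Proof.
elim=> {r s} [r|r s _|r s t _ h1 _ h2|r c s u ne pc tc c1 c2].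
- exact: cusp_refl.
- exact: cusp_sym.
- exact: cusp_trans h1 h2.
- by rewrite -!catA; apply: (@cusp_star _ _ _ _ _ u).
Qed.

Lemma cusp_homotopic_incl j v r s : cusp_homotopic j v r s ->
  pivots T j r [set v]%SET -> homotopic T j [set v]%SET r s.
Proof.
elim=> {r s} [r pr|r s /cusp_homotopic_end[_ _ e] IH|r s w rs IH1 _ IH2 pr|r c s u ne pc tc c1 c2 pr].
- exact: homotopic_refl.
- by rewrite -e => /IH/homotopic_sym.
- apply: homotopic_trans (IH1 pr) (IH2 _).
  by have [_ _ <-] := cusp_homotopic_end rs.
- by apply: homotopic_star pr; exists (tr T j r v), u; split.
Qed.

Lemma cusp_rev j v r : pivots T j r [set v]%SET ->
  cusp_homotopic j v (r ++ Defs.rev_path T j r) [::].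
Proof.
elim: r j v => [|f r IH] j v /=; first by move=> _; apply: cusp_refl.
rewrite imset_set1 finset.in_set1 => /andP[fv /IH h].
apply: (@cusp_trans _ _ _ ([:: f] ++ [:: gl T j f f])).
  rewrite -cats1 -cat_cons -[f :: r]/([:: f] ++ r) -catA.
  apply: cusp_homotopic_catl; rewrite /= catA -[[:: gl _ _ _ _]]cat0s.
  exact: cusp_homotopic_catr.
have := @cusp_star j v [::] [:: f; gl T j f f] [::] (nxt v f).
apply; rewrite /= ?gl_back ?nb_back ?nxt_eqv 1?eq_sym //.
rewrite !inE (negPf fv) [f == _]eq_sym nxt_eqf eq_sym (negPf fv) /=.
by rewrite imsetU1 imset_set1 !inE !(inj_eq perm_inj) (negPf fv) [f == _]eq_sym nxt_eqf eq_sym (negPf fv).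
Qed.

Lemma cusp_rev_rev j r : Defs.rev_path T (tgt T j r) (Defs.rev_path T j r) = r.
Proof.
have rev_cat k s t : Defs.rev_path T k (s ++ t) =
    Defs.rev_path T (tgt T k s) t ++ Defs.rev_path T k s.
  elim: s k => [|f s IH] k /=; first by rewrite cats0.
  by rewrite IH rcons_cat.
elim: r j => [//|f r IH] j /=.
by rewrite -cats1 rev_cat IH /= tgt_rev gl_back.
Qed.

Lemma cusp_revl j v r : pivots T j r [set v]%SET ->
  cusp_homotopic (tgt T j r) (tr T j r v) (Defs.rev_path T j r ++ r) [::].
Proof.
move=> pr; rewrite -{4}[r](cusp_rev_rev j); apply: cusp_rev.
by have := pivots_rev pr; rewrite imset_set1.
Qed.

(** One path followed by the reverse of the other is a loop in the star of the edge [vu], which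
    bounds there. *)
Lemma cusp_star_paths j v u r s : v != u ->
    pivots T j r [set v; u]%SET -> pivots T j s [set v; u]%SET ->
    tgt T j r = tgt T j s -> tr T j r v = tr T j s v -> tr T j r u = tr T j s u ->
  cusp_homotopic j v r s.
Proof.
move=> vu pr ps et ev eu.
have pr1 : pivots T j r [set v]%SET.
  by apply: pivots_subset pr; rewrite finset.sub1set !inE eqxx.
apply: (@cusp_trans _ _ _ ((s ++ Defs.rev_path T j r) ++ r)).
  apply: cusp_sym; have := @cusp_star j v [::] (s ++ Defs.rev_path T j r) r u.
  apply; rewrite //= ?tgt_cat ?tr_cat -?et -?ev -?eu ?tgt_rev ?tr_rev //.
  rewrite pivots_cat ps -et imsetU1 imset_set1 -ev -eu /=.
  by have := pivots_rev pr; rewrite imsetU1 imset_set1.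
rewrite -catA -[X in cusp_homotopic _ _ _ X]cats0; apply: cusp_homotopic_catl.
by rewrite -et -ev; apply: cusp_revl.
Qed.

End CuspHomotopy.

Section CuspGroup.
Local Open Scope quotient_scope.
Variables (N : nat) (T : triangulation N) (j0 : 'I_N) (w0 : 'I_4).

Definition cusp_loop (w : seq 'I_4) : bool :=
  [&& pivots T j0 w [set w0]%SET, tgt T j0 w == j0 & tr T j0 w w0 == w0].

Definition cusp_loops : Type := {w : seq 'I_4 | cusp_loop w}.
HB.instance Definition _ := Choice.on cusp_loops.

Definition loop_eq : rel cusp_loops :=
  fun u w => `[< cusp_homotopic T j0 w0 (val u) (val w) >].

Lemma loop_eq_refl : reflexive loop_eq.
Proof. by move=> u; apply/asboolP/cusp_refl. Qed.
Lemma loop_eq_sym : symmetric loop_eq.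
Proof. by move=> u w; apply/asboolP/asboolP => /cusp_sym. Qed.
Lemma loop_eq_trans : transitive loop_eq.
Proof. by move=> u w t /asboolP h1 /asboolP h2; apply/asboolP/(cusp_trans h1 h2). Qed.
Canonical loop_equiv := EquivRel loop_eq loop_eq_refl loop_eq_sym loop_eq_trans.

(** The fundamental group of the cusp torus, based at the triangle at vertex [w0] of tetrahedron
    [j0]. *)
Definition cusp_group : Type := {eq_quot loop_equiv}.
HB.instance Definition _ := Choice.on cusp_group.

Lemma cusp_loop_nil : cusp_loop [::]. Proof. by rewrite /cusp_loop /= !eqxx. Qed.

Lemma cusp_loop_cat u w : cusp_loop u -> cusp_loop w -> cusp_loop (u ++ w).
Proof.
move=> /and3P[p1 /eqP t1 /eqP v1] /and3P[p2 t2 v2].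
by rewrite /cusp_loop pivots_cat tgt_cat tr_cat imset_set1 t1 v1 p1 p2 t2 v2.
Qed.

Lemma cusp_loop_rev w : cusp_loop w -> cusp_loop (Defs.rev_path T j0 w).
Proof.
move=> /and3P[p1 /eqP t1 /eqP v1]; have := pivots_rev p1.
have := tgt_rev T j0 w; have := tr_rev T j0 w w0.
by rewrite imset_set1 /cusp_loop t1 v1 => -> -> ->; rewrite !eqxx.
Qed.

Definition loop_class (w : seq 'I_4) : cusp_group :=
  \pi_({eq_quot loop_equiv}) (insubd (exist _ [::] cusp_loop_nil) w).

Lemma loop_classE u w : cusp_loop u -> cusp_loop w ->
  loop_class u = loop_class w <-> cusp_homotopic T j0 w0 u w.
Proof.
move=> lu lw; split.
  by move=> /eqmodP/asboolP; rewrite !insubdK.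
by move=> h; apply/eqmodP/asboolP; rewrite !insubdK.
Qed.

Lemma loop_class_ex (x : cusp_group) : exists2 w, cusp_loop w & x = loop_class w.
Proof.
elim/quotW: x => -[w lw]; exists w => //; rewrite /loop_class; congr (\pi _).
by apply: val_inj; rewrite /= insubdK.
Qed.

Definition loop_repr (x : cusp_group) : seq 'I_4 := s2val (cid2 (loop_class_ex x)).
Lemma loop_reprP x : cusp_loop (loop_repr x).
Proof. exact: s2valP (cid2 (loop_class_ex x)). Qed.
Lemma loop_reprK x : loop_class (loop_repr x) = x.
Proof. exact/esym/(s2valP' (cid2 (loop_class_ex x))). Qed.

Definition cusp_mul (x y : cusp_group) := loop_class (loop_repr x ++ loop_repr y).
Definition cusp_inv (x : cusp_group) := loop_class (Defs.rev_path T j0 (loop_repr x)).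

Lemma loop_class_cat u w : cusp_loop u -> cusp_loop w ->
  loop_class (u ++ w) = cusp_mul (loop_class u) (loop_class w).
Proof.
move=> lu lw; apply/loop_classE; [exact: cusp_loop_cat|apply: cusp_loop_cat; exact: loop_reprP|].
have hu : cusp_homotopic T j0 w0 u (loop_repr (loop_class u)).
  by apply/loop_classE; rewrite ?loop_reprP ?loop_reprK.
have hw : cusp_homotopic T j0 w0 w (loop_repr (loop_class w)).
  by apply/loop_classE; rewrite ?loop_reprP ?loop_reprK.
apply: cusp_trans (cusp_homotopic_catr _ hu) (cusp_homotopic_catl _).
by case/and3P: (loop_reprP (loop_class u)) => _ /eqP -> /eqP ->.
Qed.

Lemma cusp_mulA : associative cusp_mul.
Proof.
move=> x y z; rewrite -[x]loop_reprK -[y]loop_reprK -[z]loop_reprK.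
by rewrite -!loop_class_cat ?catA ?cusp_loop_cat ?loop_reprP.
Qed.

Lemma cusp_mul1 : left_id (loop_class [::]) cusp_mul.
Proof.
by move=> x; rewrite -[x]loop_reprK -loop_class_cat ?loop_reprP ?cusp_loop_nil.
Qed.

Lemma cusp_mulr1 : right_id (loop_class [::]) cusp_mul.
Proof.
by move=> x; rewrite -[x]loop_reprK -loop_class_cat ?cats0 ?loop_reprP ?cusp_loop_nil.
Qed.

Lemma cusp_mulV : left_inverse (loop_class [::]) cusp_inv cusp_mul.
Proof.
move=> x; have lx := loop_reprP x; rewrite -{2}[x]loop_reprK /cusp_inv.
rewrite -loop_class_cat ?cusp_loop_rev //; apply/loop_classE; rewrite ?cusp_loop_cat ?cusp_loop_rev ?cusp_loop_nil //.
by case/and3P: lx => p1 /eqP t1 /eqP v1; have := cusp_revl p1; rewrite t1 v1.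
Qed.

Lemma cusp_mulrV : right_inverse (loop_class [::]) cusp_inv cusp_mul.
Proof.
move=> x; have lx := loop_reprP x; rewrite -{1}[x]loop_reprK /cusp_inv.
rewrite -loop_class_cat ?cusp_loop_rev //; apply/loop_classE; rewrite ?cusp_loop_cat ?cusp_loop_rev ?cusp_loop_nil //.
by case/and3P: lx => p1 _ _; apply: cusp_rev.
Qed.

HB.instance Definition _ := isGroup.Build cusp_group
  cusp_mulA cusp_mul1 cusp_mulr1 cusp_mulV cusp_mulrV.

End CuspGroup.

Section CuspGroupAbelian.
Variables (N : nat) (T : triangulation N) (e : 'I_N -> oedge N).
Hypothesis hT : one_cusped T e.
Variables (j0 : 'I_N) (w0 : 'I_4).
Local Open Scope group_scope.
Local Notation Q := (cusp_group T j0 w0).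
Implicit Types (j : 'I_N) (v f u : 'I_4) (r s : seq 'I_4) (x y : oedge N).

Lemma cusp_path_ex j v : exists r,
  [/\ pivots T j0 r [set w0]%SET, tgt T j0 r = j, tr T j0 r w0 = v &
      (j, v) = (j0, w0) -> r = [::]].
Proof.
have [[-> ->]|ne] := eqVneq (j, v) (j0, w0); first by exists [::].
have [/(_ j0 w0 j v)[r [p t1 t2]] _ _ _] := hT.
by exists r; split=> // E; rewrite E eqxx in ne.
Qed.

Definition cusp_path j v := sval (cid (cusp_path_ex j v)).

Lemma cusp_pathP j v :
  [/\ pivots T j0 (cusp_path j v) [set w0]%SET, tgt T j0 (cusp_path j v) = j &
      tr T j0 (cusp_path j v) w0 = v].
Proof. by rewrite /cusp_path; case: cid => r /= []. Qed.

Lemma cusp_path_base : cusp_path j0 w0 = [::].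
Proof. by rewrite /cusp_path; case: cid => r /= [_ _ _ ->]. Qed.

(** Paths chosen once for each triangle close any path into a loop, turning the path groupoid into a
    group; the chosen path at the base is empty, so based loops are unchanged. *)
Definition close_path j v r :=
  cusp_path j v ++ r ++ Defs.rev_path T j0 (cusp_path (tgt T j r) (tr T j r v)).

Definition path_class j v r : Q := loop_class T j0 w0 (close_path j v r).

Lemma close_pathP j v r : pivots T j r [set v]%SET -> cusp_loop T j0 w0 (close_path j v r).
Proof.
move=> pr; have [p1 t1 v1] := cusp_pathP j v.
have [p2 t2 v2] := cusp_pathP (tgt T j r) (tr T j r v).
rewrite /cusp_loop /close_path !pivots_cat !tgt_cat !tr_cat !imset_set1 p1 t1 v1 pr.
have := tgt_rev T j0 (cusp_path (tgt T j r) (tr T j r v)).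
have := tr_rev T j0 (cusp_path (tgt T j r) (tr T j r v)) w0.
have := pivots_rev p2.
by rewrite imset_set1 t2 v2 => -> -> ->; rewrite !eqxx.
Qed.

Lemma path_class_homotopic j v r s : pivots T j r [set v]%SET ->
  cusp_homotopic T j v r s -> path_class j v r = path_class j v s.
Proof.
move=> pr rs; have [e1 e2 e3] := cusp_homotopic_end rs.
apply/loop_classE; [exact: close_pathP|by apply: close_pathP; rewrite -e3|].
rewrite /close_path e1 e2; have [_ t1 v1] := cusp_pathP j v.
by apply: cusp_homotopic_catl; rewrite t1 v1; apply: cusp_homotopic_catr.
Qed.

Lemma path_class_nil j v : path_class j v [::] = 1.
Proof.
apply/loop_classE; [exact: close_pathP|exact: cusp_loop_nil|].
by have [p1 _ _] := cusp_pathP j v; apply: cusp_rev.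
Qed.

Lemma path_class_cat j v r s : pivots T j r [set v]%SET ->
    pivots T (tgt T j r) s [set tr T j r v]%SET ->
  path_class j v (r ++ s) = path_class j v r * path_class (tgt T j r) (tr T j r v) s.
Proof.
move=> pr ps; have prs : pivots T j (r ++ s) [set v]%SET.
  by rewrite pivots_cat pr imset_set1.
rewrite /path_class -[_ * _]loop_class_cat; try exact: close_pathP.
apply/loop_classE; [exact: close_pathP|by apply: cusp_loop_cat; exact: close_pathP|].
rewrite /close_path tgt_cat tr_cat -!catA.
have [p1 t1 v1] := cusp_pathP j v.
apply: cusp_homotopic_catl; apply: cusp_homotopic_catl; rewrite t1 v1.
rewrite !catA; apply: cusp_homotopic_catr; apply: cusp_sym.
have [p2 t2 v2] := cusp_pathP (tgt T j r) (tr T j r v).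
have := cusp_revl p2; rewrite t2 v2 => h.
by have := cusp_homotopic_catr s h.
Qed.

Lemma path_class_rev j v r : pivots T j r [set v]%SET ->
  path_class (tgt T j r) (tr T j r v) (Defs.rev_path T j r) = (path_class j v r)^-1.
Proof.
move=> pr; have prr := pivots_rev pr; rewrite imset_set1 in prr.
have hh := path_class_cat pr prr.
rewrite (path_class_homotopic _ (cusp_rev pr)) ?path_class_nil in hh.
  by apply/esym/mulg1_eq.
by rewrite pivots_cat pr imset_set1.
Qed.

Lemma star_path_ex x : exists r, tau T x != x ->
  let p := corner x in let q := edge_end e (end_class T e p) in
  [/\ pivots T p.1.1 r [set p.1.2; p.2]%SET, tgt T p.1.1 r = q.1.1,
      tr T p.1.1 r p.1.2 = q.1.2 & tr T p.1.1 r p.2 = q.2].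
Proof.
have [ax|] := boolP (tau T x != x); last by exists [::].
have [|r hr] := end_classP hT (x := corner x); first by rewrite (corner_neq T).
by exists r.
Qed.

Definition star_path x := sval (cid (star_path_ex x)).

(** A potential for the connection given by the classes of single crossings: the star path leads to
    a fixed representative of the edge, the same for all darts around one vertex. *)
Definition star_class x : Q :=
  if tau T x == x then 1 else path_class x.1.1 x.1.2 (star_path x).

(** Crossing [f] and then following the star path of the next dart stays in the star of one edge and
    ends where the star path of the first dart does, so the two are homotopic. *)
Lemma star_conn j v f : v != f ->
  conn (phi N) (tau T) star_class (j, v, f) = path_class j v [:: f].
Proof.
move=> vf; set x := (j, v, f).
have ax : tau T x != x by rewrite tau_act.
have anx : tau T (nu T x) != nu T x by rewrite nu_act.
rewrite /conn -nuE /star_class (negPf ax) (negPf anx).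
rewrite /star_path; case: cid => r /= /(_ ax)[p1 t1 a1 b1].
case: cid => s /= /(_ anx).
have := porbit_nu_class hT ax anx; rewrite porbit_step porbit_id => /esym/eqP <-.
have := corner_nu T j vf; rewrite /corner -/x => -[cn1 cn2 cn3].
rewrite cn3 cn2 cn1 => -[p2 t2 a2 b2].
have pv S u k t : pivots T k t [set S; u]%SET -> pivots T k t [set S]%SET.
  by apply: pivots_subset; rewrite finset.sub1set !inE eqxx.
rewrite -path_class_rev; last by apply: pv p2.
rewrite t2 a2 -t1 -a1 -path_class_cat; first last.
- rewrite t1 a1 -t2 -a2; have := pivots_rev (pv _ _ _ _ p2).
  by rewrite imset_set1.
- exact: pv p1.
have pf : pivots T j [:: f] [set v]%SET by rewrite /= finset.in_set1 eq_sym vf.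
have h1 : cusp_homotopic T j v r (f :: s).
  apply: (cusp_star_paths (u := nxt v f)); rewrite ?nxt_eqv //=.
  - by rewrite !inE eq_sym (negPf vf) eq_sym nxt_eqf (negPf vf) imsetU1 imset_set1.
  - by rewrite t1 t2.
  - by rewrite a1 a2.
  - by rewrite b1 b2.
apply: path_class_homotopic.
  rewrite pivots_cat (pv _ _ _ _ p1) imset_set1 /= t1 a1 -t2 -a2.
  by have := pivots_rev (pv _ _ _ _ p2); rewrite imset_set1.
apply: cusp_trans (cusp_homotopic_catr _ h1) _.
rewrite -[f :: s]/([:: f] ++ s) -catA -[X in cusp_homotopic _ _ _ _ X]cats0.
by apply: cusp_homotopic_catl; apply: cusp_rev; apply: pv p2.
Qed.

Lemma star_antisym : antisym (phi N) (tau T) star_class.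
Proof.
move=> [[j v] f] ax; move: (ax); rewrite tau_act /= => vf.
rewrite tauE // !star_conn ?(inj_eq perm_inj) // -path_class_rev //.
by rewrite /= finset.in_set1 eq_sym vf.
Qed.

Fixpoint path_darts j v r : seq (oedge N) :=
  if r is f :: r' then (j, v, f) :: path_darts (nb T j f) (gl T j f v) r' else [::].

Lemma path_class_prod j v r : pivots T j r [set v]%SET ->
  path_class j v r = \prod_(x <- path_darts j v r) conn (phi N) (tau T) star_class x.
Proof.
elim: r j v => [|f r IH] j v; first by rewrite path_class_nil big_nil.
move=> /[dup] /= /andP[]; rewrite finset.in_set1 imset_set1 => fv pr _.
rewrite big_cons -IH // star_conn 1?eq_sym // -[f :: r]/([:: f] ++ r).
by rewrite path_class_cat //= finset.in_set1 fv.
Qed.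

(** By [torus_gauge], the gauged classes of crossings lie in the subgroup generated by two commuting
    elements, so they commute with each other; every loop class is, up to conjugation by one fixed
    element, a product of them. *)
Lemma cusp_group_comm (a b : Q) : a * b = b * a.
Proof.
have [k [X [Y [kphi XY gen]]]] := torus_gauge (leqnn _) (@tauK _ T) (@tau_phi_fix _ T)
  (cusp_connected hT) (cusp_toroidal hT) star_antisym.
set g := fun x => (k x)^-1 * conn (phi N) (tau T) star_class x * k (tau T x).
(* Centralizers are subgroups; [gen] is applied first to that of X and Y, then to that of a gauged
   class. *)
have cent (S : Q -> Prop) : subgroup_pred (fun z : Q => forall z' : Q, S z' -> commute z' z).
  by split=> *; [apply: commute1|apply: commuteM; auto|apply: commuteV; auto].
have gXY x : tau T x != x -> commute X (g x) /\ commute Y (g x).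
  move=> ax; have h := gen _ (cent (fun z => z = X \/ z = Y)) _ _ x ax.
  by split; apply: h; auto; move=> y [] ->.
have gg x y : tau T x != x -> tau T y != y -> commute (g x) (g y).
  move=> ax ay; apply: (gen _ (cent (fun z => z = g x)) _ _ y ay) => // z ->;
  by apply: commute_sym; case: (gXY x ax).
pose K j v := k (j, v, if v == v0 then v1 else v0).
have kK j v f : v != f -> k (j, v, f) = K j v.
  move=> vf; have := @nxt_cases v f (if v == v0 then v1 else v0) vf.
  have -> : (if v == v0 then v1 else v0) != v by elim/ord4_ind: (v).
  by rewrite /K => /(_ isT)/or3P[]/eqP ->; rewrite -?phiE ?kphi.
have pathW r j v : pivots T j r [set v]%SET -> exists W : Q,
    path_class j v r = K j v * W * (K (tgt T j r) (tr T j r v))^-1 /\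
    forall P : Q -> Prop, subgroup_pred P -> (forall x, tau T x != x -> P (g x)) -> P W.
  elim: r j v => [|f r IH] j v.
    move=> _; exists 1; rewrite path_class_nil mulg1 mulgV; split=> // P [] //.
  move=> /[dup] /= /andP[]; rewrite finset.in_set1 imset_set1 => fv pr _.
  have vf : v != f by rewrite eq_sym.
  have [W [e1 e2]] := IH _ _ pr; exists (g (j, v, f) * W); split; last first.
    by move=> P PP gP; have [_ PM _] := PP; apply: PM; [apply: gP; rewrite tau_act|apply: e2].
  rewrite -[f :: r]/([:: f] ++ r) path_class_cat //=; last by rewrite finset.in_set1 fv.
  rewrite e1 -star_conn // /g kK // tauE // kK ?(inj_eq perm_inj) //.
  by rewrite !mulgA mulgV mul1g.
have loopW w : cusp_loop T j0 w0 w -> exists W : Q,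
    loop_class T j0 w0 w = K j0 w0 * W * (K j0 w0)^-1 /\
    forall P : Q -> Prop, subgroup_pred P -> (forall x, tau T x != x -> P (g x)) -> P W.
  move=> /and3P[pw /eqP tw /eqP vw]; have := pathW _ _ _ pw.
  by rewrite /path_class /close_path tw vw cusp_path_base cats0.
have [u lu ->] := loop_class_ex a; have [w lw ->] := loop_class_ex b.
have [U [-> hU]] := loopW _ lu; have [W [-> hW]] := loopW _ lw.
have UW : U * W = W * U.
  apply: (hW _ (cent (fun z => z = U)) _ U erefl) => x ax _ ->.
  apply: commute_sym; apply: (hU _ (cent (fun z => z = g x)) _ (g x) erefl) => y ay _ ->.
  exact: gg.
by rewrite -!mulgA !mulKg ![U * (W * _)]mulgA UW !mulgA.
Qed.

End CuspGroupAbelian.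

(** * Null-homologous loops are null-homotopic *)

Section NullHomologous.
Local Open Scope ring_scope.

Lemma sum_pairs (V : nmodType) (D : finType) (t : {perm D}) (F F' : D -> V) :
    involutive t -> (forall x, t x != x -> F x + F (t x) = F' x + F' (t x)) ->
    (forall x, t x = x -> F x = F' x) ->
  \sum_x F x = \sum_x F' x.
Proof.
move=> tK hF hfix.
pose O := [pred x | (enum_rank x < enum_rank (t x))%N].
have split_sum (E : D -> V) :
    \sum_x E x = \sum_(x | O x) (E x + E (t x)) + \sum_(x | t x == x) E x.
  rewrite (bigID (fun x => t x == x)) /= addrC; congr (_ + _).
  rewrite (bigID O) /= big_split /=; congr (_ + _).
    apply: eq_bigl => x; rewrite /= andbC; case: (ltnP _ _) => //= lt.
    by apply: contraTneq lt => ->; rewrite ltnn.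
  rewrite (reindex_inj (@perm_inj _ t)) /=; apply: eq_bigl => x.
  rewrite /= tK -leqNgt leq_eqVlt; have [tx|ne] := eqVneq (t x) x.
    by rewrite tx eqxx ltnn.
  by rewrite (inj_eq val_inj) (inj_eq enum_rank_inj) ![x == _]eq_sym (negPf ne).
rewrite !split_sum; congr (_ + _); apply: eq_bigr => x.
  by move=> Ox; apply: hF; apply: contraTneq Ox => /= ->; rewrite ltnn.
by move=> /eqP; apply: hfix.
Qed.

Lemma sum_count (V : nmodType) (D : finType) (s : seq D) (F : D -> V) :
  \sum_(x <- s) F x = \sum_x F x *+ count_mem x s.
Proof.
elim: s => [|y s IH]; first by rewrite big_nil big1.
rewrite big_cons IH (bigD1 y) //= [RHS](bigD1 y) //= eqxx mulrnDr mulr1n addrA.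
congr (_ + _); apply: eq_bigr => x xy.
by rewrite [y == x]eq_sym (negPf xy).
Qed.

(** The function [a] assigns winding numbers to the vertices: the walk is homologous to a
    combination of small circles around vertices, on each of which the flat [g] sums to 0. *)
Lemma null_homologous_sum (V : zmodType) (D : finType) (phi tau : {perm D})
    (h : D -> V) (s : seq D) (a : D -> int) :
    let g x := h x - h (phi (tau x)) in
    involutive tau -> (forall x, tau x = x -> phi x = x) ->
    (forall x, tau x != x -> g (tau x) = - g x) ->
    (forall x, a (phi (tau x)) = a x) ->
    (forall x, tau x != x ->
       (count_mem x s)%:Z - (count_mem (tau x) s)%:Z = a x - a (tau x)) ->
  \sum_(x <- s) g x = 0.
Proof.
move=> g tK fixp anti anu cnt; rewrite sum_count.
rewrite (@sum_pairs _ _ tau _ (fun x => g x *~ a x)) //; first last.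
- by move=> x tx; rewrite /g tx fixp // subrr mul0rn mul0rz.
- move=> x ax; rewrite anti // mulNrn mulNrz !pmulrn -!mulrzBr.
  by rewrite cnt.
rewrite /g; under eq_bigr => x _ do rewrite mulrzBl -{2}anu.
rewrite sumrB (reindex_inj (@perm_inj _ (tau * phi)%g)) /=.
by under eq_bigr => x _ do rewrite !permM; rewrite subrr.
Qed.

End NullHomologous.

Section NullHomotopic.
Variables (N : nat) (T : triangulation N) (e : 'I_N -> oedge N).
Hypothesis hT : one_cusped T e.
Local Open Scope ring_scope.

(** The class of the loop is the product of its crossing classes. The cusp group being abelian, this
    is a sum of a flat connection along a null-homologous walk. *)
Lemma null_homotopic j0 w0 w (a : oedge N -> int) :
    cusp_loop T j0 w0 w -> (forall x, a (nu T x) = a x) ->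
    (forall x, tau T x != x -> (count_mem x (path_darts T j0 w0 w))%:Z
        - (count_mem (tau T x) (path_darts T j0 w0 w))%:Z = a x - a (tau T x)) ->
  homotopic T j0 [set w0]%SET w [::].
Proof.
move=> lw anu cnt; have /and3P[pw /eqP tw /eqP vw] := lw.
apply: cusp_homotopic_incl (pw).
apply/(loop_classE lw (cusp_loop_nil T j0 w0)).
have -> : loop_class T j0 w0 w = path_class hT j0 w0 j0 w0 w.
  by rewrite /path_class /close_path tw vw cusp_path_base cats0.
rewrite path_class_prod //.
have mulC := @cusp_group_comm _ _ _ hT j0 w0.
pose V : zmodType := HB.pack_for zmodType (cusp_group T j0 w0)
  (GRing.isZmodule.Build (cusp_group T j0 w0) (@mulgA (cusp_group T j0 w0)) mulC
     (@mul1g (cusp_group T j0 w0)) (@mulVg (cusp_group T j0 w0))).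
pose h : oedge N -> V := star_class hT j0 w0.
have sumE (s : seq (oedge N)) : (\prod_(x <- s) conn (phi N) (tau T) (star_class hT j0 w0) x)%g =
    \sum_(x <- s) (h x - h (phi N (tau T x))).
  elim: s => [|y s IH]; first by rewrite !big_nil.
  by rewrite !big_cons IH.
rewrite sumE; apply: (@null_homologous_sum V _ _ _ h _ a) => //.
- exact: tauK.
- exact: tau_phi_fix.
- by move=> x ax; apply: star_antisym.
- by move=> x; rewrite -nuE.
Qed.
End NullHomotopic.

(** * Simple closed curves are primitive *)

Section CocycleIdeal.
Local Open Scope ring_scope.

Lemma int_ideal (I : int -> Prop) : I 0 ->
    (forall m n, I m -> I n -> I (m + n)) -> (forall m, I m -> I (- m)) ->
  exists d : nat, I d%:Z /\ forall m, I m -> (d %| m)%Z.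
Proof.
move=> I0 ID IN; have [[n npos In]|no] := pselect (exists2 n : nat, (0 < n)%N & I n%:Z).
  have exn : exists n, (0 < n)%N && `[< I n%:Z >].
    by exists n; rewrite npos; apply/asboolP.
  case: (ex_minnP exn) => d /andP[dpos /asboolP Id] dmin; exists d; split=> // m Im.
  have IM k : I (k * d%:Z).
    have INM l : I (l%:Z * d%:Z).
      by elim: l => [|l IH]; rewrite ?mul0r // intS mulrDl mul1r; apply: ID.
    by case: k => l; [apply: INM|rewrite NegzE mulNr; apply/IN/INM].
  have Ir : I (m %% d%:Z)%Z.
    have -> : (m %% d%:Z)%Z = m - (m %/ d%:Z)%Z * d%:Z.
      by rewrite {2}(divz_eq m d%:Z) addrC addKr.
    exact/ID/IN/IM.
  apply/dvdz_mod0P; have := ltz_pmod m (ltac:(by rewrite ltz_nat) : 0 < d%:Z).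
  have := modz_ge0 m (ltac:(by rewrite eqz_nat -lt0n) : d%:Z != 0).
  case: (m %% d%:Z)%Z Ir => // r Ir _; rewrite ltz_nat => rd.
  case: r Ir rd => // r Ir rd; have := dmin r.+1; rewrite ltnS.
  by move=> /(_ (introT (asboolP _) Ir)) dr; rewrite leqNgt rd in dr.
exists 0; split=> // -[[|m]|m] Im //; case: no; first by exists m.+1.
by exists m.+1 => //; have := IN _ Im; rewrite NegzE opprK.
Qed.

Variables (D : finType) (phi tau : {perm D}).
Hypotheses (tK : involutive tau) (conn1 : connected_map phi tau).
Let nu x := phi (tau x).

(* [chain n x x' k]: an integral 1-chain [q] on the sides with boundary
   [x - x'], up to the identification of the darts around a vertex, on which
   the cochain [n] takes the value [k]. *)
Definition chain (n : D -> int) (x x' : D) (k : int) := exists q h : D -> int,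
  (forall y, q y - q (tau y) = h y - h (nu y) + (x == y)%:Z - (x' == y)%:Z) /\
  \sum_y q y * n y = k.

Lemma chain_refl n x : chain n x x 0.
Proof.
by exists (fun=> 0), (fun=> 0); split=> [y|]; rewrite ?subrr ?add0r ?subrr // big1 // => y _; rewrite mul0r.
Qed.

Lemma chain_trans n x x' x'' k k' : chain n x x' k -> chain n x' x'' k' -> chain n x x'' (k + k').
Proof.
move=> [q [h [qh <-]]] [q' [h' [qh' <-]]].
exists (fun y => q y + q' y), (fun y => h y + h' y); split=> [y|].
  by have := qh y; have := qh' y; lia.
by rewrite -big_split; apply: eq_bigr => y _; rewrite mulrDl.
Qed.

Lemma chain_sym n x x' k : chain n x x' k -> chain n x' x (- k).
Proof.
move=> [q [h [qh <-]]]; exists (fun y => - q y), (fun y => - h y); split=> [y|].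
  by have := qh y; lia.
by rewrite -sumrN; apply: eq_bigr => y _; rewrite mulNr.
Qed.

Lemma chain_nu n x : chain n x (nu x) 0.
Proof.
exists (fun=> 0), (fun y => (nu x == y)%:Z); split=> [y|].
  have -> : (nu x == nu y) = (x == y) by rewrite /nu !(inj_eq perm_inj).
  by rewrite subrr; lia.
by rewrite big1 // => y _; rewrite mul0r.
Qed.

Lemma chain_tau n x : chain n x (tau x) (n x).
Proof.
exists (fun y => (x == y)%:Z), (fun=> 0); split=> [y|].
  by rewrite subrr add0r -{2}[x]tK (inj_eq perm_inj).
rewrite (bigD1 x) //= eqxx mul1r big1 ?addr0 // => y yx.
by rewrite eq_sym (negPf yx) mul0r.
Qed.

Lemma chain_connected n x x' : tau x != x -> tau x' != x' -> exists k, chain n x x' k.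
Proof.
move=> ax ax'; pose q y := `[< exists k, chain n y x' k >].
have chain_phi y : chain n y (phi y) (n y + 0).
  by apply: chain_trans (chain_tau n y) _; have := chain_nu n (tau y); rewrite /nu tK.
have qE y y' k : chain n y y' k -> q y' = q y.
  move=> h; apply/asboolP/asboolP => -[k' h'].
    by exists (k + k'); apply: chain_trans h h'.
  by exists (- k + k'); apply: chain_trans h'; apply: chain_sym.
suff /asboolP : q x by [].
rewrite (conn1 (q := q) _ _ ax ax').
- by apply/asboolP; exists 0; apply: chain_refl.
- by move=> y; apply: qE (chain_phi y).
- by move=> y; apply: qE (chain_tau n y).
Qed.

(* The values of [n] on closed 1-chains form the ideal [d Z]; hence [n] is a
   coboundary modulo [d]. *)
Lemma cocycle_ideal (n : D -> int) (x0 : D) : tau x0 != x0 ->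
    (forall x, tau x = x -> n x = 0) -> (forall x, tau x = x -> phi x = x) ->
    (forall x, (tau (nu x) != nu x) = (tau x != x)) ->
  exists (d : nat) (a : D -> int),
  [/\ forall x, (d %| a (nu x) - a x)%Z,
      forall x, (d %| n x - (a x - a (tau x)))%Z &
      exists q h : D -> int, (forall y, q y - q (tau y) = h y - h (nu y)) /\
        \sum_y q y * n y = d%:Z].
Proof.
move=> ax0 n0 fixp nuact.
have [d [[q [h [qh qd]]] dI]] : exists d : nat, chain n x0 x0 d%:Z /\
    forall m, chain n x0 x0 m -> (d %| m)%Z.
  apply: int_ideal; [exact: chain_refl|exact: chain_trans|exact: chain_sym].
have aex x : exists k, tau x != x -> chain n x x0 k.
  have [ax|] := boolP (tau x != x); last by exists 0.
  by have [k] := chain_connected n ax ax0; exists k.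
pose a x := sval (cid (aex x)).
have aP x : tau x != x -> chain n x x0 (a x) := svalP (cid (aex x)).
exists d, a; split=> [x|x|]; last first.
- by exists q, h; split=> // y; have := qh y; lia.
- have [tx|ax] := eqVneq (tau x) x; first by rewrite tx n0 // subrr subrr dvdz0.
  have ax' : tau (tau x) != tau x by rewrite tK eq_sym.
  apply: dI; have := chain_trans (chain_trans (chain_sym (aP _ ax)) (chain_tau n x)) (aP _ ax').
  by congr chain; lia.
- have [tx|ax] := eqVneq (tau x) x; first by rewrite /nu tx fixp // subrr dvdz0.
  have ax' : tau (nu x) != nu x by rewrite nuact.
  apply: dI; have := chain_trans (chain_trans (chain_sym (aP _ ax)) (chain_nu n x)) (aP _ ax').
  by congr chain; lia.
Qed.

End CocycleIdeal.

(** * Disjoint segments in a triangle *)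

Section SegmentSeparation.
Local Open Scope ring_scope.
Variable R : realFieldType.
Implicit Types (P Q : 'I_4 -> R).

(* In barycentric coordinates, a segment of the triangle with corners [x], [y], [z]
   from a point of the side [xz] to a point of the side [xy]. *)
Definition corner_segment (v x y z : 'I_4) P Q :=
  [/\ uniq [:: v; x; y; z], [/\ P v = 0, P y = 0, 0 < P x, 0 < P z & P x + P z = 1] &
      [/\ Q v = 0, Q z = 0, 0 < Q x, 0 < Q y & Q x + Q y = 1]].

Definition disjoint_segments P Q P' Q' := forall s s', 0 <= s <= 1 -> 0 <= s' <= 1 ->
  exists a, (1 - s) * P a + s * Q a != (1 - s') * P' a + s' * Q' a.

Lemma corner_segment_rev v x y z P Q :
  corner_segment v x y z P Q -> corner_segment v x z y Q P.
Proof.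
move=> [u h1 h2]; split=> //; move: u => /=; rewrite !inE !negb_or [z == y]eq_sym.
by do ![case: (_ == _) => //=].
Qed.

Lemma disjoint_segments_sym P Q P' Q' :
  disjoint_segments P Q P' Q' -> disjoint_segments P' Q' P Q.
Proof. by move=> h s s' s1 s2; have [a] := h s' s s2 s1; exists a; rewrite eq_sym. Qed.

Lemma disjoint_segments_rev P Q P' Q' :
  disjoint_segments P Q P' Q' -> disjoint_segments P Q Q' P'.
Proof.
move=> h s s' s1 /andP[s2 s3]; have s4 : 0 <= 1 - s' <= 1 by apply/andP; split; lra.
have [a hh] := h s (1 - s') s1 s4; exists a.
by move: hh; rewrite subKr [X in _ != X -> _]addrC.
Qed.

Lemma all_corners (v x y z a : 'I_4) : uniq [:: v; x; y; z] -> [|| a == v, a == x, a == y | a == z].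
Proof.
move=> u; apply/negPn/negP => h; have := max_card (mem [:: a; v; x; y; z]).
rewrite (card_uniqP _) ?card_ord //=.
by move: u h; rewrite /= !inE !negb_or => -> ->.
Qed.

(* Otherwise [P' Q'] would cross the line [PQ], inside the triangle, hence on
   the segment [PQ]. *)
Lemma segment_separation v x y z x' y' z' P Q P' Q' :
    corner_segment v x y z P Q -> corner_segment v x' y' z' P' Q' ->
    disjoint_segments P Q P' Q' -> y' = y -> P' z < P z ->
  z' = z /\ Q' y < Q y.
Proof.
move=> [u [Pv Py Px Pz P1] [Qv Qz Qx Qy Q1]] [u' [Pv' Py' Px' Pz' P1'] [Qv' Qz' Qx' Qy' Q1']].
move=> dis ey lt; subst y'.
have [P'nn Q'nn] : (forall a, 0 <= P' a) /\ (forall a, 0 <= Q' a).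
  by split=> a; case/or4P: (all_corners a u') => /eqP ->; rewrite ?Pv' ?Py' ?Qv' ?Qz' ?lexx ?ltW.
have xz : (x' = x /\ z' = z) \/ (x' = z /\ z' = x).
  move: (u'); rewrite /= !inE !negb_or => /and4P[/and3P[vx' _ vz'] /andP[xy' xz'] yz' _].
  have := all_corners x' u; have := all_corners z' u.
  rewrite [z' == v]eq_sym [x' == v]eq_sym (negPf vx') (negPf vz') (negPf xy') [z' == y]eq_sym (negPf yz') /=.
  by case/orP => /eqP ez; case/orP => /eqP ex; first [by auto | by rewrite ex ez eqxx in xz'].
have [SP' SQ'] : P' x + P' z = 1 /\ Q' x + Q' y + Q' z = 1.
  by case: xz => -[ex ez]; subst x' z'; split; lra.
(* The linear form vanishing on the line [PQ], negative at the corner [x]. *)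
pose l B : R := B y * P z + B z * Q y - P z * Q y.
have l1 : l P' < 0.
  by rewrite /l Py' mul0r add0r -mulrBl pmulr_llt0 // subr_lt0.
have [l2|l2] := ltP (l Q') 0.
  case: xz => -[ex ez]; subst x' z'.
    by split=> //; move: l2; rewrite /l Qz' mul0r addr0 [P z * _]mulrC -mulrBl pmulr_llt0 // subr_lt0.
  have e1 : l Q' = Q' y * P z * Q x + Q' z * Q y * P x.
    have -> : Q x = 1 - Q y by lra.
    have -> : P x = 1 - P z by lra.
    have -> : l Q' = Q' y * P z + Q' z * Q y - P z * Q y by [].
    have -> : Q' y = 1 - Q' z by lra.
    by ring.
  suff : 0 <= l Q' by lra.
  by rewrite e1 addr_ge0 // !mulr_ge0 // ltW.
have ld : 0 < l Q' - l P' by lra.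
(* The parameter at which [P' Q'] meets the line; as the coordinates of that point are nonnegative,
   it lies on the segment [PQ], at parameter [s] below. *)
pose s' := - l P' / (l Q' - l P').
pose X a := (1 - s') * P' a + s' * Q' a.
have s'1 : 0 <= s' <= 1.
  by rewrite /s' ler_pdivlMr // ler_pdivrMr // mul0r mul1r; apply/andP; split; lra.
have lX : l X = 0.
  have -> : l X = (1 - s') * l P' + s' * l Q' by rewrite /l /X; ring.
  have -> : (1 - s') * l P' + s' * l Q' = l P' + s' * (l Q' - l P') by ring.
  by rewrite /s' divfK ?gt_eqF //; ring.
have Xnn a : 0 <= X a.
  by rewrite /X; have := P'nn a; have := Q'nn a; move: s'1 => /andP[]; nra.
have XS : X x + X y + X z = 1.
  by rewrite /X Py'; move: SP' SQ'; move: (P' x) (P' z) (Q' x) (Q' y) (Q' z) => *; nra.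
pose s := X y / Q y.
have s1 : 0 <= s <= 1.
  rewrite /s ler_pdivlMr // ler_pdivrMr // mul0r mul1r Xnn /=.
  have := Xnn z; have := Xnn y; move: lX; rewrite /l; nra.
have sQ : s * Q y = X y by rewrite /s divfK ?gt_eqF.
have [a] := dis s s' s1 s'1; rewrite -/(X a) => /eqP [].
have eqz : (1 - s) * P z = X z.
  have h : Q y * ((1 - s) * P z) = Q y * X z.
    by move: lX sQ; rewrite /l; move: (s) => t; nra.
  by move: h; apply: mulfI; rewrite gt_eqF.
case/or4P: (all_corners a u) => /eqP ->.
- by rewrite Pv Qv /X Pv' Qv' !mulr0.
- by move: XS; nra.
- by rewrite Py mulr0 add0r.
- by rewrite Qz mulr0 addr0.
Qed.
End SegmentSeparation.

Section Telescope.
Local Open Scope ring_scope.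

(** Starting from the value [c], each crossing [l] subtracts [w l], and [before l] is the value just
    before it. The induction removes the last crossing. *)
Lemma telescope_crossings (R : realFieldType) (I : finType) (C : {set I}) (pos : I -> R)
    (w : I -> int) (F : int -> int) (c : int) :
    {in C &, injective pos} ->
  let before l := c - \sum_(l' in C | pos l' < pos l) w l' in
  \sum_(l in C) (F (before l) - F (before l - w l)) = F c - F (c - \sum_(l in C) w l).
Proof.
have [n] := ubnP #|C|; elim: n C => // n IH C Cn inj before.
have [->|[l0 l0C]] := set_0Vmem C.
  by rewrite !big_set0 subr0 subrr.
have [l1 /= l1C' l1max] := @arg_maxP _ _ _ l0 (mem C) pos l0C.
have l1C : l1 \in C by [].
have {}IH := IH (C :\ l1)%SET.
have cards : #|C| = #|(C :\ l1)%SET|.+1 by rewrite (cardsD1 l1 C) l1C.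
rewrite (big_setD1 l1) //= [in RHS](big_setD1 l1) //=.
have lt1 l : l \in (C :\ l1)%SET -> pos l < pos l1.
  rewrite !inE => /andP[ne lC]; rewrite lt_neqAle l1max // andbT.
  by apply: contra_neq ne => /inj; apply.
have before1 : before l1 = c - \sum_(l in (C :\ l1)%SET) w l.
  rewrite /before; congr (c - _); apply: eq_bigl => l.
  apply/andP/idP => [[lC lt]|lC].
    by rewrite !inE lC andbT; apply: contraTneq lt => ->; rewrite ltxx.
  by rewrite lt1 //; move: lC; rewrite !inE => /andP[].
have beforeE l : l \in (C :\ l1)%SET ->
    before l = c - \sum_(l' in (C :\ l1)%SET | pos l' < pos l) w l'.
  move=> lC; rewrite /before; congr (c - _); apply: eq_bigl => l'.
  rewrite !inE; have [->|_] := eqVneq l' l1; last by [].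
  by rewrite ltNge ltW ?andbF // lt1.
rewrite (eq_bigr _ (fun l lC => congr1 (fun b => F b - F (b - w l)) (beforeE l lC))).
rewrite IH; last first.
- by move=> x y; rewrite !inE => /andP[_ xC] /andP[_ yC]; apply: inj.
- by rewrite -ltnS -cards.
by rewrite before1 opprD [- w l1 - _]addrC [c + (_ - _)]addrA addrC addrA subrK.
Qed.

End Telescope.

(** * Crossings of a simple closed curve with the sides *)

Section CurveCounting.
Local Open Scope ring_scope.
Variables (R : realType) (N : nat) (T : triangulation N) (g : curve N).
Hypothesis gclosed : closed_curve T g.
Local Notation I := 'I_(clen g).+1.
Variable P : I -> 'I_4 -> R.
Let Q i a := P (ordS i) (gl T (atet (carc g i)) (aout (carc g i)) a).
Hypothesis Pside : forall i, let x := carc g i in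
     [/\ P i (avtx x) = 0, P i (ain x) = 0, 0 < P i (acor x), 0 < P i (aout x) &
         P i (acor x) + P i (aout x) = 1].
Hypothesis Pdisj : forall i i' s s', i != i' ->
     atet (carc g i) = atet (carc g i') -> avtx (carc g i) = avtx (carc g i') ->
     0 <= s <= 1 -> 0 <= s' <= 1 ->
     exists a, (1 - s) * P i a + s * Q i a != (1 - s') * P i' a + s' * Q i' a.
Implicit Types (i l : I) (y : oedge N).

Definition out_dart i : oedge N := (atet (carc g i), avtx (carc g i), aout (carc g i)).
Definition in_dart i : oedge N := (atet (carc g i), avtx (carc g i), ain (carc g i)).

Lemma arc_uniq i : let x := carc g i in uniq [:: avtx x; acor x; ain x; aout x].
Proof. by have [] := gclosed i. Qed.

Lemma out_dart_act i : tau T (out_dart i) != out_dart i.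
Proof.
have := arc_uniq i; rewrite tau_act /= !inE !negb_or.
by move=> /andP[/and3P[]].
Qed.

Lemma in_dart_act i : tau T (in_dart i) != in_dart i.
Proof.
have := arc_uniq i; rewrite tau_act /= !inE !negb_or.
by move=> /andP[/and3P[]].
Qed.

Lemma tau_out i : tau T (out_dart i) = in_dart (ordS i).
Proof.
have := out_dart_act i; rewrite tau_act => ne; rewrite tauE //.
by have [_ e1 e2 e3] := gclosed i; rewrite /in_dart e1 e2 e3.
Qed.

(** The two ends of a side, [near y] being the one of [corner y]. The barycentric coordinate at
    [far y] measures the position along the side starting from the near end. *)
Definition near y := nxt y.1.2 y.2.
Definition far y := nxt y.1.2 (nxt y.1.2 y.2).

Lemma gl_far i : gl T (atet (carc g i)) (aout (carc g i)) (far (out_dart i)) = near (in_dart (ordS i)).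
Proof.
have := out_dart_act i; rewrite tau_act /= => ne; rewrite /far /near /=.
have [_ e1 e2 e3] := gclosed i; rewrite e2 e3 nxt_perm // gl_odd //.
Qed.

Lemma gl_near i : gl T (atet (carc g i)) (aout (carc g i)) (near (out_dart i)) = far (in_dart (ordS i)).
Proof.
have := out_dart_act i; rewrite tau_act /= => ne; rewrite /far /near /=.
have [_ e1 e2 e3] := gclosed i; by rewrite e2 e3 nxt_perm // gl_odd nxt_perm ?nxt_eqv // gl_odd nxt3.
Qed.

Lemma Q_far i : Q i (far (out_dart i)) = P (ordS i) (near (in_dart (ordS i))).
Proof. by rewrite /Q gl_far. Qed.

Lemma Q_near i : Q i (near (out_dart i)) = P (ordS i) (far (in_dart (ordS i))).
Proof. by rewrite /Q gl_near. Qed.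

Lemma arc_segment i : let x := carc g i in
  corner_segment (avtx x) (acor x) (ain x) (aout x) (P i) (Q i).
Proof.
move=> x; split; [exact: arc_uniq|exact: Pside|].
have [u e1 e2 e3] := gclosed i.
have [p1 p2 p3 p4 p5] := Pside (ordS i).
have u' := arc_uniq (ordS i).
have glin a : a != avtx x -> a != aout x ->
    (gl T (atet x) (aout x) a == acor (carc g (ordS i))) ||
    (gl T (atet x) (aout x) a == aout (carc g (ordS i))).
  move=> av ao; have := all_corners (gl T (atet x) (aout x) a) u'.
  by rewrite e2 e3 !(inj_eq perm_inj) (negPf av) (negPf ao).
have pos a : a != avtx x -> a != aout x -> 0 < Q i a.
  by move=> av ao; rewrite /Q; case/orP: (glin a av ao) => /eqP ->.
move: u; rewrite -/x /= !inE !negb_or => /and4P[/and3P[vc vi vo] /andP[ci co] io _].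
split.
- by rewrite /Q -/x -e2.
- by rewrite /Q -/x -e3.
- by apply: pos; rewrite // eq_sym.
- by apply: pos; rewrite // eq_sym.
rewrite /Q -/x; have h1 := glin (acor x); have h2 := glin (ain x).
rewrite eq_sym vc co in h1; rewrite eq_sym vi io in h2.
have ne : gl T (atet x) (aout x) (acor x) != gl T (atet x) (aout x) (ain x).
  by rewrite (inj_eq perm_inj).
case/orP: (h1 isT isT) => /eqP f1; case/orP: (h2 isT isT) => /eqP f2;
  rewrite f1 f2 ?eqxx in ne *; rewrite // addrC //.
Qed.

Lemma arcs_disjoint k l : k != l -> (in_dart k).1 = (in_dart l).1 ->
  disjoint_segments (P k) (Q k) (P l) (Q l).
Proof. by move=> ne [e1 e2] s s'; apply: Pdisj. Qed.

(* The event [(i, true)] is the end of the i-th arc, [(i, false)] its start. *)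
Local Notation event := (I * bool)%type.
Implicit Types (p q : event).
Definition ev_dart p := if p.2 then out_dart p.1 else in_dart p.1.
Definition ev_point p := if p.2 then Q p.1 else P p.1.
Definition ev_sign p : int := if p.2 then 1 else -1.
Definition ev_swap p : event := if p.2 then (ordS p.1, false) else (ord_pred p.1, true).
Definition ev_flip p : event := (p.1, ~~ p.2).

Lemma ev_swapK : involutive ev_swap.
Proof. by move=> [i []]; rewrite /ev_swap /= ?ordSK ?ord_predK. Qed.

Lemma ev_flipK : involutive ev_flip.
Proof. by move=> [i []]. Qed.

Lemma ev_sign_swap p : ev_sign (ev_swap p) = - ev_sign p.
Proof. by case: p => i []; rewrite /ev_sign /= ?opprK. Qed.

Lemma ev_sign_flip p : ev_sign (ev_flip p) = - ev_sign p.
Proof. by case: p => i []; rewrite /ev_sign /= ?opprK. Qed.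

Lemma ev_dart_swap p : ev_dart (ev_swap p) = tau T (ev_dart p).
Proof.
case: p => i []; rewrite /ev_dart /ev_swap /= ?tau_out //.
by rewrite -[X in in_dart X]ord_predK -tau_out tauK.
Qed.

Lemma ev_point_near p :
  ev_point (ev_swap p) (far (ev_dart (ev_swap p))) = ev_point p (near (ev_dart p)).
Proof.
case: p => i []; rewrite /ev_point /ev_dart /ev_swap /= ?Q_near //.
by rewrite Q_far ord_predK.
Qed.

Lemma ev_dart_act p : tau T (ev_dart p) != ev_dart p.
Proof. by case: p => i []; [apply: out_dart_act|apply: in_dart_act]. Qed.

Lemma ev_flip_segment p : let x := carc g p.1 in
  corner_segment (avtx x) (acor x) (ev_dart p).2 (ev_dart (ev_flip p)).2
    (ev_point p) (ev_point (ev_flip p)).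
Proof.
by case: p => i []; [apply/corner_segment_rev|]; apply: arc_segment.
Qed.

Lemma ev_pointP p : let y := ev_dart p in
  [/\ ev_point p y.1.2 = 0, ev_point p y.2 = 0 & ev_point p (near y) + ev_point p (far y) = 1].
Proof.
move=> y; have [u [e1 e2 _ _ e3] _] := ev_flip_segment p.
have ey : y.1.2 = avtx (carc g p.1) by rewrite /y /ev_dart; case: ifP.
split; rewrite ?ey //.
have ac : (near y = acor (carc g p.1) /\ far y = (ev_dart (ev_flip p)).2) \/
    (near y = (ev_dart (ev_flip p)).2 /\ far y = acor (carc g p.1)).
  rewrite /near /far ey -/y in u *.
  move: (avtx _) (acor _) (y.2) (ev_dart _).2 u => v c f o.
  suff: uniq [:: v; c; f; o] -> (nxt v f == c) && (nxt v (nxt v f) == o) ||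
     (nxt v f == o) && (nxt v (nxt v f) == c).
    by move=> h /h /orP[]/andP[/eqP-> /eqP->]; [left|right].
  by elim/ord4_ind: v; elim/ord4_ind: c; elim/ord4_ind: f; elim/ord4_ind: o.
by case: ac => -[-> ->]; rewrite // addrC.
Qed.

(** Distinct arcs are disjoint, end points included, and the start and the end of one arc lie on
    different sides. *)
Lemma ev_uniq p q : ev_dart p = ev_dart q ->
  ev_point p (far (ev_dart q)) = ev_point q (far (ev_dart q)) -> p = q.
Proof.
move=> epq efar; have [p1 p2 p3] := ev_pointP p; have [q1 q2 q3] := ev_pointP q.
rewrite epq in p1 p2 p3.
have same a : ev_point p a = ev_point q a.
  have := ev_dart_act q; rewrite tau_act => ne.
  have [->|av] := eqVneq a (ev_dart q).1.2; first by rewrite p1 q1.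
  case/or3P: (nxt_cases ne av) => /eqP ->; first by rewrite p2 q2.
    rewrite -/(near _).
    by apply: (addIr (ev_point q (far (ev_dart q)))); rewrite -{1}efar p3 q3.
  exact: efar.
have [e1|ne] := eqVneq p.1 q.1.
  case: p q e1 epq {p1 p2 p3 q1 q2 q3 efar same} => i b [k c] /= <-.
  have u := arc_uniq i.
  case: b; case: c; rewrite /ev_dart //= => -[ee]; exfalso; move: u;
    by rewrite /= !inE ee eqxx ?orbT ?andbF.
have d1 : (in_dart p.1).1 = (in_dart q.1).1.
  by case: p q epq {p1 p2 p3 q1 q2 q3 efar same ne} => [i []] [k []] /= [-> ->].
have [a] := arcs_disjoint ne d1 (s := p.2%:R) (s' := q.2%:R)
   ltac:(by case: (p.2); rewrite ?lexx ?ler01) ltac:(by case: (q.2); rewrite ?lexx ?ler01).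
have pE (r : event) : (1 - r.2%:R) * P r.1 a + r.2%:R * Q r.1 a = ev_point r a.
  by case: r => i []; rewrite /ev_point /= ?subrr ?mul0r ?add0r ?mul1r ?subr0 ?mul1r ?addr0.
by rewrite !pE same eqxx.
Qed.

(** With [far] for [corner], these are the signed crossings between the near end of the side and the
    position [c]. *)
Definition count_before (corner : oedge N -> 'I_4) y (c : R) : int :=
  \sum_(p | (ev_dart p == y) && (ev_point p (corner y) < c)) ev_sign p.

Definition curve_cochain y : int := \sum_(p | ev_dart p == y) ev_sign p.

Lemma count_before_tau y c : count_before far (tau T y) c = - count_before near y c.
Proof.
rewrite /count_before (reindex_inj (inv_inj ev_swapK)) -sumrN /=.
apply: eq_big => [p|p _]; last exact: ev_sign_swap.
rewrite ev_dart_swap (inj_eq (@perm_inj _ (tau T))).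
by have [<-|//] := eqVneq (ev_dart p) y; rewrite -ev_dart_swap ev_point_near.
Qed.

Lemma count_before_compl p : let y := ev_dart p in
  count_before far y (ev_point p (far y)) + count_before near y (ev_point p (near y))
    + ev_sign p = curve_cochain y.
Proof.
move=> y; rewrite /curve_cochain (bigID (fun q => ev_point q (far y) < ev_point p (far y))) /=.
rewrite -addrA; congr (_ + _).
rewrite (bigD1 p) ?eqxx ?ltxx //= addrC; congr (_ + _); apply: eq_bigl => q.
rewrite -andbA; have [eq|//] := eqVneq (ev_dart q) y; rewrite /=.
have [_ _ h1] := ev_pointP p; have [_ _ h2] := ev_pointP q; rewrite eq in h2.
have [->|ne] := eqVneq q p; first by rewrite !ltxx.
rewrite andbT; case: (ltgtP (ev_point q (far y)) (ev_point p (far y))) => h /=.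
- by apply/negbTE; rewrite -leNgt; rewrite -/y in h1; lra.
- by rewrite -/y in h1; lra.
- by case/eqP: ne; apply: ev_uniq.
Qed.

(** By [segment_separation], an arc meeting one of the two sides closer to the corner cut off by the
    k-th arc cuts off the same corner and meets the other side closer as well; its start and its end
    contribute opposite signs. *)
Lemma count_before_flip k : let x := carc g k in
  \sum_(p | (ev_dart p == in_dart k) && (ev_point p (aout x) < P k (aout x))) ev_sign p +
  \sum_(p | (ev_dart p == out_dart k) && (ev_point p (ain x) < Q k (ain x))) ev_sign p = 0.
Proof.
move=> x; apply/eqP; rewrite addr_eq0; apply/eqP.
rewrite [in RHS](reindex_inj (inv_inj ev_flipK)) -sumrN /=.
apply: eq_big => [p|p _]; last by rewrite ev_sign_flip opprK.
have sk := arc_segment k; have sp := ev_flip_segment p.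
have [e1|ne] := eqVneq p.1 k.
  have u := arc_uniq k; rewrite -/x in u.
  case: p e1 {sp} => i [] /= ->; rewrite /ev_dart /ev_point /= ?ltxx ?andbF //.
  have hx : (out_dart k == in_dart k) = false.
    by apply/negbTE/eqP => -[ee]; rewrite -/x in ee; move: u; rewrite /= ee !inE eqxx ?orbT ?andbF.
  by rewrite hx eq_sym hx.
have [e1|nt] := eqVneq (in_dart p.1).1 (in_dart k).1; last first.
  have -> : (ev_dart p == in_dart k) = false.
    apply: contraNF nt => /eqP ee; rewrite -ee /ev_dart; by case: ifP.
  have -> //: (ev_dart (ev_flip p) == out_dart k) = false.
    apply: contraNF nt => /eqP ee; rewrite -[(in_dart k).1]/(out_dart k).1 -ee /ev_dart; by case: ifP.
have vE : avtx (carc g p.1) = avtx x by case: e1.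
have pd q y : q.1 = p.1 -> y.1 = (in_dart k).1 -> (ev_dart q == y) = ((ev_dart q).2 == y.2).
  move=> eq1 ey; have eq2 : (ev_dart q).1 = y.1.
    by rewrite ey -e1 -eq1 /ev_dart; case: ifP.
  by case: (ev_dart q) y eq2 {ey} => [q1 q2] [y1 y2] /= ->; rewrite xpair_eqE eqxx.
rewrite !pd //=.
have dis : disjoint_segments (P k) (Q k) (ev_point p) (ev_point (ev_flip p)).
  have h := arcs_disjoint (k := k) (l := p.1).
  rewrite eq_sym e1 in h; have := h ne erefl; rewrite /ev_point /ev_flip /=.
  by case: (p.2) => /= [/disjoint_segments_rev|].
rewrite /= vE in sp.
have disr : disjoint_segments (Q k) (P k) (ev_point (ev_flip p)) (ev_point p).
  exact/disjoint_segments_sym/disjoint_segments_rev/disjoint_segments_sym/disjoint_segments_rev.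
apply/andP/andP => [[/eqP a1 a2]|[/eqP a1 a2]].
  by have [-> ->] := segment_separation sk sp dis a1 a2.
have := segment_separation (corner_segment_rev sk) (corner_segment_rev sp) disr a1 a2.
by move=> [-> ->].
Qed.

Lemma dvdz_eq (d m m' : int) : (d %| m')%Z -> m = m' -> (d %| m)%Z.
Proof. by move=> h ->. Qed.

Section ModularPrimitive.
Variables (d : nat) (a0 : oedge N -> int).
Hypothesis a0_nu : forall x, (d %| a0 (nu T x) - a0 x)%Z.
Hypothesis a0_tau : forall x, (d %| curve_cochain x - (a0 x - a0 (tau T x)))%Z.
Hypothesis d_neq1 : d != 1%N.

(* [a0] extends to a function modulo [d] on the complement of the curve, and
   [before p] is its value on the side of the curve met just before the event
   [p].  This is the same residue [L] along the whole curve; as [d != 1], the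
   indicator of [L] jumps by exactly 1 across the curve. *)
Let before p := a0 (ev_dart p) - count_before far (ev_dart p) (ev_point p (far (ev_dart p))).

Let before_swapE p : before (ev_swap p) =
  a0 (tau T (ev_dart p)) + count_before near (ev_dart p) (ev_point p (near (ev_dart p))).
Proof. by rewrite /before ev_point_near ev_dart_swap count_before_tau opprK. Qed.

Let before_swap p : (d %| before (ev_swap p) - (before p - ev_sign p))%Z.
Proof.
have h := count_before_compl p; rewrite /= in h.
apply: (dvdz_eq (a0_tau (ev_dart p))).
by rewrite before_swapE /before -h; lia.
Qed.

Let before_arc k : (d %| before (k, true) - (before (k, false) + 1))%Z.
Proof.
have fl := count_before_flip k; rewrite /= in fl.
have u := arc_uniq k; rewrite /= -/(uniq [:: _; _; _; _]) in u.
have [[n1 f1 n2 f2]|[n1 f1 n2 f2]] :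
    [/\ near (out_dart k) = acor (carc g k), far (out_dart k) = ain (carc g k),
      near (in_dart k) = aout (carc g k) & far (in_dart k) = acor (carc g k)] \/
    [/\ near (out_dart k) = ain (carc g k), far (out_dart k) = acor (carc g k),
      near (in_dart k) = acor (carc g k) & far (in_dart k) = aout (carc g k)].
- rewrite /near /far /=; have := arc_uniq k; rewrite /=.
  move: (avtx _) (acor _) (ain _) (aout _) => v c i o.
  suff: uniq [:: v; c; i; o] ->
      [&& nxt v o == c, nxt v (nxt v o) == i, nxt v i == o & nxt v (nxt v i) == c] ||
      [&& nxt v o == i, nxt v (nxt v o) == c, nxt v i == c & nxt v (nxt v i) == o].
    by move=> h /h /orP[]/and4P[/eqP e1 /eqP e2 /eqP e3 /eqP e4]; [left|right]; split.
  by elim/ord4_ind: v; elim/ord4_ind: c; elim/ord4_ind: i; elim/ord4_ind: o.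
- have e0 : nu T (tau T (in_dart k)) = out_dart k.
    by rewrite nuE tauK phiE /out_dart -n2.
  apply: (dvdz_eq (rpredD (before_swap (k, false)) (a0_nu (tau T (in_dart k))))).
  rewrite before_swapE /before /count_before /ev_sign e0 /ev_dart /ev_point /=.
  rewrite n2 f1; move: fl; rewrite /ev_dart /ev_point.
  by set A := \sum_(_ | _ && _) _; set B := \sum_(_ | _ && _) _; lia.
- have e0 : nu T (tau T (out_dart k)) = in_dart k.
    by rewrite nuE tauK phiE /in_dart -n1.
  have := rpredD (before_swap (k, true)) (a0_nu (tau T (out_dart k))).
  rewrite -rpredN => h; apply: (dvdz_eq h); rewrite before_swapE /before /count_before /ev_sign e0 /ev_dart /ev_point /=.
  rewrite n1 f2; move: fl; rewrite /ev_dart /ev_point.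
  by set A := \sum_(_ | _ && _) _; set B := \sum_(_ | _ && _) _; lia.
Qed.

(** The potential is the indicator of the residue [L] applied to [a0]; [telescope_crossings] along a
    side gives its variation between the two ends. *)
Lemma curve_exact : exists a : oedge N -> int, (forall x, a (nu T x) = a x) /\
  forall y, curve_cochain y = a y - a (tau T y).
Proof.
set L := before (ord0, true).
have beforeL k : (d %| before (k, true) - L)%Z.
  case: k => n; elim: n => [|n IH] hn.
    by rewrite (_ : Ordinal hn = ord0) ?subrr ?dvdz0 //; apply: val_inj.
  have hn' := ltnW hn; set k := Ordinal hn'.
  have -> : Ordinal hn = ordS k by apply: val_inj; rewrite /= modn_small.
  apply: (dvdz_eq (rpredD (rpredD (before_swap (k, true)) (before_arc (ordS k))) (IH hn'))).
  rewrite -/k -[ev_swap _]/(ordS k, false) -[ev_sign _]/(1 : int).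
  by move: (before (ordS k, true)) (before (ordS k, false)) (before (k, true)) => u v w; lia.
pose F v : int := (d %| v - L)%Z.
have F1 v : (d %| v - L)%Z -> F v - F (v - 1) = 1.
  move=> dv; rewrite /F dv; have -> : (d %| v - 1 - L)%Z = false; last by [].
  apply/negbTE/negP => dv1; have := rpredB dv dv1.
  have -> : v - L - (v - 1 - L) = 1 by lia.
  rewrite -topredE /= /dvdz /= dvdn1.
  by apply/negP.
have Fd v v' : (d %| v - v')%Z -> F v = F v'.
  move=> h; rewrite /F; congr (Posz (nat_of_bool _)); apply/idP/idP => h'.
    by apply: (dvdz_eq (rpredB h' h)); lia.
  by apply: (dvdz_eq (rpredD h' h)); lia.
have beforeF p : F (before p) - F (before p - ev_sign p) = ev_sign p.
  case: p => k []; first by rewrite F1.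
  have h : (d %| before (k, false) + 1 - L)%Z.
    apply: (dvdz_eq (rpredB (beforeL k) (before_arc k))).
    by move: (before (k, true)) (before (k, false)) => u v; lia.
  by have := F1 _ h; rewrite addrK /ev_sign /= opprK => h1; rewrite -opprB h1.
exists (fun x => F (a0 x)); split=> [x|y]; first exact: Fd.
have := telescope_crossings (C := [set p | ev_dart p == y]%SET)
  (pos := fun p => ev_point p (far y)) ev_sign F (a0 y).
have inj : {in [set p | ev_dart p == y]%SET &, injective (fun p => ev_point p (far y))}.
  move=> p q; rewrite !inE => /eqP ep /eqP eq h; apply: ev_uniq; first by rewrite ep eq.
  by rewrite eq.
move=> /(_ inj).
have -> : \sum_(l in [set p | ev_dart p == y]%SET) ev_sign l = curve_cochain y.
  by apply: eq_bigl => p; rewrite inE.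
have -> : F (a0 y - curve_cochain y) = F (a0 (tau T y)).
  by apply: Fd; have := a0_tau y; rewrite -rpredN => h; apply: (dvdz_eq h); lia.
move=> <-; apply: eq_big => [p|p /eqP ep]; first by rewrite inE.
rewrite -[LHS]beforeF.
have -> : before p = a0 y - \sum_(l' in [set p0 | ev_dart p0 == y]%SET |
    ev_point l' (far y) < ev_point p (far y)) ev_sign l'.
  rewrite /before ep; congr (_ - _); apply: eq_bigl => q.
  by rewrite inE.
by [].
Qed.

End ModularPrimitive.

End CurveCounting.

Section CurvePrimitive.
Local Open Scope ring_scope.
Variables (R : realType) (N : nat) (T : triangulation N) (e : 'I_N -> oedge N).
Hypothesis hT : one_cusped T e.
Variable g : curve N.
Local Notation I := 'I_(clen g).+1.
Implicit Types (i : I).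

Lemma val_iter_ordS (n k : nat) : iter k (@ordS _) (ord0 : 'I_n.+1) = (k %% n.+1)%N :> nat.
Proof.
elim: k => [|k IH]; first by rewrite mod0n.
by rewrite iterS /= IH -(addn1 (k %% _)%N) modnDml addn1.
Qed.

Lemma enum_ordS (n : nat) : enum 'I_n.+1 = traject (@ordS _) ord0 n.+1.
Proof.
apply: (@eq_from_nth _ ord0) => [|k]; first by rewrite size_traject size_enum_ord.
rewrite size_enum_ord => kn; apply: val_inj; rewrite nth_traject //.
by have := val_iter_ordS n k; rewrite modn_small // /= nth_enum_ord.
Qed.

Lemma curve_word_path : closed_curve T g -> forall l i,
  let w := [seq aout (carc g i') | i' <- traject (@ordS _) i l] in
  [/\ pivots T (atet (carc g i)) w [set avtx (carc g i)]%SET,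
      tgt T (atet (carc g i)) w = atet (carc g (iter l (@ordS _) i)),
      tr T (atet (carc g i)) w (avtx (carc g i)) = avtx (carc g (iter l (@ordS _) i)) &
      path_darts T (atet (carc g i)) (avtx (carc g i)) w =
        [seq out_dart i' | i' <- traject (@ordS _) i l]].
Proof.
move=> gc; elim=> [//|l IH] i /=; have [u e1 e2 e3] := gc i.
have [p1 t1 r1 d1] := IH (ordS i).
rewrite imset_set1 -e1 -e2 p1 t1 r1 d1 -iterSr iterS finset.in_set1; split=> //.
rewrite andbT; move: u; rewrite /= !inE !negb_or => /andP[/and3P[_ _]].
by rewrite eq_sym.
Qed.

Lemma curve_word_loop : closed_curve T g ->
  cusp_loop T (atet (carc g ord0)) (avtx (carc g ord0)) (curve_word g) /\
  path_darts T (atet (carc g ord0)) (avtx (carc g ord0)) (curve_word g) =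
    [seq out_dart i | i <- enum 'I_(clen g).+1].
Proof.
move=> gc; have [p1 t1 r1 d1] := curve_word_path gc (clen g).+1 ord0.
rewrite /curve_word enum_ordS /cusp_loop p1 t1 r1 d1; split=> //.
have -> : iter (clen g).+1 (@ordS _) ord0 = (ord0 : I).
  by apply: val_inj; have := val_iter_ordS (clen g) (clen g).+1; rewrite modnn.
by rewrite !eqxx.
Qed.

Lemma curve_cochain_count : closed_curve T g -> forall y,
  curve_cochain g y = (count_mem y [seq out_dart i | i <- enum I])%:Z
    - (count_mem (tau T y) [seq out_dart i | i <- enum I])%:Z.
Proof.
move=> gc y.
have cnt z : (count_mem z [seq out_dart i | i <- enum I])%:Z = \sum_(i : I) (out_dart i == z)%:Z.
  have cnt_seq (s : seq I) :
      (count_mem z [seq out_dart i | i <- s])%:Z = \sum_(i <- s) (out_dart i == z)%:Z.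
    by elim: s => [|i s IH]; rewrite ?big_nil // big_cons /= PoszD IH.
  by rewrite cnt_seq big_enum.
rewrite !cnt -sumrB /curve_cochain big_mkcond /=.
rewrite -(pair_bigA _ (fun i c => if ev_dart (i, c) == y then ev_sign (i, c) else 0)) /=.
under eq_bigr => i _ do rewrite big_bool /=.
rewrite !big_split /= sumrN; congr (_ + _).
  by apply: eq_bigr => i _; rewrite /ev_dart /ev_sign /=; case: eqP.
rewrite (reindex_inj (can_inj (@ordSK _))) /= -sumrN; apply: eq_bigr => i _.
rewrite /ev_dart /ev_sign /= -(tau_out gc) -[y in LHS](@tauK _ T) (inj_eq (@perm_inj _ (tau T))).
by case: eqP.
Qed.

(** The numbers of crossings with closed chains generate an ideal [d Z]. If [d] were not 1, 0
    included, [curve_exact] would make the curve null-homologous, hence null-homotopic. *)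
Lemma curve_primitive : peripheral_curve R T g ->
  exists q h : oedge N -> int, (forall y, q y - q (tau T y) = h y - h (nu T y)) /\
    \sum_y q y * curve_cochain g y = 1.
Proof.
move=> [gc [P [Pside Pdisj]] nontriv].
have n0 x : tau T x = x -> curve_cochain g x = 0.
  move=> tx; rewrite /curve_cochain big_pred0 // => p; apply/negbTE/eqP => px.
  by have := ev_dart_act gc p; rewrite px tx eqxx.
have fixnu x : (tau T (phi N (tau T x)) != phi N (tau T x)) = (tau T x != x).
  by rewrite -nuE nu_act.
have [d [a0 [a0nu a0tau [q [h [qh qd]]]]]] :=
  cocycle_ideal (@tauK _ T) (cusp_connected hT) (n := curve_cochain g) (out_dart_act gc ord0) n0
    (@tau_phi_fix _ T) fixnu.
have [d1|dn1] := eqVneq d 1%N.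
  by exists q, h; rewrite qd d1; split=> // y; rewrite nuE.
case: nontriv.
have [a [anu aE]] : exists a : oedge N -> int, (forall x, a (nu T x) = a x) /\
    forall y, curve_cochain g y = a y - a (tau T y).
  apply: (curve_exact gc Pside Pdisj (d := d) (a0 := a0)) => // x.
  by rewrite nuE.
have [lw dw] := curve_word_loop gc.
apply: (null_homotopic hT lw anu) => x ax.
by rewrite dw -curve_cochain_count.
Qed.

End CurvePrimitive.

(** * Exponents of the deck transformations *)

Section Exponents.
Local Open Scope ring_scope.
Variables (N : nat) (T : triangulation N) (b : 'I_N) (alpha : seq 'I_4 -> int).
Hypothesis halpha : is_epimorphism T b alpha.
Implicit Types (j : 'I_N) (p q r s u w : seq 'I_4) (x y z : ledge).
Local Notation rev := (Defs.rev_path T).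

Lemma homotopic_rev r u s :
  homotopic T b finset.set0 (r ++ (u ++ rev (tgt T b r) u) ++ s) (r ++ s).
Proof.
elim: u r s => [|f u IH] r s /=; first exact/homotopic_refl/pivots0.
set j := tgt T b r; set f' := gl T j f f.
apply: (@homotopic_trans _ _ _ _ _ (r ++ [:: f; f'] ++ s)).
  have := IH (rcons r f) (f' :: s); rewrite -!cats1 tgt_cat /= -/j.
  by rewrite -?catA /= -?catA.
apply: homotopic_star (pivots0 _ _ _); rewrite -/j.
(* Crossing a face back and forth is a loop in the star of any edge of that face; [c] and [nxt c f]
   span such an edge. *)
pose c := if f == v0 then v1 else v0.
have cf : c != f by rewrite /c; elim/ord4_ind: (f).
exists c, (nxt c f).
rewrite /= nb_back !gl_back nxt_eqv cf imsetU1 imset_set1 !inE !(inj_eq perm_inj).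
have fn : f != nxt c f by rewrite eq_sym nxt_eqf.
by rewrite [f == c]eq_sym (negPf cf) (negPf fn); split.
Qed.

Lemma homotopic_revl r u s j : tgt T b r = tgt T j u ->
  homotopic T b finset.set0 (r ++ (rev j u ++ u) ++ s) (r ++ s).
Proof.
by move=> e; have := homotopic_rev r (rev j u) s; rewrite e cusp_rev_rev.
Qed.

Let loopE w : loop T b w <-> tgt T b w = b. Proof. by []. Qed.

Let alpha_hom u w : homotopic T b finset.set0 u w -> loop T b u -> alpha u = alpha w.
Proof. by case: halpha => _ h _ huw lu; apply: h. Qed.

Let alphaD u w : loop T b u -> loop T b w -> alpha (u ++ w) = alpha u + alpha w.
Proof. by case: halpha => h _ _; apply: h. Qed.

Lemma alpha_nil : alpha [::] = 0.
Proof. by have := @alphaD [::] [::] erefl erefl; rewrite /=; lia. Qed.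

(* The deck transformation between the tetrahedra reached by the paths [p],
   followed by [r], and [q]. *)
Definition shift p r q : int := alpha (p ++ r ++ rev b q).

Lemma loop_shift p r q : tgt T (tgt T b p) r = tgt T b q -> loop T b (p ++ r ++ rev b q).
Proof. by move=> e; rewrite /loop !tgt_cat e tgt_rev. Qed.

Lemma shift_cat p r q s m : tgt T (tgt T b p) r = tgt T b q ->
    tgt T (tgt T b q) s = tgt T b m ->
  shift p (r ++ s) m = shift p r q + shift q s m.
Proof.
move=> e1 e2; rewrite /shift -alphaD; try exact: loop_shift.
apply/esym/alpha_hom.
  have := @homotopic_revl (p ++ r) q (s ++ rev b m) b.
  by rewrite tgt_cat -!catA; apply.
by rewrite /loop tgt_cat (loop_shift e1) (loop_shift e2).
Qed.

Lemma shift_nil p : shift p [::] p = 0.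
Proof.
rewrite /shift -alpha_nil; apply: alpha_hom; last exact: loop_shift.
by have := homotopic_rev [::] p [::]; rewrite /= cats0.
Qed.

Lemma shift_star p r : star_loop T (tgt T b p) r -> shift p r p = 0.
Proof.
move=> h; rewrite -(shift_nil p) /shift; apply: alpha_hom.
  exact: homotopic_star h (pivots0 _ _ _).
by case: h => a [c [_ _ e _ _]]; apply: loop_shift.
Qed.

Lemma shift_rev p r q : tgt T (tgt T b p) r = tgt T b q ->
  shift q (rev (tgt T b p) r) p = - shift p r q.
Proof.
move=> e; have e' : tgt T (tgt T b q) (rev (tgt T b p) r) = tgt T b p by rewrite -e tgt_rev.
have := shift_cat e e'; suff -> : shift p (r ++ rev (tgt T b p) r) p = 0 by lia.
rewrite -(shift_nil p) /shift; apply: alpha_hom; last by apply: loop_shift; rewrite tgt_cat e.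
exact: homotopic_rev.
Qed.

Definition base_edge x : oedge N := (tgt T b x.1.1, x.1.2, x.2).

(** In the cyclic cover, the edge [x] is the translate of [y] by the n-th power of the generator. *)
Definition ldist x y (n : int) : Prop := exists r,
  [/\ pivots T (tgt T b x.1.1) r [set x.1.2; x.2]%SET,
      tgt T (tgt T b x.1.1) r = tgt T b y.1.1,
      (tr T (tgt T b x.1.1) r x.1.2, tr T (tgt T b x.1.1) r x.2) = (y.1.2, y.2) &
      shift x.1.1 r y.1.1 = n].

Lemma same_ldist x y : same_ledge T b alpha x y -> ldist x y 0.
Proof. by []. Qed.

Lemma ldist_same_edge x y n : ldist x y n -> same_edge T (base_edge x) (base_edge y).
Proof. by move=> [r [p1 t1 [a1 b1] _]]; exists r. Qed.

Lemma ldist_flip x y n : ldist x y n -> ldist (flip x) (flip y) n.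
Proof. by move=> [r [p1 t1 [a1 b1] e]]; exists r; rewrite /= finset.setUC a1 b1. Qed.

Lemma ldist_trans x y z m n : ldist x y m -> ldist y z n -> ldist x z (m + n).
Proof.
move=> [r [p1 t1 [a1 b1] <-]] [s [p2 t2 [a2 b2] <-]]; exists (r ++ s).
rewrite pivots_cat p1 t1 imsetU1 imset_set1 a1 b1 p2 tgt_cat t1 t2 !tr_cat t1 a1 b1 a2 b2.
by split=> //; apply: shift_cat.
Qed.

Lemma ldist_sym x y n : ldist x y n -> ldist y x (- n).
Proof.
move=> [r [p1 t1 [a1 b1] <-]]; exists (rev (tgt T b x.1.1) r).
have := pivots_rev p1; rewrite imsetU1 imset_set1 t1 a1 b1 => ->.
rewrite -t1 tgt_rev -a1 -b1 !tr_rev; split=> //; exact: shift_rev.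
Qed.

(** A loop around an edge bounds in its star, so [alpha] vanishes on it. This is what makes
    exponents well defined. *)
Lemma ldist_self x n : x.1.2 != x.2 -> ldist x x n -> n = 0.
Proof.
move=> ne [r [p1 t1 [a1 b1] <-]]; apply: shift_star.
by exists x.1.2, x.2.
Qed.

Lemma ldist_uniq x y m n : x.1.2 != x.2 -> ldist x y m -> ldist x y n -> m = n.
Proof.
move=> ne h1 h2; have := ldist_self ne (ldist_trans h1 (ldist_sym h2)); lia.
Qed.

Variables (e : 'I_N -> oedge N) (L : nat).
Hypothesis hT : one_cusped T e.
Variable D : lifts T b alpha e L.
Implicit Types (c d : 'I_4).

Definition var_class (m : 'I_(N + L)) : 'I_N :=
  match fintype.split m with inl i => i | inr l => orb D l end.
Definition var_expo (m : 'I_(N + L)) : int :=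
  match fintype.split m with inl _ => 0 | inr l => expo D l end.

Definition base_lift (p : 'I_N * bool) : ledge :=
  let x := elift D (lshift L p.1) in if p.2 then x else flip x.

(** The edge of M under the edge [cd] of the j-th lifted tetrahedron, with relative orientation;
    [edge_expo] is the power of the generator that carries the chosen lift to that edge. *)
Definition edge_lift j c d := (var_class (var D j c d).1, (var D j c d).2).
Definition edge_expo j c d := var_expo (var D j c d).1.

Lemma base_lift_edge (p : 'I_N * bool) : same_edge T (base_edge (base_lift p)) (edge_end e p).
Proof.
case: p => i []; rewrite /base_lift /edge_end /=; first exact: eliftP.
by apply: (@same_edge_flip _ _ (base_edge (elift D (lshift L i)))); apply: eliftP.
Qed.

Lemma ldist_orb l : ldist (elift D (rshift N l)) (elift D (lshift L (orb D l))) (expo D l).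
Proof.
have [w [lw aw [r [p1 t1 tr1 al]]]] := orbP D l; rewrite /= in p1 t1 tr1 al.
rewrite tgt_cat lw in p1 t1 tr1.
rewrite -[expo D l]opprK; apply: ldist_sym; exists r; split=> //.
rewrite /shift; have := @alphaD w _ lw (loop_shift t1).
by move: al; rewrite -catA => -> ; rewrite aw; lia.
Qed.

Lemma edge_lift_dist j c d : c != d ->
  ldist (ltet D j, c, d) (base_lift (edge_lift j c d)) (edge_expo j c d).
Proof.
move=> cd; have := same_ldist (varP D j cd).
rewrite /base_lift /edge_lift /edge_expo /var_class /var_expo.
case: (var D j c d) => m o /=; case: splitP => [i|l] em.
  by rewrite (_ : m = lshift L i) //; apply: val_inj.
rewrite (_ : m = rshift N l); last exact: val_inj.
move=> h; rewrite -[expo D l]add0r; apply: ldist_trans h _.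
by case: o; [|apply: ldist_flip]; apply: ldist_orb.
Qed.

Lemma edge_lift_end j c d : c != d -> same_edge T (j, c, d) (edge_end e (edge_lift j c d)).
Proof.
move=> cd; apply: same_edge_trans (base_lift_edge _).
by have := ldist_same_edge (edge_lift_dist j cd); rewrite /base_edge /= ltetP.
Qed.

Lemma edge_lift_uniq j c d (p : 'I_N * bool) : c != d ->
  same_edge T (j, c, d) (edge_end e p) -> edge_lift j c d = p.
Proof. by move=> cd; apply: (edge_end_uniq hT _ (edge_lift_end j cd)). Qed.

Lemma edge_lift_ldist j c d j' c' d' n : c != d -> c' != d' ->
    ldist (ltet D j, c, d) (ltet D j', c', d') n ->
  edge_lift j c d = edge_lift j' c' d' /\ edge_expo j c d = n + edge_expo j' c' d'.
Proof.
move=> cd cd' h.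
have ee : edge_lift j c d = edge_lift j' c' d'.
  apply: edge_lift_uniq => //.
  have := ldist_same_edge h; rewrite /base_edge /= !ltetP => h'.
  exact: same_edge_trans h' (edge_lift_end j' cd').
split=> //; have h1 := edge_lift_dist j cd.
have h2 := ldist_trans h (edge_lift_dist j' cd').
by rewrite ee in h1; apply: ldist_uniq h1 h2.
Qed.

Lemma edge_lift_sym j c d : c != d ->
  edge_lift j d c = ((edge_lift j c d).1, ~~ (edge_lift j c d).2) /\
  edge_expo j d c = edge_expo j c d.
Proof.
move=> cd; have dc : d != c by rewrite eq_sym.
have flipE (p : 'I_N * bool) : edge_end e (p.1, ~~ p.2) = flip (edge_end e p).
  by case: p => i []; rewrite /edge_end //= flipK.
have flipL (p : 'I_N * bool) : base_lift (p.1, ~~ p.2) = flip (base_lift p).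
  by case: p => i []; rewrite /base_lift //=; case: (elift _ _) => [[]].
have ee : edge_lift j d c = ((edge_lift j c d).1, ~~ (edge_lift j c d).2).
  apply: edge_lift_uniq => //; rewrite flipE.
  exact: (same_edge_flip (edge_lift_end j cd)).
split=> //; have h1 := edge_lift_dist j dc; rewrite ee flipL in h1.
have h2 := ldist_flip (edge_lift_dist j cd).
by apply: ldist_uniq h1 h2.
Qed.

Definition cusp_expo (x : oedge N) : int := edge_expo x.1.1 x.1.2 (nxt x.1.2 x.2).

(** The exponents at the corners are a potential for the restriction of [alpha] to the cusp, which
    is thereby a flat connection. *)
Definition cusp_shift (x : oedge N) : int := cusp_expo x - cusp_expo (nu T x).

Lemma cusp_shiftE j v f : v != f ->
  cusp_shift (j, v, f) = shift (ltet D j) [:: f] (ltet D (nb T j f)).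
Proof.
move=> vf; rewrite /cusp_shift /cusp_expo.
have := corner_nu T j vf; rewrite /corner => -[cn1 cn2 cn3].
rewrite cn3 cn2 cn1 /=.
have vu : v != nxt v f by rewrite nxt_eqv.
have vu' : gl T j f v != gl T j f (nxt v f) by rewrite (inj_eq perm_inj).
have h : ldist (ltet D j, v, nxt v f) (ltet D (nb T j f), gl T j f v, gl T j f (nxt v f))
    (shift (ltet D j) [:: f] (ltet D (nb T j f))).
  exists [:: f]; rewrite /= !ltetP !inE; split=> //.
  by rewrite eq_sym (negPf vf) eq_sym nxt_eqf (negPf vf).
by have [_ ->] := edge_lift_ldist vu vu' h; rewrite addrK.
Qed.

Lemma cusp_shift_tau (x : oedge N) : tau T x != x -> cusp_shift (tau T x) = - cusp_shift x.
Proof.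
case: x => [[j v] f]; rewrite tau_act /= => vf; rewrite tauE // !cusp_shiftE ?(inj_eq perm_inj) //.
rewrite -shift_rev; last by rewrite !ltetP.
by rewrite nb_back !ltetP.
Qed.

Lemma cusp_shift_path r j v : pivots T j r [set v]%SET ->
  \sum_(x <- path_darts T j v r) cusp_shift x = shift (ltet D j) r (ltet D (tgt T j r)).
Proof.
elim: r j v => [|f r IH] j v /=; first by rewrite big_nil shift_nil.
rewrite imset_set1 finset.in_set1 big_cons => /andP[fv pr]; rewrite IH // cusp_shiftE 1?eq_sym //.
by rewrite -shift_cat ?ltetP.
Qed.

Lemma cusp_shift_onto : peripherally_onto T b alpha -> exists w,
  [/\ pivots T b w [set v0]%SET, tgt T b w = b, tr T b w v0 = v0 &
      \sum_(x <- path_darts T b v0 w) cusp_shift x = 1].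
Proof.
move=> /(_ 1)[w [lw pw tw aw]]; exists w; split=> //.
rewrite cusp_shift_path // lw /shift.
have lb : loop T b (ltet D b) by rewrite /loop ltetP.
have lr : loop T b (rev b (ltet D b)) by rewrite /loop -{1}(ltetP D b) tgt_rev.
rewrite !alphaD //; last by rewrite /loop tgt_cat lw.
rewrite aw addrCA -alphaD //.
by have := shift_nil (ltet D b); rewrite /shift /= => ->; rewrite addr0.
Qed.

Lemma cusp_shift_curve g : closed_curve T g -> alpha_vanishes T b alpha g ->
  \sum_(x <- path_darts T (atet (carc g ord0)) (avtx (carc g ord0)) (curve_word g)) cusp_shift x = 0.
Proof.
move=> gc ga; have [/and3P[pw /eqP tw _] _] := curve_word_loop gc.
rewrite cusp_shift_path // tw /shift; have := ga (ltet D (atet (carc g ord0))).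
rewrite ltetP => /(_ erefl).
by [].
Qed.

End Exponents.

(** * Duality between the longitude and the infinite cyclic cover *)

Section WalkCoboundary.
Local Open Scope ring_scope.
Variables (N : nat) (T : triangulation N) (V : zmodType) (S : V -> Prop).
Hypotheses (S0 : S 0) (SD : forall u v, S u -> S v -> S (u + v))
  (SN : forall u, S u -> S (- u)).
Variable k : oedge N -> V.
Hypothesis kphi : forall x, S (k (phi N x) - k x).

Lemma face_const j v f f' : f != v -> f' != v -> S (k (j, v, f) - k (j, v, f')).
Proof.
move=> fv fv'; rewrite eq_sym in fv; have k1 := kphi (j, v, f).
have k2 := kphi (phi N (j, v, f)); case/or3P: (nxt_cases fv fv') => /eqP ->.
- by rewrite subrr.
- by rewrite -phiE -opprB; apply: SN.
- by rewrite -!phiE -opprB -(subrKA (k (phi N (j, v, f)))); apply/SN/SD.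
Qed.

(** The sum telescopes because [k] is constant modulo [S] on each triangle. Below, [S] is either
    zero or the multiples of an integer. *)
Lemma walk_coboundary r j v f f' : f != v -> f' != tr T j r v ->
    pivots T j r [set v]%SET ->
  S (\sum_(x <- path_darts T j v r) (k x - k (tau T x)) -
     (k (j, v, f) - k (tgt T j r, tr T j r v, f'))).
Proof.
elim: r j v f => [|g r IH] j v f fv fv' /=.
  by move=> _; rewrite big_nil sub0r; apply/SN/face_const.
rewrite imset_set1 finset.in_set1 big_cons => /andP[gv pr].
have gv' : gl T j g g != gl T j g v by rewrite (inj_eq perm_inj).
have := SD (IH _ _ _ gv' fv' pr) (face_const j gv fv).
rewrite tauE 1?eq_sym //; congr S.
by rewrite !opprB !addrA [LHS](ACl (4*3*1*2*5))%AC.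
Qed.

Lemma closed_walk_coboundary r j v : pivots T j r [set v]%SET -> tgt T j r = j ->
  tr T j r v = v -> S (\sum_(x <- path_darts T j v r) (k x - k (tau T x))).
Proof.
move=> pr tr1 tr2; pose f := if v == v0 then v1 else v0.
have fv : f != v by rewrite /f; elim/ord4_ind: (v).
have := @walk_coboundary r j v f f fv; rewrite tr2 tr1 subrr subr0.
by apply.
Qed.

End WalkCoboundary.

(** * Periods and cup products on the torus *)

Section Duality.
Local Open Scope ring_scope.

Lemma right_kernel_exists (F : fieldType) (X Y : 'rV[F]_3) :
  exists v : 'cV[F]_3, [/\ v != 0, X *m v = 0 & Y *m v = 0].
Proof.
pose A := col_mx X Y; pose w := nz_row (kermx A^T).
have w0 : w != 0.
  rewrite nz_row_eq0 -mxrank_eq0 mxrank_ker mxrank_tr subn_eq0 -ltnNge.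
  exact: leq_ltn_trans (rank_leq_row A) _.
have : w *m A^T = 0 by apply/sub_kermxP/nz_row_sub.
move=> /(congr1 trmx); rewrite trmx_mul trmxK trmx0 mul_col_mx => e.
exists w^T; split; first by rewrite -(inj_eq trmx_inj) trmxK trmx0.
  by rewrite -[LHS](col_mxKu _ (Y *m w^T)) e linear0.
by rewrite -[LHS](col_mxKd (X *m w^T)) e linear0.
Qed.

Variables (N : nat) (T : triangulation N) (e : 'I_N -> oedge N).
Hypothesis hT : one_cusped T e.
Variables (F : numFieldType) (ha : oedge N -> int).
(** Two forms of the class of [alpha]: [ga] is its value on the crossing of a side, [na] its
    variation between the two ends of the side. *)
Let ga x := ha x - ha (nu T x).
Let na x := ha x - ha (phi N x).
Hypothesis ga_tau : forall x, tau T x != x -> ga (tau T x) = - ga x.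
Variables (j0 b : 'I_N) (w0 u0 : 'I_4) (s s1 : seq 'I_4).
Hypotheses (ps : cusp_loop T j0 w0 s) (ps1 : cusp_loop T b u0 s1).
Let lam := path_darts T j0 w0 s.
Hypotheses (ga_lam : \sum_(x <- lam) ga x = 0)
  (ga_one : \sum_(x <- path_darts T b u0 s1) ga x = 1).
Variables (q1 h1 : oedge N -> int).
Hypotheses (qh1 : forall y, q1 y - q1 (tau T y) = h1 y - h1 (nu T y))
  (lam_one : \sum_(x <- lam) (q1 x - q1 (tau T x)) = 1).

Lemma na_tau x : na (tau T x) = - na x.
Proof.
have [tx|ax] := eqVneq (tau T x) x; first by rewrite /na tx (tau_phi_fix tx) subrr.
have := ga_tau ax; rewrite /ga /na !nuE tauK.
by move: (ha _) (ha _) (ha _) (ha _) => a1 a2 a3 a4; clear; lia.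
Qed.

(** If [na] is a coboundary modulo [d], then subtracting its potential from [ha] makes [ga] one too,
    so the loop on which [ga] sums to 1 forces [d] to be 1. *)
Lemma na_primitive : exists q h : oedge N -> int,
  (forall y, q y - q (tau T y) = h y - h (nu T y)) /\ \sum_y q y * na y = 1.
Proof.
have [x0 ax0] : exists x0, tau T x0 != x0.
  by exists (j0, v0, v1); rewrite tau_act.
have n0 x : tau T x = x -> na x = 0 by move=> tx; rewrite /na (tau_phi_fix tx) subrr.
have fixnu x : (tau T (phi N (tau T x)) != phi N (tau T x)) = (tau T x != x).
  by rewrite -nuE nu_act.
have [d [a0 [a0nu a0tau [q [h [qh qd]]]]]] :=
  cocycle_ideal (@tauK _ T) (cusp_connected hT) (n := na) ax0 n0 (@tau_phi_fix _ T) fixnu.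
exists q, h; split; first by move=> y; rewrite nuE.
rewrite qd; pose k x := ha x - a0 x.
have dN (u : int) : (d %| u)%Z -> (d %| - u)%Z by move=> du; rewrite rpredN.
have dD (u v : int) : (d %| u)%Z -> (d %| v)%Z -> (d %| u + v)%Z by move=> *; apply: rpredD.
have kphi x : (d %| k (phi N x) - k x)%Z.
  have g1 := a0nu (tau T x); rewrite tauK in g1.
  have := dD _ _ (dN _ (a0tau x)) (dN _ g1); congr (is_true (_ %| _)%Z).
  by rewrite /k /na; lia.
have dga x : (d %| ga x - (k x - k (tau T x)))%Z.
  have g1 := a0nu x; have g2 := kphi (tau T x).
  have := dD _ _ (dN _ g1) (dN _ g2); congr (is_true (_ %| _)%Z).
  by rewrite /k /ga nuE; lia.
have /and3P[p1 /eqP t1 /eqP r1] := ps1.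
have dw := closed_walk_coboundary (S := fun m => (d %| m)%Z) (dvdz0 _) dD dN kphi p1 t1 r1.
have : (d %| \sum_(x <- path_darts T b u0 s1) ga x)%Z.
  rewrite -[X in (_ %| X)%Z](subrK (\sum_(x <- path_darts T b u0 s1) (k x - k (tau T x)))).
  by rewrite rpredD // -sumrB rpred_sum.
by rewrite ga_one dvdz1 absz_nat => /eqP ->.
Qed.

Definition cusp_conn (V : zmodType) (h : oedge N -> V) x := h x - h (nu T x).
Definition cusp_antisym (V : zmodType) (h : oedge N -> V) :=
  forall x, tau T x != x -> cusp_conn h (tau T x) = - cusp_conn h x.
(** [Fc] is evaluation on the curve; [Fp] is the cup product with [alpha], each side being counted
    from both of its darts. *)
Let Fc (h : oedge N -> F) := \sum_(x <- lam) cusp_conn h x.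
Let Fp (h : oedge N -> F) := \sum_x cusp_conn h x * (na x)%:~R.
Let hF x : F := (ha x)%:~R.

Let hF_conn x : cusp_conn hF x = (ga x)%:~R.
Proof. by rewrite /cusp_conn /hF -intrB. Qed.

Let Fc_ha : Fc hF = 0.
Proof.
rewrite /Fc (eq_bigr (fun x => (ga x)%:~R)); last by move=> x _; apply: hF_conn.
by rewrite -rmorph_sum /= ga_lam.
Qed.

Lemma sum_antisym (V : zmodType) (f : oedge N -> V) :
  \sum_x f (tau T x) = \sum_x f x.
Proof. by rewrite [RHS](reindex_inj (@perm_inj _ (tau T))). Qed.

Lemma sum_phi (V : zmodType) (f : oedge N -> V) : \sum_x f (phi N x) = \sum_x f x.
Proof. by rewrite [RHS](reindex_inj (@perm_inj _ (phi N))). Qed.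

(** The cup square of a class of degree 1 vanishes; here this is summation by parts over the
    triangles. *)
Let Fp_ha : Fp hF = 0.
Proof.
rewrite /Fp (eq_bigr (fun x => (ga x * na x)%:~R)); last by move=> x _; rewrite hF_conn -intrM.
rewrite -rmorph_sum /= (_ : \sum_x _ = 0) //.
have gE x : ga x = ha x - ha (tau T x) - na x.
  by rewrite /ga nuE; have := na_tau x; rewrite /na; lia.
have e1 : \sum_x ga x * na x = (\sum_x ha x * na x) *+ 2 - \sum_x na x * na x.
  rewrite mulr2n -{2}(sum_antisym (fun x => ha x * na x)) -big_split /= -sumrB.
  by apply: eq_bigr => x _; rewrite gE na_tau; ring.
have e2 : \sum_x na x * na x = (\sum_x ha x * na x) *+ 2.
  have hz : \sum_x (ha x * ha x - ha (phi N x) * ha (phi N x)) = 0.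
    by rewrite sumrB (sum_phi (fun x => ha x * ha x)) subrr.
  rewrite mulr2n -big_split -[RHS]subr0 -[X in _ - X]hz -sumrB /=.
  by apply: eq_bigr => x _; rewrite /na; ring.
by rewrite e1 e2 subrr.
Qed.

(** On each triangle [k] is constant while [na] sums to 0 along the boundary. *)
Let Fp_coboundary (k : oedge N -> F) : (forall x, k (phi N x) = k x) ->
  \sum_x (k x - k (tau T x)) * (na x)%:~R = 0.
Proof.
move=> kphi.
have e1 : \sum_x k x * (na x)%:~R = 0.
  transitivity (\sum_x (k x * (ha x)%:~R - k (phi N x) * (ha (phi N x))%:~R)).
    by apply: eq_bigr => x _; rewrite kphi /na intrB mulrBr.
  by rewrite sumrB (sum_phi (fun x => k x * (ha x)%:~R)) subrr.
transitivity (\sum_x k x * (na x)%:~R + \sum_x k (tau T x) * (na (tau T x))%:~R).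
  rewrite -big_split /=; apply: eq_bigr => x _.
  by rewrite na_tau intrN mulrBl mulrN.
by rewrite (sum_antisym (fun x => k x * (na x)%:~R)) e1 addr0.
Qed.

Let Fc_coboundary (k : oedge N -> F) : (forall x, k (phi N x) = k x) ->
  \sum_(x <- lam) (k x - k (tau T x)) = 0.
Proof.
move=> kphi; have /and3P[p1 /eqP t1 /eqP r1] := ps.
apply: (closed_walk_coboundary (S := fun u => u = 0) _ _ _ _ p1 t1 r1) => //.
- by move=> u v -> ->; rewrite addr0.
- by move=> u ->; rewrite oppr0.
- by move=> x; rewrite kphi subrr.
Qed.

(* The periods of the connections of [ha], [hb], [hb'] span at most a plane of
   [F^3], so some linear combination [va, vb, vc] of the three is a coboundary. *)
Lemma pair_walks (hb hb' : oedge N -> F) : cusp_antisym hb -> cusp_antisym hb' ->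
  Fc hb * Fp hb' = Fc hb' * Fp hb.
Proof.
move=> anti anti'.
pose G : groupType := HB.pack_for groupType 'rV[F]_3 (isGroup.Build 'rV[F]_3
  (@addrA 'rV[F]_3) (@add0r 'rV[F]_3) (@addr0 'rV[F]_3) (@addNr 'rV[F]_3) (@addrN 'rV[F]_3)).
pose H x : 'rV[F]_3 := \row_i nth 0 [:: hF x; hb x; hb' x] i.
have HE x : H x - H (phi N (tau T x)) =
    \row_i nth 0 [:: cusp_conn hF x; cusp_conn hb x; cusp_conn hb' x] i.
  by apply/rowP => i; rewrite !mxE -nuE; case: i => [[|[|[|i]]]].
have antiH : antisym (phi N) (tau T) (H : _ -> G).
  move=> x ax; change (H (tau T x) - H (phi N (tau T (tau T x))) = - (H x - H (phi N (tau T x)))).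
  rewrite !HE; apply/rowP => i; rewrite !mxE !hF_conn ga_tau // anti // anti' // intrN.
  by case: i => [[|[|[|i]]]].
have [k [X [Y [kphi _ gen]]]] := torus_gauge (leqnn _) (@tauK _ T) (@tau_phi_fix _ T)
  (cusp_connected hT) (cusp_toroidal hT) antiH.
(* As [v] annihilates both generators, the combination with coefficients [v] has trivial gauged
   holonomy. *)
have [v [v0' Xv Yv]] := right_kernel_exists X Y.
pose kv x : F := ((k x : 'rV[F]_3) *m v) 0 0.
have kvphi x : kv (phi N x) = kv x by rewrite /kv kphi.
have subP : @subgroup_pred G (fun z => (z : 'rV[F]_3) *m v = 0).
  split; first exact: mul0mx.
    by move=> u w hu hw; rewrite mulmxDl hu hw addr0.
  by move=> u hu; rewrite mulNmx hu oppr0.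
pose va : F := v ord0 0; pose vb : F := v (lift ord0 ord0) 0.
pose vc : F := v (lift ord0 (lift ord0 ord0)) 0.
pose hv x : F := (H x *m v) 0 0.
have hvE x : hv x = va * hF x + vb * hb x + vc * hb' x.
  rewrite /hv mxE !big_ord_recl big_ord0 !mxE /= -/va -/vb -/vc addr0 addrA.
  by rewrite [hF x * _]mulrC [hb x * _]mulrC [hb' x * _]mulrC.
have connv x : cusp_conn hv x = ((H x - H (phi N (tau T x))) *m v) 0 0.
  by rewrite /cusp_conn /hv nuE mulmxBl !mxE.
have aux (A B C : 'rV[F]_3) : (- A + B + C) *m v = 0 ->
    (B *m v) 0 0 = (A *m v) 0 0 - (C *m v) 0 0.
  rewrite !mulmxDl mulNmx; move: (A *m v) (B *m v) (C *m v) => A' B' C' /eqP.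
  by rewrite addr_eq0 => /eqP h; rewrite -[B'](addNKr A') h !mxE.
have connE x : cusp_conn hv x = kv x - kv (tau T x).
  have [tx|ax] := eqVneq (tau T x) x.
    by rewrite tx subrr /cusp_conn nuE tx (tau_phi_fix tx) subrr.
  have := gen _ subP Xv Yv x ax.
  change ((- (k x : 'rV[F]_3) + (H x - H (phi N (tau T x))) + k (tau T x)) *m v = 0 -> 
    cusp_conn hv x = kv x - kv (tau T x)).
  by move/aux; rewrite connv.
have lin (f : (oedge N -> F) -> F) : f hv = va * f hF + vb * f hb + vc * f hb' ->
    f hv = 0 -> f hF = 0 -> vb * f hb = - (vc * f hb').
  by move=> ef h0 h; rewrite ef h mulr0 add0r in h0; apply/eqP; rewrite -addr_eq0 h0.
have Fcv : vb * Fc hb = - (vc * Fc hb').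
  apply: (lin Fc) Fc_ha.
    by rewrite /Fc !mulr_sumr -!big_split; apply: eq_bigr => x _; rewrite /cusp_conn !hvE /=; ring.
  by rewrite /Fc (eq_bigr _ (fun x _ => connE x)) Fc_coboundary.
have Fpv : vb * Fp hb = - (vc * Fp hb').
  apply: (lin Fp) Fp_ha.
    by rewrite /Fp !mulr_sumr -!big_split; apply: eq_bigr => x _; rewrite /cusp_conn !hvE /=; ring.
  rewrite /Fp (eq_bigr (fun x => (kv x - kv (tau T x)) * (na x)%:~R)) ?Fp_coboundary //.
  by move=> x _; rewrite connE.
have [e1|n1] := eqVneq (vb) 0; last first.
  apply: (mulfI n1); rewrite !mulrA Fcv [vb * Fc hb']mulrC -[Fc hb' * _ * _]mulrA Fpv.
  by ring.
have [e2|n2] := eqVneq (vc) 0; last first.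
  move/eqP: Fcv; move/eqP: Fpv; rewrite e1 !mul0r ![0 == _]eq_sym !oppr_eq0 !mulf_eq0 (negPf n2) /=.
  by move=> /eqP -> /eqP ->; rewrite mulr0 mul0r.
(* If only the first coefficient is nonzero, [ga] itself is a coboundary, contrary to the loop on
   which it sums to 1. *)
have n0 : va != 0.
  apply: contra_neq v0' => e0; apply/colP => i; rewrite mxE.
  by case: i => [[|[|[|i]]]] hi //; [rewrite -e0|rewrite -e1|rewrite -e2]; congr (v _ 0); apply: val_inj.
have /and3P[p1 /eqP t1 /eqP r1] := ps1.
have := closed_walk_coboundary (S := fun u : F => u = 0) (k := kv) _ _ _ _ p1 t1 r1.
rewrite -(eq_bigr _ (fun x _ => connE x)) => h.
have h0 : \sum_(x <- path_darts T b u0 s1) cusp_conn hv x = 0.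
  apply: h => //.
  - by move=> u w -> ->; rewrite addr0.
  - by move=> u ->; rewrite oppr0.
  - by move=> x; rewrite kvphi subrr.
move: h0; rewrite (eq_bigr (fun x => va * (ga x)%:~R)); last first.
  by move=> x _; rewrite /cusp_conn !hvE e1 e2 -[(ga x)%:~R]hF_conn /cusp_conn; ring.
rewrite -mulr_sumr -rmorph_sum /= ga_one mulr1 => /eqP.
by rewrite (negPf n0).
Qed.

(** Applying [pair_walks] with the integral class [h1], of value 1 on the curve, gives the constant
    2m with m an integer; the integral class [h2], dual to [na], then shows that m divides 1. *)
Lemma walk_duality : exists eps : F, (eps = 1 \/ eps = -1) /\
  forall hb : oedge N -> F, cusp_antisym hb -> Fp hb = eps *+ 2 * Fc hb.
Proof.
have antiI (q h : oedge N -> int) : (forall y, q y - q (tau T y) = h y - h (nu T y)) ->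
    cusp_antisym (fun x => (h x)%:~R : F).
  move=> qh x ax; rewrite /cusp_conn -!intrB -!qh tauK -intrN; congr (_%:~R).
  by lia.
have FpI (q h : oedge N -> int) : (forall y, q y - q (tau T y) = h y - h (nu T y)) ->
    Fp (fun x => (h x)%:~R) = ((\sum_y q y * na y) *+ 2)%:~R.
  move=> qh; rewrite mulr2n -{2}(sum_antisym (fun y => q y * na y)) -big_split rmorph_sum /=.
  apply: eq_bigr => x _; rewrite /cusp_conn -intrB -qh -intrM; congr (_%:~R).
  by rewrite na_tau; ring.
have FcI (q h : oedge N -> int) : (forall y, q y - q (tau T y) = h y - h (nu T y)) ->
    Fc (fun x => (h x)%:~R) = (\sum_(x <- lam) (q x - q (tau T x)))%:~R.
  by move=> qh; rewrite rmorph_sum /=; apply: eq_bigr => x _; rewrite /cusp_conn -intrB -qh.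
have [q2 [h2 [qh2 na_one]]] := na_primitive.
have main hb : cusp_antisym hb -> Fp hb = ((\sum_y q1 y * na y) *+ 2)%:~R * Fc hb.
  move=> anti; rewrite -(FpI _ _ qh1).
  by rewrite mulrC (pair_walks anti (antiI _ _ qh1)) (FcI _ _ qh1) lam_one mul1r.
pose m := \sum_y q1 y * na y.
have m1 : m = 1 \/ m = -1.
  have := main _ (antiI _ _ qh2); rewrite (FpI _ _ qh2) na_one (FcI _ _ qh2) -intrM -/m.
  set l := \sum_(x <- lam) _ => /eqP; rewrite eqr_int => /eqP h.
  have : m * l = 1 by lia.
  move=> /(congr1 absz); rewrite abszM => /eqP; rewrite muln_eq1 => /andP[/eqP h1' _].
  by lia.
exists m%:~R; split.
  by case: m1 => ->; [left|right; rewrite intrN].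
by move=> hb anti; rewrite main // -/m; congr (_ * _); rewrite !mulr2n intrD.
Qed.

End Duality.

Section OrbitSums.
Local Open Scope ring_scope.

(** The weights in [H] average the partial sums over all starting points of the cycle, so that no
    base point has to be chosen. *)
Lemma orbit_primitive (F : numFieldType) (D : finType) (p : {perm D}) (f : D -> F) :
    (forall x, \sum_(y in porbit p x) f y = 0) ->
  exists h : D -> F, forall x, h x - h (p x) = f (p x).
Proof.
move=> f0; pose H x := \sum_(l < #|porbit p x|) l.+1%:R * f ((p ^+ l.+1)%g x).
exists (fun x => - H x / #|porbit p x|%:R) => x.
have ep : porbit p (p x) = porbit p x by have := porbit_perm p 1 x; rewrite expg1.
rewrite ep; set n := #|porbit p x|.
have n0 : n%:R != 0 :> F by rewrite pnatr_eq0 card_porbit_neq0.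
have ssum : \sum_(l < n) f ((p ^+ l.+1)%g x) = 0.
  rewrite -[RHS](f0 (p x)) ep.
  have -> : \sum_(y in porbit p x) f y = \sum_(y <- traject p (p x) n) f y.
    rewrite big_uniq /=; last by rewrite /n -ep uniq_traject_porbit.
    by apply: eq_bigl => y; rewrite /n -ep -porbit_traject.
  rewrite [RHS](big_nth (p x)) size_traject big_mkord; apply: eq_bigr => l _.
  by rewrite nth_traject // -iterSr permX.
have HE : H (p x) = H x - \sum_(l < n) f ((p ^+ l.+1)%g x) + n%:R * f (p x).
  rewrite /H ep -/n -sumrB.
  have [m em] : exists m, n = m.+1 by exists n.-1; rewrite prednK // lt0n card_porbit_neq0.
  rewrite em big_ord_recr big_ord_recl /= expg1 mul1r subrr add0r -em.
  have -> : (p ^+ n)%g (p x) = p x.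
    by rewrite permX /n -ep iter_porbit.
  congr (_ + _); apply: eq_bigr => l _.
  rewrite /bump /= add1n [in RHS]mulrSr mulrDl mul1r addrK; congr (_ * f _).
  by rewrite [in RHS]expgS permM.
by rewrite HE ssum subr0 !mulNr opprK mulrDl addKr mulrAC divff // mul1r.
Qed.

End OrbitSums.

Section CornerWeights.
Local Open Scope ring_scope.

Lemma big_ord4_lt (V : Type) (x : V) (op : Monoid.com_law x) (F : 'I_4 * 'I_4 -> V) :
  \big[op/x]_(ab : 'I_4 * 'I_4 | (ab.1 < ab.2)%N) F ab =
    op (op (op (op (op (F (v0, v1)) (F (v0, v2))) (F (v0, v3))) (F (v1, v2))) (F (v1, v3))) (F (v2, v3)).
Proof.
transitivity (\big[op/x]_(a < 4) \big[op/x]_(c < 4) if (a < c)%N then F (a, c) else x).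
  by rewrite pair_bigA big_mkcond; apply: eq_bigr => -[].
rewrite !big_ord_recl !big_ord0 /= !Monoid.mulm1 !Monoid.mul1m !Monoid.mulmA.
by do ![congr (op _ _)]; congr (F (_, _)); apply: val_inj.
Qed.

Lemma sum_ord4_neq (V : nmodType) (F : 'I_4 * 'I_4 -> V) :
  \sum_(ab : 'I_4 * 'I_4 | ab.1 != ab.2) F ab = \sum_(ab : 'I_4 * 'I_4 | (ab.1 < ab.2)%N) (F ab + F (ab.2, ab.1)).
Proof.
rewrite big_split /= (bigID (fun ab : 'I_4 * 'I_4 => (ab.1 < ab.2)%N)) /=; congr (_ + _).
  by apply: eq_bigl => -[a c] /=; apply: andb_idl; apply: contraTneq => ->; rewrite ltnn.
pose sw (ab : 'I_4 * 'I_4) := (ab.2, ab.1).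
rewrite [RHS](reindex_inj (can_inj (_ : involutive sw))); last by case.
apply: eq_big => -[a c] //=.
by rewrite -leqNgt -val_eqE /= ltn_neqAle eq_sym.
Qed.

Lemma edge_kindC a c : edge_kind a c = edge_kind c a.
Proof. by rewrite /edge_kind addnC. Qed.

Lemma sum_edge_kind (V : nmodType) (W : 'I_3 -> V) :
  \sum_(ab : 'I_4 * 'I_4 | (ab.1 < ab.2)%N) W (edge_kind ab.1 ab.2) = (\sum_k W k) *+ 2.
Proof.
rewrite big_ord4_lt !big_ord_recl big_ord0 addr0 /edge_kind /=.
rewrite (_ : lift ord0 ord0 = 1 :> 'I_3); last exact: val_inj.
rewrite (_ : lift ord0 (lift ord0 ord0) = 2%:R :> 'I_3); last exact: val_inj.
rewrite (_ : ord0 = 0 :> 'I_3); last exact: val_inj.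
by rewrite mulr2n !addrA [LHS](ACl (2*1*3*5*6*4))%AC.
Qed.

Lemma sum_corner_kinds (V : nmodType) (W : 'I_3 -> V) (v f : 'I_4) : v != f ->
  W (edge_kind v (nxt v f)) + W (edge_kind v (nxt v (nxt v f))) + W (edge_kind v f) = \sum_k W k.
Proof.
move=> vf; rewrite !big_ord_recl big_ord0 addr0 addrA.
rewrite (_ : lift ord0 ord0 = 1 :> 'I_3); last exact: val_inj.
rewrite (_ : lift ord0 (lift ord0 ord0) = 2%:R :> 'I_3); last exact: val_inj.
rewrite (_ : ord0 = 0 :> 'I_3); last exact: val_inj.
move: vf; elim/ord4_ind: v; elim/ord4_ind: f => // _; rewrite /edge_kind /=.
all: first [by [] | by rewrite [LHS](ACl (1*3*2))%AC | by rewrite [LHS](ACl (2*1*3))%AC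
  | by rewrite [LHS](ACl (2*3*1))%AC | by rewrite [LHS](ACl (3*1*2))%AC | by rewrite [LHS](ACl (3*2*1))%AC].
Qed.

End CornerWeights.

(** * Corner weights as closed cochains on the cusp *)

Section WeightsDuality.
Local Open Scope ring_scope.
Variables (R : realType) (N : nat) (T : triangulation N) (e : 'I_N -> oedge N).
Hypothesis hT : one_cusped T e.
Implicit Types (x y : oedge N).

Lemma end_class_flip x : x.1.2 != x.2 ->
  end_class T e (flip x) = ((end_class T e x).1, ~~ (end_class T e x).2).
Proof.
move=> ax; have ax' : (flip x).1.2 != (flip x).2 by rewrite /= eq_sym.
apply/(end_class_eq hT _ ax').
have := same_edge_flip (end_classP hT ax).
by case: (end_class T e x) => i []; rewrite /edge_end //= flipK.
Qed.

Lemma on_edge_class x i : x.1.2 != x.2 -> on_edge T e x i <-> (end_class T e x).1 = i.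
Proof.
move=> ax; rewrite on_edge_ends; split=> [[c xc]|<-]; first by move/(end_class_eq hT _ ax): xc => ->.
by exists (end_class T e x).2; rewrite -surjective_pairing; apply: end_classP.
Qed.

Lemma sum_corners (V : nmodType) (G : oedge N -> V) :
  \sum_(x : oedge N | x.1.2 != x.2) G (corner x) =
  \sum_j \sum_(ab : 'I_4 * 'I_4 | (ab.1 < ab.2)%N) (G (j, ab.1, ab.2) + G (j, ab.2, ab.1)).
Proof.
transitivity (\sum_(x : oedge N | x.1.2 != x.2) G x).
  rewrite [RHS](reindex_inj (@perm_inj _ (phi N))) /=; apply: eq_big => x.
    by case: x => [[j v] f]; rewrite phiE /= nxt_eqv.
  by rewrite cornerE.
under [RHS]eq_bigr => j _ do rewrite -(sum_ord4_neq (fun ab => G (j, ab.1, ab.2))).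
rewrite pair_big_dep /=.
pose ass (p : 'I_N * ('I_4 * 'I_4)) : oedge N := (p.1, p.2.1, p.2.2).
rewrite (reindex ass) /=; first by apply: eq_bigl.
exists (fun x : oedge N => (x.1.1, (x.1.2, x.2))); first by case=> [j [a c]].
by case=> [[j a] c].
Qed.

Lemma arc_sign (v c i o : 'I_4) : uniq [:: v; c; i; o] ->
  [/\ nxt v i = o, nxt v o = c & sign4 v c i o = 1] \/
  [/\ nxt v o = i, nxt v i = c & sign4 v c i o = -1].
Proof.
move=> u; suff : [&& nxt v i == o, nxt v o == c & sign4 v c i o == 1] ||
    [&& nxt v o == i, nxt v i == c & sign4 v c i o == -1].
  by move=> /orP[]/and3P[/eqP e1 /eqP e2 /eqP e3]; [left|right]; split.
by move: u; elim/ord4_ind: v; elim/ord4_ind: c; elim/ord4_ind: i; elim/ord4_ind: o.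
Qed.

Variables (F : numFieldType).
Variable B : 'I_N -> 'I_3 -> F.
Hypothesis B_kinds : forall j, \sum_k B j k = 0.
Hypothesis B_edges : forall i, \sum_j \sum_(ab : 'I_4 * 'I_4 |
  (ab.1 < ab.2)%N && `[< on_edge T e (j, ab.1, ab.2) i >]) B j (edge_kind ab.1 ab.2) = 0.

Definition corner_weight x : F :=
  if x.1.2 == x.2 then 0 else B x.1.1 (edge_kind x.1.2 (nxt x.1.2 x.2)).
Local Notation beta := corner_weight.

Lemma corner_weight_triangle x : beta x + beta (phi N x) + beta (phi N (phi N x)) = 0.
Proof.
case: x => [[j v] f]; rewrite !phiE /corner_weight /= !nxt_eqv nxt3.
have [vf|vf] := eqVneq v f; first by rewrite !addr0.
by rewrite sum_corner_kinds.
Qed.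

Lemma corner_weight_vertex x : \sum_(y in porbit (nu T) x) beta y = 0.
Proof.
have [tx|ax] := eqVneq (tau T x) x.
  rewrite nu_inact // big_set1 /corner_weight.
  by move/eqP: tx; rewrite -[_ == _]negbK tau_act negbK => ->.
pose p := end_class T e (corner x).
pose G y : F := if end_class T e y == p then B y.1.1 (edge_kind y.1.2 y.2) else 0.
transitivity (\sum_(y : oedge N | y.1.2 != y.2) G (corner y)).
  rewrite [LHS]big_mkcond [RHS]big_mkcond /=; apply: eq_bigr => y _.
  rewrite -(tau_act T); have [ty|ay] := eqVneq (tau T y) y.
    by rewrite porbit_sym nu_inact // finset.in_set1; case: eqP => // exy; rewrite exy ty eqxx in ax.
  rewrite (porbit_nu_class hT) // /G eq_sym -/p; case: eqP => // _.
  by move: ay; rewrite tau_act /corner_weight => /negPf ->.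
rewrite sum_corners -[RHS](B_edges p.1); apply: eq_bigr => j _.
rewrite [RHS]big_mkcondr; apply: eq_bigr => -[a c] /= ac.
have nac : a != c by apply: contraTneq ac => ->; rewrite ltnn.
have := @on_edge_class (j, a, c) p.1 nac; have := @end_class_flip (j, a, c) nac.
rewrite /G /flip /= edge_kindC => ->; case: (end_class T e (j, a, c)) => i o /= onE.
case: (p) onE => i' o' /= onE; rewrite !xpair_eqE.
have -> : `[< on_edge T e (j, a, c) i' >] = (i == i').
  by apply/asboolP/eqP => /onE.
case: (i == i'); last by rewrite addr0.
by case: o; case: o' {onE} => /=; rewrite ?addr0 ?add0r.
Qed.

(** The corner weights of a triangle sum to 0, so they are the increments of a function on its
    sides; this is the one with sum 0. *)
Definition corner_potential x : F := (beta x - beta (phi N x)) / 3.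
Local Notation u := corner_potential.

Lemma corner_potentialE x : u (phi N x) - u x = beta (phi N x).
Proof.
rewrite /corner_potential -mulrBl; apply: (canLR (mulfK _)); first by rewrite pnatr_eq0.
have := corner_weight_triangle x.
move: (beta x) (beta (phi N x)) (beta (phi N (phi N x))) => a b c e0.
by have -> : c = - a - b; [apply/eqP; rewrite -subr_eq0 -e0; apply/eqP; ring|ring].
Qed.

(** The jumps of the potential across the sides are flat because the corner weights sum to 0 around
    every vertex. *)
Lemma corner_connection_exists : exists h : oedge N -> F,
  forall x, cusp_conn T h x = u x - u (tau T x).
Proof.
have [h hE] := orbit_primitive corner_weight_vertex.
exists (fun x => u x + h x) => x; rewrite /cusp_conn opprD addrACA hE nuE.
by rewrite -corner_potentialE addrA subrK.
Qed.

Variables (b : 'I_N) (alpha : seq 'I_4 -> int).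
Hypotheses (halpha : is_epimorphism T b alpha) (halphaP : peripherally_onto T b alpha).
Variables (L : nat) (D : lifts T b alpha e L) (g : curve N).
Hypotheses (hg : peripheral_curve R T g) (hg0 : alpha_vanishes T b alpha g).

(** Regrouping the jumps across sides by arcs gives the variation of the potential along each arc,
    the signed weight of the corner cut off. *)
Lemma curve_potential (h : oedge N -> F) : closed_curve T g ->
    (forall x, cusp_conn T h x = u x - u (tau T x)) ->
  \sum_(x <- path_darts T (atet (carc g ord0)) (avtx (carc g ord0)) (curve_word g)) cusp_conn T h x =
  \sum_i (sign4 (avtx (carc g i)) (acor (carc g i)) (ain (carc g i)) (aout (carc g i)))%:~R *
    B (atet (carc g i)) (edge_kind (avtx (carc g i)) (acor (carc g i))).
Proof.
move=> gc hE; have [_ ->] := curve_word_loop gc.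
rewrite big_map big_enum /= (eq_bigr (fun i => u (out_dart i) - u (in_dart (ordS i)))); last first.
  by move=> i _; rewrite hE (tau_out gc).
have shiftE : \sum_(i < (clen g).+1) u (in_dart (ordS i)) = \sum_(i < (clen g).+1) u (in_dart i).
  by rewrite [RHS](reindex_inj (can_inj (@ordSK _))).
rewrite sumrB shiftE -sumrB /=.
apply: eq_bigr => i _.
have := arc_uniq gc i => /= U; have vo : avtx (carc g i) != aout (carc g i).
  by move: U; rewrite !inE !negb_or => /andP[/and3P[]].
have vi : avtx (carc g i) != ain (carc g i).
  by move: U; rewrite !inE !negb_or => /andP[/and3P[]].
have [[e1 e2 ->]|[e1 e2 ->]] := arc_sign U.
  have -> : out_dart i = phi N (in_dart i) by rewrite phiE e1.
  rewrite corner_potentialE phiE /corner_weight /= e1 e2 (negPf vo).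
  by rewrite mul1r.
have -> : in_dart i = phi N (out_dart i) by rewrite phiE e1.
rewrite -opprB corner_potentialE phiE /corner_weight /= e1 e2 (negPf vi).
by rewrite mulN1r.
Qed.

Theorem weights_duality : exists eps : F, (eps = 1 \/ eps = -1) /\
  (\sum_j \sum_(ab : 'I_4 * 'I_4 | (ab.1 < ab.2)%N)
    (edge_expo D j ab.1 ab.2)%:~R * B j (edge_kind ab.1 ab.2)) *+ 2 =
  eps * \sum_i (sign4 (avtx (carc g i)) (acor (carc g i)) (ain (carc g i)) (aout (carc g i)))%:~R *
    B (atet (carc g i)) (edge_kind (avtx (carc g i)) (acor (carc g i))).
Proof.
have [gc _ _] := hg; have [lw dw] := curve_word_loop gc.
have [q1 [h1 [qh1 q1one]]] := curve_primitive hT hg.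
have [w [pw tw rw ga_one]] := cusp_shift_onto halpha hT D halphaP.
have lw1 : cusp_loop T b v0 w by rewrite /cusp_loop pw tw rw !eqxx.
have lam_one : \sum_(x <- path_darts T (atet (carc g ord0)) (avtx (carc g ord0)) (curve_word g))
    (q1 x - q1 (tau T x)) = 1.
  rewrite -q1one sum_count.
  have -> : \sum_y q1 y * curve_cochain g y =
      \sum_y q1 y *+ count_mem y [seq out_dart i | i <- enum 'I_(clen g).+1]
      - \sum_y q1 (tau T y) *+ count_mem (tau T (tau T y)) [seq out_dart i | i <- enum 'I_(clen g).+1].
    rewrite (sum_antisym T (fun y => q1 y *+ count_mem (tau T y) _)) -sumrB.
    apply: eq_bigr => y _; rewrite (curve_cochain_count gc) mulrBr.
    by rewrite -!natz !mulr_natr.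
  rewrite dw -sumrB; apply: eq_bigr => y _.
  by rewrite tauK mulrnBl.
have [eps [eps1 dual]] := @walk_duality N T e hT F (cusp_expo D) (cusp_shift_tau halpha hT D) _ _ _ _ _ _ lw lw1
  (cusp_shift_curve halpha hT D gc hg0) ga_one _ _ qh1 lam_one.
have [h hE] := corner_connection_exists.
exists eps; split=> //.
have anti : cusp_antisym T h by move=> x ax; rewrite !hE tauK opprB.
rewrite -(curve_potential gc hE).
have := dual h anti; set S := \sum_(x <- path_darts _ _ _ _) _; set P := \sum_x _ * _.
(* Summation by parts; one factor 2 comes from the two darts of a side, the other from the two ends
   of an edge. *)
have -> : P = (\sum_j \sum_(ab : 'I_4 * 'I_4 | (ab.1 < ab.2)%N)
    (edge_expo D j ab.1 ab.2)%:~R * B j (edge_kind ab.1 ab.2)) *+ 2 *+ 2.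
  rewrite /P; pose na x := cusp_expo D x - cusp_expo D (phi N x).
  have naE x : na (tau T x) = - na x.
    exact: (na_tau (cusp_shift_tau halpha hT D)).
  transitivity ((\sum_x u x * (na x)%:~R) *+ 2).
    rewrite mulr2n -{2}(sum_antisym T (fun x => u x * (na x)%:~R)) -big_split /=.
    by apply: eq_bigr => x _; rewrite hE naE intrN -/(na x); ring.
  congr (_ *+ 2); transitivity (\sum_x beta x * (cusp_expo D x)%:~R).
    transitivity (\sum_x u x * (cusp_expo D x)%:~R - \sum_x u x * (cusp_expo D (phi N x))%:~R).
      by rewrite -sumrB; apply: eq_bigr => x _; rewrite /na intrB mulrBr.
    rewrite -(sum_phi (fun x => u x * _)) -sumrB -(sum_phi (fun x => beta x * _)).
    by apply: eq_bigr => x _; rewrite -mulrBl corner_potentialE.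
  transitivity (\sum_(x : oedge N | x.1.2 != x.2)
     B (corner x).1.1 (edge_kind (corner x).1.2 (corner x).2) *
       (edge_expo D (corner x).1.1 (corner x).1.2 (corner x).2)%:~R).
    rewrite [RHS]big_mkcond /=; apply: eq_bigr => x _.
    by rewrite /corner_weight; case: ifP; rewrite // mul0r.
  rewrite (sum_corners (fun y => B y.1.1 (edge_kind y.1.2 y.2) * (edge_expo D y.1.1 y.1.2 y.2)%:~R)).
  rewrite -sumrMnl; apply: eq_bigr => j _; rewrite -sumrMnl; apply: eq_bigr => -[a c] /= ac.
  have nac : a != c by apply: contraTneq ac => ->; rewrite ltnn.
  have [_ ->] := edge_lift_sym halpha hT D j nac.
  by rewrite edge_kindC mulr2n mulrC.
move=> hh; apply: (@mulfI _ (2%:R : F)); first by rewrite pnatr_eq0.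
by rewrite !mulr_natl hh mulrnAl.
Qed.

End WeightsDuality.

(** * The Jacobian and the 1-loop invariant *)

Section Determinants.
Local Open Scope ring_scope.

Lemma det_block_unit (F : comRingType) n m (A : 'M[F]_n) (B : 'M[F]_(n, m)) (C : 'M[F]_(m, n)) :
  \det (block_mx A B C 1%:M) = \det (A - B *m C).
Proof.
have -> : block_mx A B C 1%:M = block_mx (A - B *m C) B 0 1%:M *m block_mx 1%:M 0 C 1%:M.
  by rewrite mulmx_block !mulmx1 !mul1mx !mulmx0 subrK !add0r.
by rewrite det_mulmx det_ublock det_lblock !det1 !mulr1.
Qed.

Lemma sum_cofactor_col (F : comRingType) n (A : 'M[F]_n) i0 i :
  \sum_j A j i * cofactor A j i0 = \det A *+ (i == i0).
Proof.
have := mul_adj_mx A => /matrixP/(_ i0 i); rewrite !mxE eq_sym => <-.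
by apply: eq_bigr => j _; rewrite !mxE mulrC.
Qed.

(** Add all columns to the column [i0], then expand along it. *)
Lemma det_row_sums (F : comRingType) n (A : 'M[F]_n) i0 :
  \det A = \sum_j (\sum_i A j i) * cofactor A j i0.
Proof.
under eq_bigr => j _ do rewrite mulr_suml.
rewrite exchange_big /=; under eq_bigr => i _ do rewrite sum_cofactor_col.
by rewrite (bigD1 i0) //= eqxx big1 ?addr0 // => i /negPf ->.
Qed.

End Determinants.

Section DeterminantDerivatives.
Local Open Scope classical_set_scope.
Local Open Scope ring_scope.
Variable F : numFieldType.

Lemma derivable_big_sum (I : Type) (r : seq I) (f : I -> F -> F) (x : F) :
  (forall i, derivable (f i) x 1) -> derivable (fun t => \sum_(i <- r) f i t) x 1.
Proof.
move=> df; elim: r => [|i r IH].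
  by under eq_fun do rewrite big_nil; apply: derivable_cst.
by under eq_fun do rewrite big_cons; apply: derivableD.
Qed.

Lemma derivable_big_prod (I : Type) (r : seq I) (f : I -> F -> F) (x : F) :
  (forall i, derivable (f i) x 1) -> derivable (fun t => \prod_(i <- r) f i t) x 1.
Proof.
move=> df; elim: r => [|i r IH].
  by under eq_fun do rewrite big_nil; apply: derivable_cst.
by under eq_fun do rewrite big_cons; apply: derivableM.
Qed.

Lemma derivable_det n (A : F -> 'M[F]_n) (x : F) :
  (forall i j, derivable (fun t => A t i j) x 1) -> derivable (fun t => \det (A t)) x 1.
Proof.
move=> dA; apply: derivable_big_sum => s; apply: derivableM; first exact: derivable_cst.
by apply: derivable_big_prod => i.
Qed.

Lemma is_derive_big_sum (I : Type) (r : seq I) (f : I -> F -> F) (d : I -> F) (x : F) :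
  (forall i, is_derive x 1 (f i) (d i)) ->
  is_derive x 1 (fun t => \sum_(i <- r) f i t) (\sum_(i <- r) d i).
Proof.
move=> df; elim: r => [|i r IH].
  by under eq_fun do rewrite big_nil; rewrite big_nil; apply: is_derive_cst.
by under eq_fun do rewrite big_cons; rewrite big_cons; apply: is_deriveD.
Qed.

Lemma is_derive_exprz (k : int) : is_derive (1 : F) (1 : F) (fun t : F => t ^ k) k%:~R.
Proof.
have dX n : is_derive (1 : F) (1 : F) (fun t : F => t ^+ n) n%:R.
  apply: DeriveDef; first exact: exprn_derivable.
  by rewrite exp_derive expr1n /GRing.scale /= !mulr1.
case: k => n; first exact: dX.
have e1 : (fun t : F => t ^+ n.+1) 1 != 0 by rewrite expr1n oner_neq0.
have [d1 d2] := dX n.+1.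
apply: DeriveDef; first exact: derivableV.
rewrite (@deriveV _ _ (fun t : F => t ^+ n.+1)) // d2 expr1n expr1n invr1 scaleN1r NegzE mulrNz.
by [].
Qed.

(** In [det_row_sums] the row sums vanish at [x], so the terms where a cofactor is differentiated
    disappear. *)
Lemma is_derive_det n (A : F -> 'M[F]_n) (i0 : 'I_n) (d : 'I_n -> F) (x : F) :
    (forall i j, derivable (fun t => A t i j) x 1) ->
    (forall j, \sum_i A x j i = 0) ->
    (forall j, is_derive x 1 (fun t => \sum_i A t j i) (d j)) ->
  is_derive x 1 (fun t => \det (A t)) (\sum_j d j * cofactor (A x) j i0).
Proof.
move=> dA A0 dd; under eq_fun do rewrite (det_row_sums _ i0).
apply: is_derive_big_sum => j.
have dc : derivable (fun t => cofactor (A t) j i0) x 1.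
  apply: derivableM; first exact: derivable_cst.
  by apply: derivable_det => k l; under eq_fun do rewrite !mxE; apply: dA.
have dcD := derivableP dc.
apply: (@is_derive_eq _ _ _ _ _ _ _ _ (is_deriveM _ _)).
by rewrite A0 scale0r add0r /GRing.scale /= mulrC.
Qed.

End DeterminantDerivatives.

(** * Relations between the zeta parameters *)

Section ShapeAlgebra.
Local Open Scope ring_scope.
Variable F : fieldType.
Implicit Type z : F.

Lemma ord3E (k : 'I_3) : [\/ k = 0, k = 1 | k = 2%:R].
Proof. by case: k => -[|[|[|//]]] i; [constructor 1|constructor 2|constructor 3]; apply: val_inj. Qed.

Lemma zeta_neq0 k z : z != 0 -> z != 1 -> zeta k z != 0.
Proof.
move=> z0 z1; have z1' : 1 - z != 0 by rewrite subr_eq0 eq_sym.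
have z1'' : z - 1 != 0 by rewrite subr_eq0.
by case: (ord3E k) => ->; rewrite /zeta /= invr_eq0 ?mulf_neq0.
Qed.

Lemma zeta_sum z : z != 0 -> z != 1 -> zeta 0 z + zeta 1 z + zeta 2%:R z = 0.
Proof.
move=> z0 z1; have z1' : 1 - z != 0 by rewrite subr_eq0 eq_sym.
have z1'' : z - 1 != 0 by rewrite subr_eq0.
by rewrite /zeta /=; field; rewrite z0 z1' z1''.
Qed.

Lemma zeta_shape k z : z != 0 -> z != 1 -> zeta (k + 1) z = - shape_param k z * zeta (k + 2%:R) z.
Proof.
move=> z0 z1; have z1' : 1 - z != 0 by rewrite subr_eq0 eq_sym.
have z1'' : z - 1 != 0 by rewrite subr_eq0.
by case: (ord3E k) => ->; rewrite /zeta /shape_param /=; field; rewrite ?z0 ?z1' ?z1''.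
Qed.

(** A triple with sum 0 is determined up to scale by one ratio; the shift by [q] accounts for the
    quad type. *)
Lemma zeta_proportional (q : 'I_3) z (X0 X1 X2 : F) : z != 0 -> z != 1 ->
    X0 + X1 + X2 = 0 -> X1 = - shape_param (- q) z * X2 -> X2 != 0 ->
  exists2 mu : F, mu != 0 &
    [/\ X0 = mu * zeta (0 - q) z, X1 = mu * zeta (1 - q) z & X2 = mu * zeta (2%:R - q) z].
Proof.
move=> z0 z1 sX X1E X2n; have zn k := zeta_neq0 k z0 z1.
exists (X2 / zeta (2%:R - q) z); first by rewrite mulf_neq0 ?invr_neq0.
have e2 : X2 = X2 / zeta (2%:R - q) z * zeta (2%:R - q) z by rewrite divfK.
have e1 : X1 = X2 / zeta (2%:R - q) z * zeta (1 - q) z.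
  by rewrite [2%:R - q]addrC [1 - q]addrC zeta_shape // mulrCA divfK // X1E.
split=> //; have -> : X0 = - X1 - X2 by rewrite -[LHS](addrK (X1 + X2)) addrA sX sub0r opprD.
rewrite e1 {2}e2 -mulrN -mulrBr; congr (_ * _).
suff /eqP : zeta (0 - q) z + (zeta (1 - q) z + zeta (2%:R - q) z) = 0.
  by rewrite addr_eq0 opprD => /eqP/esym.
have := zeta_sum z0 z1.
case: (ord3E q) => -> <-; rewrite /zeta /=; ring.
Qed.

End ShapeAlgebra.

(** * The Jacobian of the Ptolemy polynomials *)

Section PtolemyJacobian.
Local Open Scope classical_set_scope.
Local Open Scope ring_scope.

Lemma is_derive_coord (F : numFieldType) n (m : 'I_n) (x v : 'rV[F]_n) :
  is_derive x v (fun y : 'rV[F]_n => y 0 m) (v 0 m).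
Proof.
have lim : (fun h => h^-1 *: ((h *: v + x) 0 m - x 0 m)) @ (0 : F)^' --> v 0 m.
  apply: cvg_near_cst; near=> h.
  rewrite !mxE addrK /GRing.scale /= mulKf //.
  by near: h; apply: nbhs_dnbhs_neq.
by apply: DeriveDef; [apply/cvg_ex; exists (v 0 m)|apply: cvg_lim].
Unshelve. all: by end_near. Qed.

Variable R : realType.
Local Notation C := (Cx R).

(** The signed monomials of the Ptolemy relation, indexed by the kind of the two opposite edges in
    each. *)
Definition ptolemy_term (s : 'I_4 -> 'I_4 -> 'I_4 -> C) (c : 'I_4 -> 'I_4 -> C) (k : 'I_3) : C :=
  nth 0 [:: c v0 v2 * c v1 v3;
    - ((s v0 v1 v3 * s v1 v0 v2) / (s v1 v3 v2 * s v0 v2 v3) * (c v0 v1 * c v2 v3));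
    - ((s v0 v3 v1 * s v3 v0 v2) / (s v3 v1 v2 * s v0 v2 v1) * (c v0 v3 * c v1 v2))] k.

Lemma ptolemy_sum s c : ptolemy s c = ptolemy_term s c 0 + ptolemy_term s c 1 + ptolemy_term s c 2%:R.
Proof. by rewrite /ptolemy /ptolemy_term /= addrAC. Qed.

Lemma sum_ord3 (V : nmodType) (f : 'I_3 -> V) : \sum_k f k = f 0 + f 1 + f 2%:R.
Proof.
rewrite !big_ord_recl big_ord0 addr0 addrA.
by congr (f _ + f _ + f _); apply: val_inj.
Qed.

(** Multiplying a derivative by its variable restores each monomial, once for every occurrence of
    the variable; [w] records the occurrences. *)
Lemma ptolemy_derive (V : normedModType C) s (y : 'I_4 -> 'I_4 -> V -> C) (x v : V)
    (dy w : 'I_4 -> 'I_4 -> C) (k : C) :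
    (forall a b, is_derive x v (y a b) (dy a b)) ->
    (forall a b : 'I_4, (a < b)%N -> k * dy a b = w a b * y a b x) ->
  k * 'D_v (fun x => ptolemy s (fun a b => y a b x)) x =
  \sum_(ab : 'I_4 * 'I_4 | (ab.1 < ab.2)%N)
    w ab.1 ab.2 * ptolemy_term s (fun a b => y a b x) (edge_kind ab.1 ab.2).
Proof.
move=> dyP kdy.
have dM a b a' b' := is_deriveM (dyP a b) (dyP a' b').
have dMk r a b a' b' : is_derive x v (fun x => r * (y a b x * y a' b' x)) _ :=
  is_deriveZ r (dM a b a' b').
have dP := is_deriveB (is_deriveB (dM v0 v2 v1 v3)
  (dMk ((s v0 v3 v1 * s v3 v0 v2) / (s v3 v1 v2 * s v0 v2 v1)) v0 v3 v1 v2))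
  (dMk ((s v0 v1 v3 * s v1 v0 v2) / (s v1 v3 v2 * s v0 v2 v3)) v0 v1 v2 v3).
have -> := @derive_val _ _ _ _ _ _ _ dP.
rewrite big_ord4_lt /ptolemy_term /edge_kind /= /GRing.scale /=.
move: (s v0 v3 v1 * _ / _) (s v0 v1 v3 * _ / _) => r1 r2.
transitivity (y v0 v2 x * (k * dy v1 v3) + y v1 v3 x * (k * dy v0 v2)
  - r1 * (y v0 v3 x * (k * dy v1 v2) + y v1 v2 x * (k * dy v0 v3))
  - r2 * (y v0 v1 x * (k * dy v2 v3) + y v2 v3 x * (k * dy v0 v1))); first by ring.
by rewrite !kdy //; ring.
Qed.

Variables (N : nat) (T : triangulation N) (b : 'I_N) (alpha : seq 'I_4 -> int).
Variables (e : 'I_N -> oedge N) (L : nat) (D : lifts T b alpha e L).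
Variable sigma : 'I_N -> 'I_4 -> 'I_4 -> 'I_4 -> C.

Definition var_value (x : 'rV[C]_(N + L)) j (a c : 'I_4) : C :=
  if (var D j a c).2 then x 0 (var D j a c).1 else - x 0 (var D j a c).1.

Lemma jacobian_tet (x : 'rV[C]_(N + L)) t j m : x 0 m * ptolemy_jacobian D sigma x t (lshift L j) m =
  \sum_(ab : 'I_4 * 'I_4 | (ab.1 < ab.2)%N)
    ((var D j ab.1 ab.2).1 == m)%:R * ptolemy_term (sigma j) (var_value x j) (edge_kind ab.1 ab.2).
Proof.
rewrite mxE (_ : ptolemy_poly _ _ _ _ = fun x => ptolemy (sigma j) (fun a c => var_value x j a c)); last first.
  by apply/funext => y; rewrite /ptolemy_poly (unsplitK (inl j)).
pose w a c : C := ((var D j a c).1 == m)%:R.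
pose dy a c : C := if (var D j a c).2 then w a c else - w a c.
apply: (@ptolemy_derive _ _ (fun a c x => var_value x j a c) _ _ dy w) => a c.
  rewrite /var_value /dy /w; case: (var D j a c) => n [] /=.
    by apply: is_derive_eq (is_derive_coord n x _) _; rewrite mxE eqxx.
  apply: is_derive_eq (is_deriveN (is_derive_coord n x _)) _.
  by rewrite mxE eqxx.
rewrite /dy /var_value /w => _; case: (var D j a c) => n [] /=.
  by case: eqP => [->|_]; rewrite ?mulr1 ?mul1r ?mulr0 ?mul0r.
by case: eqP => [->|_]; rewrite ?mulrN1 ?mul1r ?oppr0 ?mulr0 ?mul0r.
Qed.

Lemma jacobian_extra (x : 'rV[C]_(N + L)) t l m : ptolemy_jacobian D sigma x t (rshift N l) m =
  (rshift N l == m)%:R - t ^ (- expo D l) * (lshift L (orb D l) == m)%:R.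
Proof.
rewrite mxE (_ : ptolemy_poly _ _ _ _ =
  (fun x : 'rV[C]_(N + L) => x 0 (rshift N l)) -
  (fun x : 'rV[C]_(N + L) => t ^ (- expo D l) * x 0 (lshift L (orb D l)))); last first.
  by apply/funext => y; rewrite /ptolemy_poly (unsplitK (inr l)).
have d1 := is_derive_coord (rshift N l) x (delta_mx 0 m).
have d2 := is_deriveZ (t ^ (- expo D l)) (is_derive_coord (lshift L (orb D l)) x (delta_mx 0 m)).
have -> := @derive_val _ _ _ _ _ _ _ (is_deriveB d1 d2).
by rewrite !mxE !eqxx.
Qed.

(** After scaling the columns, the equations of the extra variables contain an identity block; its
    Schur complement replaces each extra variable by a power of t times its base variable. *)
Lemma jacobian_det (x : 'rV[C]_(N + L)) t :
    (forall m, x 0 m != 0) -> (forall l, x 0 (rshift N l) = x 0 (lshift L (orb D l))) ->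
  \det (ptolemy_jacobian D sigma x t) * \prod_(i < N) x 0 (lshift L i) =
  \det (\matrix_(j < N, i < N) \sum_(ab : 'I_4 * 'I_4 | (ab.1 < ab.2)%N)
    ((edge_lift D j ab.1 ab.2).1 == i)%:R * t ^ (- edge_expo D j ab.1 ab.2) *
    ptolemy_term (sigma j) (var_value x j) (edge_kind ab.1 ab.2)).
Proof.
move=> x0 xr; pose y := \row_l x 0 (lshift L (orb D l)).
pose X j (ab : 'I_4 * 'I_4) := ptolemy_term (sigma j) (var_value x j) (edge_kind ab.1 ab.2).
pose A : 'M[C]_N := \matrix_(j, i) \sum_(ab : 'I_4 * 'I_4 | (ab.1 < ab.2)%N)
  ((var D j ab.1 ab.2).1 == lshift L i)%:R * X j ab.
pose B : 'M[C]_(N, L) := \matrix_(j, l) \sum_(ab : 'I_4 * 'I_4 | (ab.1 < ab.2)%N)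
  ((var D j ab.1 ab.2).1 == rshift N l)%:R * X j ab.
pose E : 'M[C]_(L, N) := \matrix_(l, i) - (t ^ (- expo D l) * (orb D l == i)%:R).
have JE : ptolemy_jacobian D sigma x t *m diag_mx x =
    diag_mx (row_mx (const_mx 1) y) *m block_mx A B E 1%:M.
  rewrite mul_mx_diag mul_diag_mx; apply/matrixP => i m; rewrite [LHS]mxE [RHS]mxE mulrC.
  case: (split_ordP i) => [j ->|l ->].
    rewrite jacobian_tet row_mxEl mxE mul1r.
    by case: (split_ordP m) => [k ->|k ->]; rewrite (block_mxEul, block_mxEur) mxE.
  rewrite jacobian_extra row_mxEr mxE.
  case: (split_ordP m) => [k ->|k ->]; rewrite (block_mxEdl, block_mxEdr) mxE !eq_shift.
    by rewrite sub0r !mulrN; case: eqP => [->|_]; rewrite ?mulr0 ?mulr1 // mulrC.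
  by rewrite mulr0 subr0 xr; case: eqP => [->|_]; rewrite ?mulr0 ?mulr1.
have prod0 : \prod_l y 0 l != 0 by apply/prodf_neq0 => l _; rewrite mxE x0.
apply: (mulIf prod0); rewrite -mulrA.
have -> : \prod_(i < N) x 0 (lshift L i) * \prod_l y 0 l = \det (diag_mx x).
  by rewrite det_diag big_split_ord /=; congr (_ * _); apply: eq_bigr => l _; rewrite mxE xr.
rewrite -det_mulmx JE det_mulmx det_block_unit det_diag big_split_ord /= mulrC; congr (_ * _).
  congr (\det _); apply/matrixP => j i; rewrite !mxE -sumrN.
  under [X in _ + X]eq_bigr => l _ do rewrite !mxE mulrN opprK mulr_suml.
  rewrite exchange_big -big_split /=; apply: eq_bigr => -[a c] _ /=.
  rewrite /edge_expo /var_class /var_expo -/(X j (a, c)).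
  case: (split_ordP (var D j a c).1) => [k ->|k ->].
    rewrite eq_shift oppr0 expr0z mulr1 big1 ?addr0 // => l _.
    by rewrite eq_shift !mul0r.
  rewrite eq_shift mul0r add0r (bigD1 k) //= eqxx big1 ?addr0 => [|l /negPf lk].
    by rewrite mul1r mulrC [_ * (_ == _)%:R]mulrC.
  by rewrite eq_shift eq_sym lk !mul0r.
rewrite big1 ?mul1r; last by move=> i _; rewrite row_mxEl mxE.
by apply: eq_bigr => l _; rewrite row_mxEr.
Qed.

End PtolemyJacobian.

Section CocycleSigns.
Local Open Scope ring_scope.
Variables (R : realType) (N : nat) (T : triangulation N).
Local Notation C := (Cx R).
Variable sigma : 'I_N -> 'I_4 -> 'I_4 -> 'I_4 -> C.
Hypothesis hs : cocycle T sigma.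

Lemma cocycle_sqr j i v k l : uniq [:: i; v; k; l] -> sigma j i v k ^+ 2 = 1.
Proof. by move=> u; case: (hs j u) => [[] -> _ _ _]; rewrite ?sqrrN expr1n. Qed.

Lemma cocycle_inv j i v k l : uniq [:: i; v; k; l] -> (sigma j i v k)^-1 = sigma j i v k.
Proof. by move=> u; case: (hs j u) => [[] -> _ _ _]; rewrite ?invrN invr1. Qed.

Lemma cocycle_sym j i v k l : uniq [:: i; v; k; l] -> sigma j k v i = sigma j i v k.
Proof. by move=> u; case: (hs j u) => _ -> _ _; apply: cocycle_inv u. Qed.

Lemma cocycle_mul j i v k l : uniq [:: i; v; k; l] -> sigma j i v k * sigma j k v l = sigma j i v l.
Proof.
move=> u; case: (hs j u) => _ _ e _; have u' : uniq [:: i; v; l; k].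
  by move: u; rewrite /= !inE !negb_or [l == k]eq_sym => /and3P[/and3P[-> -> ->] /andP[-> ->] ->].
have s0 : sigma j l v i != 0.
  by case: (hs j u') => _ -> _ _; case: (hs j u') => [[] -> _ _ _]; rewrite invr_eq0 ?oppr_eq0 oner_eq0.
apply: (mulIf s0); rewrite e; case: (hs j u') => _ -> _ _.
by rewrite (cocycle_inv j u') -expr2 (cocycle_sqr j u').
Qed.

Lemma cocycle_ratio_sqr j : ((sigma j v0 v1 v3 * sigma j v1 v0 v2) / (sigma j v1 v3 v2 * sigma j v0 v2 v3)) ^+ 2 = 1
  /\ ((sigma j v0 v3 v1 * sigma j v3 v0 v2) / (sigma j v3 v1 v2 * sigma j v0 v2 v1)) ^+ 2 = 1.
Proof.
split; rewrite exprMn exprVn !exprMn.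
  by rewrite (@cocycle_sqr j v0 v1 v3 v2) // (@cocycle_sqr j v1 v0 v2 v3) //
    (@cocycle_sqr j v1 v3 v2 v0) // (@cocycle_sqr j v0 v2 v3 v1) // !mulr1 invr1 mulr1.
by rewrite (@cocycle_sqr j v0 v3 v1 v2) // (@cocycle_sqr j v3 v0 v2 v1) //
  (@cocycle_sqr j v3 v1 v2 v0) // (@cocycle_sqr j v0 v2 v1 v3) // !mulr1 invr1 mulr1.
Qed.

(** Reconciles the sign in the shape parameter with the two signs in the Ptolemy relation. *)
Lemma cocycle_ratios j :
  ((sigma j v1 v0 v3 * sigma j v3 v2 v1) / (sigma j v0 v3 v2 * sigma j v2 v1 v0)) *
  ((sigma j v0 v3 v1 * sigma j v3 v0 v2) / (sigma j v3 v1 v2 * sigma j v0 v2 v1)) =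
  (sigma j v0 v1 v3 * sigma j v1 v0 v2) / (sigma j v1 v3 v2 * sigma j v0 v2 v3).
Proof.
rewrite !invfM (@cocycle_inv j v0 v3 v2 v1) // (@cocycle_inv j v2 v1 v0 v3) //
  (@cocycle_inv j v3 v1 v2 v0) // (@cocycle_inv j v0 v2 v1 v3) //
  (@cocycle_inv j v1 v3 v2 v0) // (@cocycle_inv j v0 v2 v3 v1) //.
rewrite -(@cocycle_mul j v1 v0 v3 v2) // (@cocycle_sym j v3 v1 v0 v2) // -(@cocycle_mul j v3 v1 v2 v0) //.
rewrite -(@cocycle_mul j v0 v2 v1 v3) // (@cocycle_sym j v3 v2 v1 v0) //.
rewrite -(@cocycle_mul j v1 v3 v0 v2) // (@cocycle_sym j v0 v3 v1 v2) //.
ring.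
Qed.

End CocycleSigns.

Section EdgeValues.
Local Open Scope ring_scope.
Variables (R : realType) (N : nat) (T : triangulation N).
Variables (sigma : 'I_N -> 'I_4 -> 'I_4 -> 'I_4 -> Cx R) (c : 'I_N -> 'I_4 -> 'I_4 -> Cx R).
Hypothesis hc : ptolemy_assignment T sigma c.
Local Notation C := (Cx R).

Lemma ptolemy_same_edge (x y : oedge N) : x.1.2 != x.2 -> same_edge T x y ->
  c x.1.1 x.1.2 x.2 = c y.1.1 y.1.2 y.2.
Proof.
case: hc => _ cnb _; case: x y => [[j a] d] [[j' a'] d'] /= ad [r []] /=.
elim: r j a d ad => [|f r IH] j a d ad /= p t t1 t2; first by rewrite -t -t1 -t2.
move: p; rewrite !inE negb_or imsetU1 imset_set1 => /andP[/andP[fa fd] p].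
rewrite -(IH _ _ _ _ p t t1 t2) ?(inj_eq perm_inj) // cnb //.
by rewrite /= !inE negb_or ad ![_ == f]eq_sym fa fd.
Qed.

Variables (b : 'I_N) (alpha : seq 'I_4 -> int) (halpha : is_epimorphism T b alpha).
Variables (e : 'I_N -> oedge N) (hT : one_cusped T e) (L : nat) (D : lifts T b alpha e L).

Lemma edge_valueE j a d : a != d ->
  c j a d = if (edge_lift D j a d).2 then edge_value e c (edge_lift D j a d).1
            else - edge_value e c (edge_lift D j a d).1.
Proof.
move=> ad; rewrite (ptolemy_same_edge _ (edge_lift_end halpha D j ad)) //.
case: (edge_lift D j a d) => i [] //=; rewrite /edge_end /=.
by case: hc => cne _ _; case: hT => _ _ ne _; case: (cne (e i).1.1 (e i).1.2 (e i).2).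
Qed.

Lemma edge_value_neq0 i : edge_value e c i != 0.
Proof. by case: hc => cne _ _; case: hT => _ _ ne _; case: (cne (e i).1.1 (e i).1.2 (e i).2). Qed.

Lemma ptolemy_point_class m : ptolemy_point D c 0 m = edge_value e c (var_class D m).
Proof. by rewrite mxE /var_class; case: (fintype.split m). Qed.

Lemma var_value_point j a d : a != d -> var_value D (ptolemy_point D c) j a d = c j a d.
Proof. by move=> ad; rewrite /var_value edge_valueE // ptolemy_point_class. Qed.

Lemma ptolemy_term_point (s : 'I_4 -> 'I_4 -> 'I_4 -> C) j k :
  ptolemy_term s (var_value D (ptolemy_point D c) j) k = ptolemy_term s (c j) k.
Proof. by rewrite /ptolemy_term !var_value_point. Qed.

(** Squaring removes the cocycle signs and the edge orientations, at the price of a result up to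
    sign. *)
Lemma sqr_ptolemy_term j k : cocycle T sigma ->
  ptolemy_term (sigma j) (c j) k ^+ 2 =
  \prod_(ab : 'I_4 * 'I_4 | (ab.1 < ab.2)%N && (edge_kind ab.1 ab.2 == k))
    edge_value e c (edge_lift D j ab.1 ab.2).1 ^+ 2.
Proof.
move=> hs; transitivity (\prod_(ab : 'I_4 * 'I_4 | (ab.1 < ab.2)%N && (edge_kind ab.1 ab.2 == k))
    c j ab.1 ab.2 ^+ 2); last first.
  apply: eq_bigr => -[a d] /andP[/= ad _]; rewrite edge_valueE; last first.
    by apply: contraTneq ad => ->; rewrite ltnn.
  by case: ifP => _ //; rewrite sqrrN.
case: (cocycle_ratio_sqr hs j) => sq1 sq2.
rewrite big_mkcondr /= big_ord4_lt /edge_kind /=.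
case: (ord3E k) => -> /=; rewrite /ptolemy_term /= ?mul1r ?mulr1 ?sqrrN.
- by rewrite exprMn.
- by rewrite exprMn sq1 mul1r exprMn.
- by rewrite exprMn sq2 mul1r exprMn.
Qed.

End EdgeValues.

Section PtolemyWeights.
Local Open Scope ring_scope.
Variables (R : realType) (N : nat) (T : triangulation N).
Local Notation C := (Cx R).
Variables (sigma : 'I_N -> 'I_4 -> 'I_4 -> 'I_4 -> C) (c : 'I_N -> 'I_4 -> 'I_4 -> C).
Hypotheses (hs : cocycle T sigma) (hc : ptolemy_assignment T sigma c).

Lemma ptolemy_shape_term j :
  ptolemy_term (sigma j) (c j) 1 = - ptolemy_shape (sigma j) (c j) * ptolemy_term (sigma j) (c j) 2%:R.
Proof.
case: (hc) => cne _ _.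
rewrite /ptolemy_shape /ptolemy_term /= -(cocycle_ratios hs) opprK mulrN; congr (- _).
have [c03 _] := cne j v0 v3 isT; have [c12 _] := cne j v1 v2 isT.
rewrite [RHS]mulrACA divfK ?mulf_neq0 //.
Qed.

Lemma ptolemy_weights (qd : 'I_N -> 'I_3) (z : 'I_N -> C) j : z j != 0 -> z j != 1 ->
    ptolemy_shape (sigma j) (c j) = edge_shape qd z j v1 v3 ->
  exists2 mu : C, mu != 0 & forall k, ptolemy_term (sigma j) (c j) k = mu * zeta (k - qd j) (z j).
Proof.
move=> z0 z1 sh; case: (hc) => cne _ /(_ j); rewrite ptolemy_sum => p0.
have [||mu mu0 [e0 e1 e2]] := zeta_proportional (q := qd j) z0 z1 p0.
- rewrite ptolemy_shape_term sh; congr (- _ * _).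
  by rewrite /edge_shape /edge_kind /= sub0r.
- case: (cocycle_ratio_sqr hs j) => _ sq; rewrite /ptolemy_term /= oppr_eq0.
  have [c03 _] := cne j v0 v3 isT; have [c12 _] := cne j v1 v2 isT.
  apply: mulf_neq0; last exact: mulf_neq0.
  by apply: contra_eq_neq sq => ->; rewrite expr0n eq_sym oner_eq0.
by exists mu => // k; case: (ord3E k) => ->.
Qed.
End PtolemyWeights.

(** * The twisted gluing matrix *)

Section OneLoop.
Local Open Scope classical_set_scope.
Local Open Scope ring_scope.
Variables (R : realType) (N : nat) (T : triangulation N).
Local Notation C := (Cx R).
Variables (b : 'I_N) (alpha : seq 'I_4 -> int) (halpha : is_epimorphism T b alpha).
Variables (e : 'I_N -> oedge N) (hT : one_cusped T e) (L : nat) (D : lifts T b alpha e L).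
Variables (qd : 'I_N -> 'I_3) (z : 'I_N -> C).
Hypothesis z01 : forall j, z j != 0 /\ z j != 1.

Lemma on_edge_lift j a d i : a != d ->
  `[< on_edge T e (j, a, d) i >] = ((edge_lift D j a d).1 == i).
Proof.
move=> ad; have cls := @end_class_eq _ _ _ hT (j, a, d) (edge_lift D j a d) ad.
have <- := proj1 cls (edge_lift_end halpha D j ad).
by apply/asboolP/eqP => /(@on_edge_class _ _ _ hT (j, a, d) i ad).
Qed.

Lemma big_gluing (V : Type) (x : V) (op : Monoid.com_law x) (G : 'I_3 -> 'I_4 * 'I_4 -> V) i j :
  \big[op/x]_k \big[op/x]_(ab in [set ab : 'I_4 * 'I_4 |
     [&& (ab.1 < ab.2)%N, edge_kind ab.1 ab.2 - qd j == k &
         `[< on_edge T e (j, ab.1, ab.2) i >]]]%SET) G k ab =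
  \big[op/x]_(ab : 'I_4 * 'I_4 | (ab.1 < ab.2)%N && ((edge_lift D j ab.1 ab.2).1 == i))
    G (edge_kind ab.1 ab.2 - qd j) ab.
Proof.
rewrite [RHS](partition_big (fun ab : 'I_4 * 'I_4 => edge_kind ab.1 ab.2 - qd j) predT) //=.
apply: eq_bigr => k _; apply: eq_big => [[a d]|[a d]]; rewrite finset.in_set /=; last first.
  by move=> /and3P[_ /eqP -> _].
have [ad|] := ltnP a d; rewrite //= on_edge_lift 1?andbC //.
by apply: contraTneq ad => ->; rewrite ltnn.
Qed.

Lemma gluing_sum (W : 'I_3 -> C) i j :
  \sum_k (gluing_mx T e qd k i j)%:~R * W k =
  \sum_(ab : 'I_4 * 'I_4 | (ab.1 < ab.2)%N && ((edge_lift D j ab.1 ab.2).1 == i))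
    W (edge_kind ab.1 ab.2 - qd j).
Proof.
rewrite -(big_gluing _ (fun k _ => W k)); apply: eq_bigr => k _.
by rewrite mxE sumr_const mulrC mulr_natr.
Qed.

Lemma sum_zeta_shift j : \sum_k zeta (k - qd j) (z j) = 0.
Proof.
have [z0 z1] := z01 j; rewrite -[RHS](zeta_sum z0 z1) -(sum_ord3 (fun k => zeta k (z j))).
by rewrite [RHS](reindex_inj (@addIr _ (- qd j))).
Qed.

Definition weight_mx (G : 'I_3 -> 'M[int]_N) : 'M[C]_N :=
  \sum_(k < 3) map_mx intr (G k) *m diag_mx (\row_j zeta k (z j)).

Lemma weight_mxE G i j : weight_mx G i j = \sum_k (G k i j)%:~R * zeta k (z j).
Proof. by rewrite summxE; apply: eq_bigr => k _; rewrite mul_mx_diag !mxE. Qed.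

(** The transposed zeta-weighted gluing matrix of the cyclic cover, with t recording deck
    exponents. *)
Definition cover_mx (t : C) : 'M[C]_N :=
  \matrix_(j < N, i < N) \sum_(ab : 'I_4 * 'I_4 | (ab.1 < ab.2)%N)
    ((edge_lift D j ab.1 ab.2).1 == i)%:R * t ^ (- edge_expo D j ab.1 ab.2) *
    zeta (edge_kind ab.1 ab.2 - qd j) (z j).

Lemma cover_mx1 : cover_mx 1 = (weight_mx (gluing_mx T e qd))^T.
Proof.
apply/matrixP => j i; rewrite !mxE weight_mxE gluing_sum big_mkcondr /=.
apply: eq_bigr => ab _; rewrite exp1rz mulr1.
by case: eqP; rewrite ?mul1r ?mul0r.
Qed.

Lemma cover_mx_row t j : \sum_i cover_mx t j i =
  \sum_(ab : 'I_4 * 'I_4 | (ab.1 < ab.2)%N)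
    t ^ (- edge_expo D j ab.1 ab.2) * zeta (edge_kind ab.1 ab.2 - qd j) (z j).
Proof.
under eq_bigr => i _ do rewrite mxE.
rewrite exchange_big; apply: eq_bigr => ab _ /=.
rewrite -2!mulr_suml (bigD1 (edge_lift D j ab.1 ab.2).1) //= eqxx big1 ?addr0 ?mul1r //.
by move=> i /negPf; rewrite eq_sym => ->.
Qed.

Lemma cover_mx_derive i0 : is_derive (1 : C) (1 : C) (fun t => \det (cover_mx t))
  (\sum_j (\sum_(ab : 'I_4 * 'I_4 | (ab.1 < ab.2)%N)
     (- edge_expo D j ab.1 ab.2)%:~R * zeta (edge_kind ab.1 ab.2 - qd j) (z j)) *
   cofactor (weight_mx (gluing_mx T e qd)) i0 j).
Proof.
have cofE j : cofactor (weight_mx (gluing_mx T e qd)) i0 j = cofactor (cover_mx 1) j i0.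
  by rewrite cover_mx1 cofactor_tr.
under eq_bigr => j _ do rewrite cofE.
apply: is_derive_det => [j i|j|j].
- have -> : (fun t => cover_mx t j i) = (fun t => \sum_(ab <- index_enum ('I_4 * 'I_4)%type)
     if (ab.1 < ab.2)%N then ((edge_lift D j ab.1 ab.2).1 == i)%:R * t ^ (- edge_expo D j ab.1 ab.2) *
       zeta (edge_kind ab.1 ab.2 - qd j) (z j) else 0).
    by apply/funext => t; rewrite mxE big_mkcond.
  apply: derivable_big_sum => ab; case: (ab.1 < ab.2)%N; last exact: derivable_cst.
  apply: derivableM; last exact: derivable_cst.
  apply: derivableM; first exact: derivable_cst.
  by case: (is_derive_exprz C (- edge_expo D j ab.1 ab.2)).
- rewrite cover_mx_row; under eq_bigr => ab _ do rewrite exp1rz mul1r.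
  by rewrite (sum_edge_kind (fun k => zeta (k - qd j) (z j))) sum_zeta_shift mul0rn.
- under eq_fun do rewrite cover_mx_row big_mkcond; rewrite big_mkcond.
  apply: is_derive_big_sum => ab; case: (ab.1 < ab.2)%N; last exact: is_derive_cst.
  have dX := is_derive_exprz C (- edge_expo D j ab.1 ab.2).
  apply: is_derive_eq (is_deriveM dX (is_derive_cst _ _ _)) _.
  by rewrite scaler0 add0r /GRing.scale /= mulrC.
Qed.

End OneLoop.

(** * The contribution of the flattening *)

Section FlatteningProduct.
Local Open Scope ring_scope.

Lemma prodrXz (F : fieldType) (I : Type) (r : seq I) (x : I -> F) (n : int) :
  \prod_(i <- r) x i ^ n = (\prod_(i <- r) x i) ^ n.
Proof. by rewrite (big_morph (fun y : F => y ^ n) (id1 := 1) (op1 := *%R)) ?exp1rz // => y y'; rewrite expfzMl. Qed.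

Lemma exprz_sum (F : fieldType) (I : Type) (r : seq I) (x : F) (n : I -> int) : x != 0 ->
  x ^ (\sum_(i <- r) n i) = \prod_(i <- r) x ^ n i.
Proof. by move=> x0; rewrite (big_morph (fun n : int => x ^ n) (id1 := 1) (op1 := *%R)) // => m m'; rewrite expfzDr. Qed.

Variables (R : realType) (N : nat) (T : triangulation N).
Local Notation C := (Cx R).
Variables (b : 'I_N) (alpha : seq 'I_4 -> int) (halpha : is_epimorphism T b alpha).
Variables (e : 'I_N -> oedge N) (hT : one_cusped T e) (L : nat) (D : lifts T b alpha e L).
Variables (qd : 'I_N -> 'I_3) (z : 'I_N -> C).
Variables (sigma : 'I_N -> 'I_4 -> 'I_4 -> 'I_4 -> C) (c : 'I_N -> 'I_4 -> 'I_4 -> C).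
Hypotheses (hs : cocycle T sigma) (hc : ptolemy_assignment T sigma c).
Variable mu : 'I_N -> C.
Hypothesis muP : forall j, mu j != 0 /\
  forall k, ptolemy_term (sigma j) (c j) k = mu j * zeta (k - qd j) (z j).

Lemma sqr_zeta_gluing j k :
  (zeta k (z j) * mu j) ^+ 2 = \prod_i (edge_value e c i ^+ 2) ^ gluing_mx T e qd k i j.
Proof.
have -> : zeta k (z j) * mu j = ptolemy_term (sigma j) (c j) (k + qd j).
  by rewrite (muP j).2 addrK mulrC.
rewrite (sqr_ptolemy_term hc halpha hT D) //.
rewrite (partition_big (fun ab : 'I_4 * 'I_4 => (edge_lift D j ab.1 ab.2).1) predT) //=.
apply: eq_bigr => i _; rewrite mxE -exprnP -prodr_const.
apply: eq_big => [[a d]|[a d] /andP[_ /eqP -> //]]; rewrite finset.in_set /= subr_eq -andbA.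
have [ad|] := ltnP a d; rewrite //= (on_edge_lift halpha hT D) //.
by apply: contraTneq ad => ->; rewrite ltnn.
Qed.

(** Raise [sqr_zeta_gluing] to the powers [f k j]: by the flattening equations, the exponents of
    [mu j] add up to 1 in each tetrahedron, those of the gluing matrix to 2 at each edge. *)
Lemma flattening_product (f : 'I_3 -> 'I_N -> int) : flattening R T e qd f ->
  (\prod_j \prod_(k < 3) zeta k (z j) ^ f k j * \prod_j mu j) ^+ 2 = (\prod_i edge_value e c i ^+ 2) ^+ 2.
Proof.
case=> f1 f2 _; rewrite -big_split -2!prodrXl /=.
transitivity (\prod_j \prod_k \prod_i (edge_value e c i ^+ 2) ^ (gluing_mx T e qd k i j * f k j)).
  apply: eq_bigr => j _; rewrite -[mu j]expr1z -(f1 j) exprz_sum ?(muP j).1 // -big_split -prodrXl.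
  apply: eq_bigr => k _ /=; rewrite -expfzMl [LHS]exprnP exprzAC.
  rewrite (sqr_zeta_gluing j k : (_ ^ 2%:Z = _)) -prodrXz.
  by apply: eq_bigr => i _; rewrite exprz_exp.
rewrite exchange_big; under eq_bigr => k _ do rewrite exchange_big.
rewrite exchange_big; apply: eq_bigr => i _ /=.
have v0' : edge_value e c i ^+ 2 != 0 by rewrite expf_neq0 // (edge_value_neq0 hc hT).
rewrite [RHS](_ : _ = (edge_value e c i ^+ 2) ^ (2 : int)) // -(f2 i) exprz_sum //; apply: eq_bigr => k _.
by rewrite exprz_sum.
Qed.

End FlatteningProduct.

Section CurveDeterminant.
Local Open Scope ring_scope.
Variables (R : realType) (N : nat) (T : triangulation N) (e : 'I_N -> oedge N).
Local Notation C := (Cx R).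
Variables (qd : 'I_N -> 'I_3) (z : 'I_N -> C).

Lemma curve_row_sum (g : curve N) (W : 'I_N -> 'I_3 -> C) :
  \sum_j \sum_k (curve_row qd g k j)%:~R * W j k =
  \sum_i (sign4 (avtx (carc g i)) (acor (carc g i)) (ain (carc g i)) (aout (carc g i)))%:~R *
    W (atet (carc g i)) (edge_kind (avtx (carc g i)) (acor (carc g i)) - qd (atet (carc g i))).
Proof.
rewrite pair_bigA [RHS](partition_big (fun i => (atet (carc g i),
  edge_kind (avtx (carc g i)) (acor (carc g i)) - qd (atet (carc g i)))) predT) //=.
apply: eq_bigr => -[j k] _ /=; rewrite rmorph_sum mulr_suml /=.
apply: eq_big => [i|i /andP[/eqP -> /eqP -> //]].
by rewrite xpair_eqE; case: eqP => // ->.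
Qed.

(** Expansion along the replaced row, whose cofactors are those of the original gluing matrix. *)
Lemma det_gluing_hat (g : curve N) (i0 : 'I_N) :
  \det (weight_mx z (gluing_hat T e qd i0 g)) =
  \sum_i (sign4 (avtx (carc g i)) (acor (carc g i)) (ain (carc g i)) (aout (carc g i)))%:~R *
    (zeta (edge_kind (avtx (carc g i)) (acor (carc g i)) - qd (atet (carc g i))) (z (atet (carc g i))) *
     cofactor (weight_mx z (gluing_mx T e qd)) i0 (atet (carc g i))).
Proof.
rewrite -(curve_row_sum g (fun j k => zeta k (z j) * cofactor (weight_mx z (gluing_mx T e qd)) i0 j)).
rewrite (expand_det_row _ i0); apply: eq_bigr => j _.
have -> : cofactor (weight_mx z (gluing_hat T e qd i0 g)) i0 j =
    cofactor (weight_mx z (gluing_mx T e qd)) i0 j.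
  rewrite /cofactor; congr (_ * \det _); apply/matrixP => i m; rewrite !mxE !weight_mxE.
  by apply: eq_bigr => l _; rewrite mxE lift_eqF.
rewrite weight_mxE mulr_suml; apply: eq_bigr => k _.
by rewrite mxE eqxx -[LHS]mulrA.
Qed.

End CurveDeterminant.

Local Open Scope classical_set_scope.
Local Open Scope ring_scope.

Theorem corollary3p8 (R : realType) (N : nat) (T : triangulation N)
    (e : 'I_N -> oedge N) (hT : one_cusped T e)
    (b : 'I_N) (alpha : seq 'I_4 -> int) (halpha : is_epimorphism T b alpha)
    (halphaP : peripherally_onto T b alpha)
    (sigma : 'I_N -> 'I_4 -> 'I_4 -> 'I_4 -> Cx R)
    (hsigma : obstruction_cocycle T b sigma)
    (qd : 'I_N -> 'I_3) (z : 'I_N -> Cx R) (hz : geometric_solution T b e qd z)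
    (c : 'I_N -> 'I_4 -> 'I_4 -> Cx R) (hc : ptolemy_assignment T sigma c)
    (hcz : forall j, ptolemy_shape (sigma j) (c j) = edge_shape qd z j v1 v3)
    (lambda : curve N) (hlambda : peripheral_curve R T lambda)
    (hlambda0 : alpha_vanishes T b alpha lambda)
    (i0 : 'I_N) (f : 'I_3 -> 'I_N -> int) (hf : flattening R T e qd f)
    (L : nat) (D : lifts T b alpha e L) :
  let rhs := (\prod_(i < N) edge_value e c i)^-1 *
             derive1 (fun t : Cx R =>
               \det (ptolemy_jacobian D sigma (ptolemy_point D c) t)) 1 in
  one_loop T e qd i0 lambda f z = rhs \/ one_loop T e qd i0 lambda f z = - rhs.
Proof.
move=> rhs; have [hs _] := hsigma; have [[z01 _ _] _] := hz.
have mu_ex j : exists m : Cx R, m != 0 /\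
    forall k, ptolemy_term (sigma j) (c j) k = m * zeta (k - qd j) (z j).
  have [z0 z1] := z01 j.
  by have [m m0 mP] := ptolemy_weights hs hc z0 z1 (hcz j); exists m.
have [mu muP] := choice mu_ex.
have ev0 := edge_value_neq0 hc hT.
pose x := ptolemy_point D c; pose P := \prod_(i < N) edge_value e c i.
have P0 : P != 0 by apply/prodf_neq0 => i _.
have xE : forall m, x 0 m = edge_value e c (var_class D m) := ptolemy_point_class c D.
have classl i : var_class D (lshift L i) = i by rewrite /var_class (unsplitK (inl i)).
have classr l : var_class D (rshift N l) = orb D l by rewrite /var_class (unsplitK (inr l)).
pose M := weight_mx z (gluing_mx T e qd).
(* These weights sum to 0 in a tetrahedron because the zeta parameters do, and around an edge
   because [M] times its adjugate is [\det M], which is 0. *)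
pose B j k := zeta (k - qd j) (z j) * cofactor M i0 j.
have detM : \det M = 0.
  rewrite -det_tr /M -(cover_mx1 halpha hT D) // (det_row_sums _ i0) big1 // => j _.
  rewrite (cover_mx_row D qd z 1 j); under eq_bigr => ab _ do rewrite exp1rz mul1r.
  by rewrite (sum_edge_kind (fun k => zeta (k - qd j) (z j))) sum_zeta_shift // mul0rn mul0r.
have JE t : \det (ptolemy_jacobian D sigma x t) =
    P^-1 * (\prod_j mu j) * \det (cover_mx D qd z t).
  apply: (mulIf P0); rewrite mulrC.
  have -> : P * \det (ptolemy_jacobian D sigma x t) = \prod_j mu j * \det (cover_mx D qd z t).
    rewrite mulrC; transitivity (\det (ptolemy_jacobian D sigma x t) * \prod_(i < N) x 0 (lshift L i)).
      by congr (_ * _); apply: eq_bigr => i _; rewrite xE classl.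
    rewrite jacobian_det => [|m|l]; last 2 first.
    - by rewrite xE.
    - by rewrite !xE classl classr.
    have -> : \prod_j mu j = \det (diag_mx (\row_j mu j)).
      by rewrite det_diag; apply: eq_bigr => j _; rewrite mxE.
    rewrite -det_mulmx mul_diag_mx; congr (\det _); apply/matrixP => j i; rewrite !mxE mulr_sumr.
    apply: eq_bigr => ab _; rewrite (ptolemy_term_point hc halpha hT) (muP j).2.
    by rewrite mulrCA.
  by rewrite [RHS]mulrC -!mulrA mulVKf.
have B_kinds j : \sum_k B j k = 0 by rewrite -mulr_suml sum_zeta_shift // mul0r.
have B_edges i : \sum_j \sum_(ab : 'I_4 * 'I_4 |
    (ab.1 < ab.2)%N && `[< on_edge T e (j, ab.1, ab.2) i >]) B j (edge_kind ab.1 ab.2) = 0.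
  transitivity (\sum_j M i j * cofactor M i0 j); last first.
    have := mul_mx_adj M => /matrixP/(_ i i0); rewrite detM !mxE mul0rn => h; rewrite -[RHS]h.
    by apply: eq_bigr => j _; rewrite mxE.
  apply: eq_bigr => j _; rewrite weight_mxE (gluing_sum halpha hT D qd (fun k => zeta k (z j))) mulr_suml.
  apply: eq_bigl => -[a d] /=; have [ad|//] := ltnP a d.
  by rewrite (on_edge_lift halpha hT D) //; apply: contraTneq ad => ->; rewrite ltnn.
have [eps [eps1 dual]] := weights_duality hT B_kinds B_edges halpha halphaP D hlambda hlambda0.
pose S := \sum_j \sum_(ab : 'I_4 * 'I_4 | (ab.1 < ab.2)%N)
  (edge_expo D j ab.1 ab.2)%:~R * B j (edge_kind ab.1 ab.2).
pose Phi := \prod_j \prod_(k < 3) zeta k (z j) ^ f k j.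
rewrite -/S /B -det_gluing_hat in dual.
(* The minus sign comes from the negative exponents of t in [cover_mx]. *)
have rhsE : rhs = - (P^-1 * (P^-1 * (\prod_j mu j) * S)).
  rewrite /rhs derive1E -mulrN; congr (_ * _).
  have -> : (fun t : Cx R => \det (ptolemy_jacobian D sigma (ptolemy_point D c) t)) =
      (P^-1 * \prod_j mu j) *: (fun t => \det (cover_mx D qd z t)) by apply/funext => t; apply: JE.
  have dC := cover_mx_derive halpha hT D qd z01 i0.
  have -> := @derive_val _ _ _ _ _ _ _ (is_deriveZ (P^-1 * \prod_j mu j) dC).
  rewrite -mulrN; congr (_ * _); rewrite /S -sumrN; apply: eq_bigr => j _.
  rewrite mulr_suml -sumrN; apply: eq_bigr => ab _.
  by rewrite rmorphN !mulNr -mulrA.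
have mu0 : \prod_j mu j != 0 by apply/prodf_neq0 => j _; case: (muP j).
have Phi0 : Phi != 0.
  apply/prodf_neq0 => j _; apply/prodf_neq0 => k _; have [z0 z1] := z01 j.
  by rewrite expfz_neq0 // zeta_neq0.
(* Only the squares of the two sides are known to agree, hence the sign ambiguity. *)
have PhiE : (Phi * \prod_j mu j == P ^+ 2) || (Phi * \prod_j mu j == - P ^+ 2).
  rewrite -eqf_sqr; apply/eqP; rewrite (flattening_product halpha hT D hs hc muP hf).
  by rewrite prodrXl.
have loopE : one_loop T e qd i0 lambda f z = eps * (S / Phi).
  rewrite /one_loop -/Phi -/(weight_mx z (gluing_hat T e qd i0 lambda)) 2!mulrA; congr (_ / _).
  have ee : eps * eps = 1 by case: eps1 => ->; rewrite ?mulrNN mulr1.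
  have -> : \det (weight_mx z (gluing_hat T e qd i0 lambda)) = eps * (S *+ 2).
    by rewrite dual mulrA ee mul1r.
  by rewrite mulrnAr -[X in _ * X]mulr_natl mulKf // pnatr_eq0.
have : rhs = S / Phi \/ rhs = - (S / Phi).
  rewrite rhsE; case/orP: PhiE => /eqP /(canRL (mulKf Phi0)) ->; [right|left].
    by clearbody P S Phi; field; rewrite P0 Phi0.
  by clearbody P S Phi; field; rewrite P0 Phi0.
by rewrite loopE; case: eps1 => -> [] ->; rewrite ?mulN1r ?mul1r ?opprK; [left|right|right|left].
Qed.
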